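(* Let $\mathbb{F}$ be an algebraically closed field and let $n\geq 2$. Then each of the groups ${\rm SL}_n(\mathbb{F})$ and ${\rm GL}_n(\mathbb{F})$ possesses the $R_\infty$-property if and only if $\mathbb{F}$ has characteristic zero and the transcendence degree of $\mathbb{F}$ over $\mathbb{Q}$ is finite.
   Context: For a group $G$ and an endomorphism $\varphi$ of $G$, elements $x,y\in G$ are $\varphi$-conjugated if $x=zy\varphi(z)^{-1}$ for some $z\in G$; this is an equivalence relation, whose classes are the $\varphi$-conjugacy (twisted conjugacy) classes. The Reidemeister number $R(\varphi)$ is the number of $\varphi$-conjugacy classes, an element of $\mathbb{N}\cup\{\infty\}$ (all infinite cardinals are identified with $\infty$). The Reidemeister spectrum of $G$ is $Spec_R(G)=\{R(\varphi)\mid \varphi \text{ an automorphism of } G\}$. $G$ possesses the $R_\infty$-property if $Spec_R(G)=\{\infty\}$. *)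

(* Defs.v *)
From HB Require Import structures.
From mathcomp Require Import all_boot all_order all_algebra.
Set Implicit Arguments. Unset Strict Implicit. Unset Printing Implicit Defensive.
Import Order.TTheory GRing.Theory Num.Theory.
Local Open Scope ring_scope.

(* A group of n x n matrices over F is given as a predicate H on 'M[F]_n,
   with group law matrix multiplication and inverse invmx. *)

Section MatGroups.
Variables (F : fieldType) (n : nat).
Local Notation M := 'M[F]_n.

Definition GLpred : M -> bool := fun A => A \in unitmx.
Definition SLpred : M -> bool := fun A => \det A == 1.

Definition is_group_aut (H : M -> bool) (phi : M -> M) : Prop :=
  [/\ (forall x, H x -> H (phi x)),
      (forall x y, H x -> H y -> phi x = phi y -> x = y),
      (forall y, H y -> exists x, H x /\ phi x = y)
    & (forall x y, H x -> H y -> phi (x *m y) = phi x *m phi y)].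

Definition twisted_conj (H : M -> bool) (phi : M -> M) (x y : M) : Prop :=
  exists z, H z /\ x = z *m y *m invmx (phi z).

(* R(phi) is finite: finitely many phi-conjugacy classes, i.e. a finite
   list of elements of H meets every class. *)
Definition reidemeister_finite (H : M -> bool) (phi : M -> M) : Prop :=
  exists s : seq M, (forall y, y \in s -> H y) /\
    (forall x, H x -> exists y, y \in s /\ twisted_conj H phi x y).

Definition R_infty_property (H : M -> bool) : Prop :=
  forall phi, is_group_aut H phi -> ~ reidemeister_finite H phi.

End MatGroups.

Section Transcendence.
Variable F : fieldType.

Inductive gen_subfield (s : seq F) : F -> Prop :=
  | gs_mem x : x \in s -> gen_subfield s x
  | gs_one : gen_subfield s 1
  | gs_add x y : gen_subfield s x -> gen_subfield s y -> gen_subfield s (x + y)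
  | gs_opp x : gen_subfield s x -> gen_subfield s (- x)
  | gs_mul x y : gen_subfield s x -> gen_subfield s y -> gen_subfield s (x * y)
  | gs_inv x : gen_subfield s x -> gen_subfield s (x^-1).

Definition algebraic_over (K : F -> Prop) (x : F) : Prop :=
  exists p : {poly F}, [/\ p != 0, forall i, K p`_i & root p x].

Definition alg_independent (s : seq F) : Prop :=
  forall i, (i < size s)%N -> ~ algebraic_over (gen_subfield (take i s)) (nth 0 s i).

Definition transcendence_basis (s : seq F) : Prop :=
  alg_independent s /\ forall x, algebraic_over (gen_subfield s) x.

Definition finite_trdeg : Prop := exists s : seq F, transcendence_basis s.

End Transcendence.

(* Main.v *)
Require Import Defs.
From HB Require Import structures.
From mathcomp Require Import all_boot all_order all_algebra.
From mathcomp Require Import perm cyclotomic separable.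
From mathcomp Require Import boolp classical_sets.
From mathcomp Require Import ring zify.
Set Implicit Arguments. Unset Strict Implicit. Unset Printing Implicit Defensive.
Import GRing.Theory.
Local Open Scope ring_scope.

(** If F carries a bijective endomorphism sigma for which every inhomogeneous scalar
    difference equation t = c0 + \sum_i c_i sigma^(i+1)(t) has a nonzero solution, then
    Lang's theorem holds for sigma acting on matrices, and R(sigma) = 1 on GL_n and SL_n.
    The Frobenius is such a sigma in positive characteristic; when the transcendence
    degree is infinite one is built by Zorn's lemma, reserving for each equation a block
    of elements of a transcendence basis.

    Conversely, in characteristic zero every automorphism of SL_n(F) is a field
    endomorphism sigma up to conjugation and inverse transpose. Comparing the classes of
    matrices with entries 1/p, p for infinitely many primes p produces, for sigma or its
    square, eigenvectors with multiplicatively independent rational eigenvalues; these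
    are algebraically independent. *)

(** * Algebraic closure as a pregeometry *)

(** The comparison of two classes is projective: test matrices are rescaled to determinant 1 by an
    n-th root, so they are intertwined only up to a scalar. That scalar cancels in a quotient of two
    entries of the intertwiner from different rows, which is why the ratio matrices differ from the
    identity in two rows and why the eigenvalues contain [b ^ 2]. The square of sigma belongs to the
    inverse-transpose case: there twisted conjugacy is a sigma-twisted congruence of bilinear forms,
    and passing from X to X X^-T removes the transpose at the price of applying sigma twice. In the
    construction of sigma the obstacle is circularity: a block can solve an equation only once the
    coefficients, themselves algebraic over other basis elements, lie in the domain. Basis elements
    are therefore indexed by an equation, a position and a natural number called rank, and a block
    is taken of rank above everything its coefficients involve; induction on the rank then applies.
    That a basis B has room for this indexing is cardinal arithmetic, derived from an injection of B
    x B into B. *)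

Definition subfield (F : fieldType) (K : F -> Prop) : Prop :=
  [/\ K 1, (forall x y, K x -> K y -> K (x + y)), (forall x, K x -> K (- x)),
      (forall x y, K x -> K y -> K (x * y)) & (forall x, K x -> K (x^-1))].

Section SubfieldType.
Variables (F : fieldType) (K : F -> Prop) (HK : subfield K).

Definition subfield_pred of subfield K : {pred F} := [pred x | `[<K x>]].
Local Notation S := (subfield_pred HK).

Lemma subfield_predP x : reflect (K x) (x \in S).
Proof. by rewrite inE; apply: asboolP. Qed.

Lemma subfield_divring_closed : divring_closed S.
Proof.
case: (HK) => K1 KD KN KM KV; split; first exact/subfield_predP.
  by move=> x y /subfield_predP Kx /subfield_predP Ky; apply/subfield_predP/KD/KN.
by move=> x y /subfield_predP Kx /subfield_predP Ky; apply/subfield_predP/KM/KV.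
Qed.

HB.instance Definition _ :=
  GRing.isDivringClosed.Build F S subfield_divring_closed.

(** Turning the predicate into an actual field gives the ring morphism [subfield_inc], over which
    the theory of algebraic and integral elements applies. *)
Record subfield_type := SubfieldElt {subfield_val : F; _ : subfield_val \in S}.
HB.instance Definition _ := [isSub for subfield_val].
HB.instance Definition _ := [Choice of subfield_type by <:].
HB.instance Definition _ := [SubChoice_isSubIntegralDomain of subfield_type by <:].
HB.instance Definition _ := [SubIntegralDomain_isSubField of subfield_type by <:].

Definition subfield_inc : {rmorphism subfield_type -> F} := val.

Lemma algebraic_overE x : algebraic_over K x <-> algebraicOver subfield_inc x.
Proof.
split=> [[p [p0 Kp px]]|[p p0 px]].
  pose q := \poly_(i < size p) SubfieldElt (introT (subfield_predP _) (Kp i)).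
  have pE : p = map_poly subfield_inc q.
    apply/polyP=> i; rewrite coef_map coef_poly; case: ltnP => // le_p_i.
    by rewrite nth_default ?rmorph0.
  by exists q; rewrite -?pE //; apply: contraNneq p0 => q0; rewrite pE q0 rmorph0.
exists (map_poly subfield_inc p); split=> // [|i]; first by rewrite map_poly_eq0.
by rewrite coef_map; apply/subfield_predP/valP.
Qed.

Lemma algebraic_over_subfield : subfield (algebraic_over K).
Proof.
split=> [|x y|x|x y|x].
- exact/algebraic_overE/algebraic1.
- by move=> /algebraic_overE ax /algebraic_overE ay; apply/algebraic_overE/algebraic_add.
- by move=> /algebraic_overE ax; apply/algebraic_overE/algebraic_opp.
- by move=> /algebraic_overE ax /algebraic_overE ay; apply/algebraic_overE/algebraic_mul.
- by move=> /algebraic_overE ax; apply/algebraic_overE/algebraic_inv.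
Qed.

Lemma algebraic_over_self x : K x -> algebraic_over K x.
Proof.
move=> /subfield_predP Kx; apply/algebraic_overE.
exact: (algebraic_id subfield_inc (SubfieldElt Kx)).
Qed.

(** Over a field algebraic means integral, and a root of a nonzero polynomial with integral
    coefficients is integral. *)
Lemma algebraic_over_trans (L : F -> Prop) x :
  (forall y, L y -> algebraic_over K y) -> algebraic_over L x -> algebraic_over K x.
Proof.
move=> LK [p [p0 Lp px]]; apply/algebraic_overE/integral_algebraic.
apply: (integral_root p0 px); apply/integral_poly => i.
exact/integral_algebraic/algebraic_overE/LK.
Qed.

End SubfieldType.

Definition subring (R : nzRingType) (A : R -> Prop) : Prop :=
  [/\ A 1, (forall x y, A x -> A y -> A (x + y)), (forall x, A x -> A (- x))
    & (forall x y, A x -> A y -> A (x * y))].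

Lemma subring0 (R : nzRingType) (A : R -> Prop) : subring A -> A 0.
Proof. by case=> A1 AD AN _; rewrite -(subrr 1); apply/AD/AN. Qed.

Lemma subring_sum (R : nzRingType) (A : R -> Prop) (I : Type) (r : seq I) (P : pred I) f :
  subring A -> (forall i, P i -> A (f i)) -> A (\sum_(i <- r | P i) f i).
Proof.
by move=> Asub; apply: big_ind; [exact: subring0 | case: Asub].
Qed.

Lemma subring_exp (R : nzRingType) (A : R -> Prop) x n : subring A -> A x -> A (x ^+ n).
Proof.
by case=> A1 _ _ AM Ax; elim: n => [|n IH]; rewrite ?expr0 // exprS; apply: AM.
Qed.

Lemma subfield_subring (F : fieldType) (K : F -> Prop) : subfield K -> subring K.
Proof. by case. Qed.

Section Generation.
Variable F : fieldType.
Implicit Types (s t : seq F) (x y : F) (K S T : F -> Prop).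

Lemma gen_subfieldP s : subfield (gen_subfield s).
Proof. by split; [exact: gs_one|exact: gs_add|exact: gs_opp|exact: gs_mul|exact: gs_inv]. Qed.

Lemma gen_subfield_min s K x :
  subfield K -> (forall y, y \in s -> K y) -> gen_subfield s x -> K x.
Proof. by case=> K1 KD KN KM KV sK; elim=> *; auto. Qed.

Lemma gen_subfield_frac s A x :
    subring A -> (forall y, y \in s -> A y) -> gen_subfield s x ->
  exists P Q, [/\ A P, A Q, Q != 0 & x = P / Q].
Proof.
move=> Asub sA; have [A1 AD AN AM] := Asub; have A0 := subring0 Asub.
have nz1 := oner_neq0 F.
elim=> [{}x /sA Ax||{}x y _ [P [Q [AP AQ Q0 ->]]] _ [P' [Q' [AP' AQ' Q'0 ->]]]
       |{}x _ [P [Q [AP AQ Q0 ->]]]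
       |{}x y _ [P [Q [AP AQ Q0 ->]]] _ [P' [Q' [AP' AQ' Q'0 ->]]]
       |{}x _ [P [Q [AP AQ Q0 ->]]]].
- by exists x, 1; rewrite divr1.
- by exists 1, 1; rewrite divr1.
- exists (P * Q' + P' * Q), (Q * Q'); rewrite mulf_neq0 ?addf_div //; split; auto.
- by exists (- P), Q; rewrite mulNr; split; auto.
- by exists (P * P'), (Q * Q'); rewrite mulf_neq0 ?mulf_div //; split; auto.
- have [->|P0] := eqVneq P 0; first by exists 0, 1; rewrite !mul0r invr0.
  by exists Q, P; rewrite invf_div.
Qed.

Lemma common_denominator A (f : nat -> F) n :
    subring A -> (forall i, exists P Q, [/\ A P, A Q, Q != 0 & f i = P / Q]) ->
  exists D, [/\ A D, D != 0 & forall i, (i < n)%N -> A (D * f i)].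
Proof.
move=> Asub fA; have [A1 AD AN AM] := Asub.
elim: n => [|n [D [AD' D0 Df]]]; first by exists 1; rewrite oner_neq0.
have [P [Q [AP AQ Q0 fE]]] := fA n.
exists (D * Q); rewrite mulf_neq0 //; split; auto=> i; rewrite ltnS leq_eqVlt.
case/predU1P=> [->|/Df ADi]; last by rewrite mulrAC; apply: AM.
by rewrite fE -mulrA (mulrC Q) divfK //; apply: AM.
Qed.

(** Clearing denominators moves the coefficients into a ring [A] with an explicit description:
    polynomial values in the exchange property, sums of eigenvectors in the independence
    argument. *)
Lemma algebraic_over_frac s A x :
    subring A -> (forall y, y \in s -> A y) -> algebraic_over (gen_subfield s) x ->
  exists p : {poly F}, [/\ p != 0, forall i, A p`_i & root p x].
Proof.
move=> Asub sA [p [p0 Kp px]].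
have [D [AD D0 Dp]] := common_denominator (size p) Asub
  (fun i => gen_subfield_frac Asub sA (Kp i)).
exists (D *: p); split=> [|i|]; first by rewrite scaler_eq0 negb_or D0.
  rewrite coefZ; case: (ltnP i (size p)) => [/Dp //|/(nth_default 0) ->].
  by rewrite mulr0; exact: subring0.
by rewrite rootE hornerZ (rootP px) mulr0.
Qed.

Definition acl s x := algebraic_over (gen_subfield s) x.

Lemma acl_subfield s : subfield (acl s).
Proof. exact/algebraic_over_subfield/gen_subfieldP. Qed.

Lemma acl_mem s x : x \in s -> acl s x.
Proof. by move=> xs; apply: algebraic_over_self (gen_subfieldP s) _ _; exact: gs_mem. Qed.

Lemma acl_trans s t x : (forall y, y \in t -> acl s y) -> acl t x -> acl s x.
Proof.
move=> ts; apply: algebraic_over_trans (gen_subfieldP s) _ _ _ => y.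
exact: gen_subfield_min (acl_subfield s) ts.
Qed.

Lemma acl_sub s t x : {subset s <= t} -> acl s x -> acl t x.
Proof. by move=> st; apply: acl_trans => y /st/acl_mem. Qed.

(** A relation for x over K(y) becomes, after clearing denominators, a polynomial relation between x
    and y over K. Reordered by powers of y it is a relation for y over K(x); were it trivial, some
    nonzero polynomial over K would vanish at x. *)
Lemma acl_exchange s x y : acl (y :: s) x -> ~ acl s x -> acl (x :: s) y.
Proof.
move=> yx nx; have [K1 KD KN KM KV] := gen_subfieldP s.
have Ksub := subfield_subring (gen_subfieldP s).
have K0 := subring0 Ksub.
pose A u := exists2 P : {poly F}, (forall i, gen_subfield s P`_i) & u = P.[y].
have Asub : subring A.
  split=> [|_ _ [P KP ->] [Q KQ ->]|_ [P KP ->]|_ _ [P KP ->] [Q KQ ->]].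
  - by exists 1; rewrite ?hornerC // => i; rewrite coef1; case: eqP.
  - by exists (P + Q); rewrite ?hornerD // => i; rewrite coefD; apply: KD.
  - by exists (- P); rewrite ?hornerN // => i; rewrite coefN; apply: KN.
  - exists (P * Q); rewrite ?hornerM // => i; rewrite coefM.
    by apply: subring_sum => // j _; apply: KM.
have sA u : u \in y :: s -> A u.
  case/predU1P=> [->|us]; first by exists 'X; rewrite ?hornerX // => i; rewrite coefX; case: eqP.
  exists u%:P; rewrite ?hornerC // => i; rewrite coefC; case: eqP => // _.
  exact: gs_mem.
have [p [p0 Ap px]] := algebraic_over_frac Asub sA yx.
have /choice [P PP] j : exists P : {poly F},
    (forall i, gen_subfield s P`_i) /\ p`_j = P.[y].
  by have [Q KQ E] := Ap j; exists Q.
have sub_s u : gen_subfield s u -> gen_subfield (x :: s) u.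
  by apply: gen_subfield_min (gen_subfieldP _) _ => v vs; apply: gs_mem; rewrite inE vs orbT.
have K'sub := subfield_subring (gen_subfieldP (x :: s)).
(* The variable of [q] is y; its i-th coefficient is a polynomial in x formed from the i-th
   coefficients of the [P j]. *)
pose q := \sum_(j < size p) x ^+ j *: P j.
exists q; split.
- apply: contra_notN nx => /eqP q0.
  have [j Pj0] : exists j : 'I_(size p), P j != 0.
    apply: contrapT => nP; case/eqP: p0; apply/polyP=> j; rewrite coef0.
    case: (ltnP j (size p)) => [ltj|/(nth_default 0) //]; rewrite (PP j).2.
    suff -> : P j = 0 by rewrite horner0.
    by apply/eqP/negPn/negP => Pj; apply: nP; exists (Ordinal ltj).
  have [i Pji] : exists i, (P j)`_i != 0.
    by exists (size (P j)).-1; rewrite -lead_coefE lead_coef_eq0.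
  exists (\poly_(k < size p) (P k)`_i); split.
  + by apply: contraNneq Pji => /polyP /(_ j); rewrite coef_poly ltn_ord coef0 => ->.
  + by move=> k; rewrite coef_poly; case: ifP => // _; apply: (PP k).1.
  + apply/eqP; rewrite horner_poly -[RHS](coef0 F i) -q0 coef_sum.
    by apply: eq_bigr => k _; rewrite coefZ mulrC.
- move=> i; rewrite coef_sum; apply: subring_sum => // j _; rewrite coefZ.
  apply: gs_mul; first by apply: subring_exp => //; apply: gs_mem; rewrite mem_head.
  exact/sub_s/(PP j).1.
- rewrite rootE horner_sum -[X in _ == X](rootP px) horner_coef; apply/eqP.
  by apply: eq_bigr => j _; rewrite hornerZ -(PP j).2 mulrC.
Qed.

(** Independence over a base list [c]. Each element is compared with those after it, so lists grow
    at the head; [alg_independent] compares with those before. *)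
Fixpoint indep_over c t : Prop :=
  if t is x :: t' then indep_over c t' /\ ~ acl (t' ++ c) x else True.

(** Dropping elements of [s] from the left, x leaves the closure at some y, and the exchange
    property applies there. *)
Lemma exchange_in u s x : acl (s ++ u) x -> ~ acl u x ->
  exists s1 y s2, s = s1 ++ y :: s2 /\ acl (x :: s1 ++ s2 ++ u) y.
Proof.
elim: s => [//|y s IH] /= sx nx; case: (pselect (acl (s ++ u) x)) => [sux|nsx].
  have [s1 [z [s2 [-> zE]]]] := IH sux nx; exists (y :: s1), z, s2; split=> //.
  by apply: acl_sub zE => w; rewrite !inE => /orP[] ->; rewrite ?orbT.
by exists [::], y, s; split=> //; apply: acl_exchange.
Qed.

(** Each element of [t] takes the place of one element of [s] without loss of generation; hence [t]
    is at most as long as [s]. *)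
Lemma steinitz c s t : indep_over c t -> (forall x, x \in t -> acl (s ++ c) x) ->
  exists s', (size s' + size t = size s)%N /\ forall x, x \in s -> acl (s' ++ t ++ c) x.
Proof.
elim: t => [|x t IH] /= => [_ _|[it nx] st].
  by exists s; rewrite addn0; split=> // x xs; apply: acl_mem; rewrite mem_cat xs.
have [||s' [szs' s's]] // := IH; first by move=> y yt; apply: st; rewrite inE yt orbT.
have s'x : acl (s' ++ t ++ c) x.
  apply: acl_trans (st x (mem_head _ _)) => y; rewrite mem_cat => /orP[/s's //|yc].
  by apply: acl_mem; rewrite !mem_cat yc !orbT.
have [s1 [y [s2 [s'E yE]]]] := exchange_in s'x nx.
exists (s1 ++ s2); split.
  by rewrite -szs' s'E !size_cat /= !addnS addSn.
move=> z /s's; apply: acl_trans => w; rewrite s'E -catA mem_cat => /orP[ws1|].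
  by apply: acl_mem; rewrite !mem_cat ws1.
rewrite cat_cons inE => /predU1P[->|ws2].
  apply: acl_sub yE => v; rewrite !(inE, mem_cat).
  by do !case: (_ \in _); rewrite ?orbT //; case: (v == x).
by apply: acl_mem; move: ws2; rewrite !(inE, mem_cat); do !case: (_ \in _); rewrite ?orbT.
Qed.

Lemma alg_independent_rcons s x :
  alg_independent s -> ~ acl s x -> alg_independent (rcons s x).
Proof.
move=> si nx i; rewrite size_rcons ltnS nth_rcons -cats1 => le_i.
case: ltngtP le_i => // [lti _|-> _]; last by rewrite take_size_cat.
by rewrite takel_cat ?(ltnW lti) //; apply: si.
Qed.

Lemma indep_over_rev t : indep_over [::] t -> alg_independent (rev t).
Proof.
elim: t => [//|x t IH] /= [/IH it nx]; rewrite rev_cons.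
apply: alg_independent_rcons it _ => tx; apply: nx; rewrite cats0.
by apply: acl_sub tx => y; rewrite mem_rev.
Qed.

Lemma finite_trdeg_indep_bounded : finite_trdeg F ->
  exists N, forall t, indep_over [::] t -> (size t <= N)%N.
Proof.
case=> s [_ sF]; exists (size s) => t it.
have [|s' [<- _]] := steinitz (s := s) it; last exact: leq_addl.
by move=> x _; rewrite cats0; apply: sF.
Qed.

Definition cl S x := exists s, (forall y, y \in s -> S y) /\ acl s x.

Lemma cl_self S x : S x -> cl S x.
Proof. by move=> Sx; exists [:: x]; split=> [y|]; [rewrite inE => /eqP -> | apply/acl_mem/mem_head]. Qed.

Lemma cl_subset S T x : (forall y, S y -> T y) -> cl S x -> cl T x.
Proof. by move=> ST [s [sS sx]]; exists s; split=> // y /sS/ST. Qed.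

Lemma cl_cover S (t : seq F) : (forall y, y \in t -> cl S y) ->
  exists s, (forall y, y \in s -> S y) /\ forall y, y \in t -> acl s y.
Proof.
elim: t => [|x t IH] tS; first by exists [::].
have [|s [sS st]] := IH; first by move=> y yt; apply: tS; rewrite inE yt orbT.
have [s' [s'S s'x]] := tS x (mem_head _ _).
exists (s' ++ s); split=> [y|y]; first by rewrite mem_cat => /orP[/s'S|/sS].
case/predU1P=> [->|/st]; first by apply: acl_sub s'x => z zs; rewrite mem_cat zs.
by apply: acl_sub => z zs; rewrite mem_cat zs orbT.
Qed.

Lemma cl_trans S T x : (forall y, T y -> cl S y) -> cl T x -> cl S x.
Proof.
move=> TS [t [tT tx]]; have [|s [sS st]] := @cl_cover S t; first by move=> y /tT/TS.
by exists s; split=> //; apply: acl_trans tx.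
Qed.

Lemma cl_subfield S : subfield (cl S).
Proof.
split.
- by exists [::]; split=> //; case: (acl_subfield [::]).
- move=> x y cx cy; have [|s [sS st]] := @cl_cover S [:: x; y].
    by move=> z; rewrite !inE => /orP[] /eqP ->.
  exists s; split=> //; case: (acl_subfield s) => _ + _ _ _; apply; apply: st;
    by rewrite !inE eqxx ?orbT.
- by move=> x [s [sS sx]]; exists s; split=> //; case: (acl_subfield s) => _ _ + _ _; apply.
- move=> x y cx cy; have [|s [sS st]] := @cl_cover S [:: x; y].
    by move=> z; rewrite !inE => /orP[] /eqP ->.
  exists s; split=> //; case: (acl_subfield s) => _ _ _ + _; apply; apply: st;
    by rewrite !inE eqxx ?orbT.
- by move=> x [s [sS sx]]; exists s; split=> //; case: (acl_subfield s) => _ _ _ _; apply.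
Qed.

Lemma cl_algebraic S x : algebraic_over (cl S) x -> cl S x.
Proof.
case=> p [p0 cp px]; have [|s [sS sp]] := @cl_cover S p.
  by move=> _ /(nthP 0) [i _ <-].
exists s; split=> //; apply: (@algebraic_over_trans _ _ (gen_subfieldP s) (acl s)) => //.
exists p; split=> // i; case: (ltnP i (size p)) => [lti|/(nth_default 0) ->].
  exact/sp/mem_nth.
exact: subring0 (subfield_subring (acl_subfield s)).
Qed.

Lemma cl_exchange S x y : cl (fun z => S z \/ z = y) x -> ~ cl S x ->
  cl (fun z => S z \/ z = x) y.
Proof.
case=> s [sS sx] nx; pose s' := [seq z <- s | `[< S z >]].
have s'S z : z \in s' -> S z by rewrite mem_filter => /andP[/asboolP].
have : acl (x :: s') y.
  apply: acl_exchange => [|s'x]; last by apply: nx; exists s'.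
  apply: acl_sub sx => z zs; rewrite inE mem_filter zs andbT.
  by have [Sz|->] := sS z zs; rewrite ?eqxx // asboolT ?orbT.
by exists (x :: s'); split=> // z; rewrite inE => /predU1P[->|/s'S]; [right|left].
Qed.

End Generation.

(** * Eigenvectors of a field endomorphism *)

Lemma natr_injective (F : fieldType) : [pchar F] =i pred0 -> injective (fun n => n%:R : F).
Proof.
move=> /GRing.pcharf0P F0 m n /eqP; wlog le_mn : m n / (m <= n)%N => [IH|] E.
  by case/orP: (leq_total m n) => le; [apply: IH | apply/esym/IH; rewrite // eq_sym].
apply/eqP; rewrite eqn_leq le_mn -subn_eq0 -F0 natrB // subr_eq0 eq_sym.
exact: E.
Qed.

Section Eigenvectors.
Variables (F : fieldType) (F0 : [pchar F] =i pred0) (sigma : {rmorphism F -> F}).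
Implicit Types (s : seq (F * F)) (x y u l : F).

Lemma natr_neq0 n : (0 < n)%N -> n%:R != 0 :> F.
Proof. by rewrite lt0n; move/GRing.pcharf0P: (F0) => ->. Qed.

(** Pairs of an eigenvalue and an eigenvector, possibly zero. The eigenvalues are fixed by sigma,
    which makes sigma linear over them, as the elimination of components requires. *)
Definition eigen_pairs s := forall z, z \in s -> sigma z.1 = z.1 /\ sigma z.2 = z.1 * z.2.

(** Each factor comes from applying [sigma - l] to the relation, which scales the vector of [z] by
    [z.1 - l]. *)
Lemma eigen_sum_eq0 s (r : seq F) (mu : F) : eigen_pairs s ->
    (forall l, l \in r -> sigma l = l) -> \sum_(z <- s) z.2 = 0 ->
  \sum_(z <- s) (\prod_(l <- r) (z.1 - l)) * z.2 = 0.
Proof.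
move=> se; elim: r => [|l r IH] rfix s0.
  by rewrite -[RHS]s0; apply: eq_bigr => z _; rewrite big_nil mul1r.
have {}IH := IH (fun l0 lr => rfix l0 (@mem_behead _ (l :: r) l0 lr)) s0.
have fixp z : z \in s -> sigma (\prod_(l <- r) (z.1 - l)) = \prod_(l <- r) (z.1 - l).
  move=> zs; rewrite rmorph_prod; apply: eq_big_seq => k kr.
  by rewrite rmorphB (se z zs).1 rfix // inE kr orbT.
have E : \sum_(z <- s) (\prod_(l <- r) (z.1 - l)) * (z.1 * z.2) = 0.
  have := congr1 sigma IH; rewrite rmorph0 rmorph_sum => E; rewrite -[RHS]E; apply: eq_big_seq => z zs.
  by rewrite rmorphM fixp // (se z zs).2.
rewrite (eq_bigr (fun z => (\prod_(l <- r) (z.1 - l)) * (z.1 * z.2)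
    - l * ((\prod_(l <- r) (z.1 - l)) * z.2))).
  by rewrite sumrB -mulr_sumr E IH mulr0 subrr.
by move=> z _; rewrite big_cons; ring.
Qed.

Lemma eigen_component_eq0 s mu : eigen_pairs s -> \sum_(z <- s) z.2 = 0 ->
  \sum_(z <- s | z.1 == mu) z.2 = 0.
Proof.
(* The product over the eigenvalues other than mu kills every other eigenspace and acts on that of
   mu by a nonzero scalar. *)
move=> se s0; pose r := [seq l <- map fst s | l != mu].
have rfix l : l \in r -> sigma l = l.
  by rewrite mem_filter => /andP[_ /mapP[z zs ->]]; exact: (se z zs).1.
have := eigen_sum_eq0 mu se rfix s0.
rewrite (bigID (fun z => z.1 == mu)) /= [X in _ + X]big_seq_cond.
rewrite [X in _ + X]big1 ?addr0; last first.
  move=> z /andP[zs zmu]; apply/eqP; rewrite mulf_eq0 prodf_seq_eq0; apply/orP; left.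
  by apply/hasP; exists z.1; [rewrite mem_filter zmu map_f | rewrite /= subrr].
rewrite (eq_bigr (fun z => \prod_(l <- r) (mu - l) * z.2)); last by move=> z /eqP ->.
rewrite -mulr_sumr => /eqP; rewrite mulf_eq0 => /orP[|/eqP //].
rewrite prodf_seq_eq0 => /hasP[l]; rewrite mem_filter => /andP[nl _] /=.
by rewrite subr_eq0 eq_sym (negPf nl).
Qed.

Lemma eigen_pred_eq0 s (P : pred F) : eigen_pairs s -> \sum_(z <- s) z.2 = 0 ->
  \sum_(z <- s | P z.1) z.2 = 0.
Proof.
move=> se s0; pose r := undup (map fst s).
transitivity (\sum_(mu <- r | P mu) \sum_(z <- s | z.1 == mu) z.2); last first.
  by rewrite big1 // => mu _; exact: eigen_component_eq0.
rewrite (exchange_big_dep (fun z => P z.1)) /= => [|mu z Pmu /eqP -> //].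
rewrite big_seq_cond [RHS]big_seq_cond; apply: eq_bigr => z /andP[zs Pz].
rewrite big_mkcond (bigD1_seq z.1) ?undup_uniq ?mem_undup ?map_f //= Pz eqxx /=.
rewrite big1 ?addr0 // => mu; rewrite eq_sym => /negPf ->; by rewrite andbF.
Qed.

(* [valuation_class b k l] : l is a rational number of b-adic valuation k *)
Definition valuation_class b k l := exists m n,
  [/\ ~~ (b %| m)%N, ~~ (b %| n)%N & l * n%:R = (b ^ k * m)%:R].

(** Homogeneous elements of degree [k], where the degree of an eigenvector is the b-adic valuation
    of its rational eigenvalue. The list may be empty, so 0 lies in every degree. *)
Definition graded b k x := exists s,
  [/\ eigen_pairs s, (forall z, z \in s -> valuation_class b k z.1) & x = \sum_(z <- s) z.2].

Lemma ndvdn_gt0 b m : ~~ (b %| m)%N -> (0 < m)%N.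
Proof. by case: m => //; rewrite dvdn0. Qed.

Lemma valuation_class_uniq b k k' l : prime b ->
  valuation_class b k l -> valuation_class b k' l -> k = k'.
Proof.
move=> b_pr [m [n [bm bn E]]] [m' [n' [bm' bn' E']]].
have [m0 n0 m'0 n'0] := And4 (ndvdn_gt0 bm) (ndvdn_gt0 bn) (ndvdn_gt0 bm') (ndvdn_gt0 bn').
have : (b ^ k * m * n' = b ^ k' * m' * n)%N.
  by apply: (natr_injective F0); rewrite natrM -E natrM -E' mulrAC.
move=> /(congr1 (logn b)).
have b0 j : (0 < b ^ j)%N by rewrite expn_gt0 prime_gt0.
rewrite !lognM ?muln_gt0 ?b0 // !pfactorK //.
have lg0 j : ~~ (b %| j)%N -> logn b j = 0%N by rewrite lognE => /negPf ->; rewrite !andbF.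
by rewrite !lg0 // !addn0.
Qed.

Lemma valuation_classM b k k' l l' : prime b -> valuation_class b k l ->
  valuation_class b k' l' -> valuation_class b (k + k') (l * l').
Proof.
move=> b_pr [m [n [bm bn E]]] [m' [n' [bm' bn' E']]]; exists (m * m')%N, (n * n')%N.
rewrite !Euclid_dvdM // !negb_or bm bm' bn bn'; split=> //.
by rewrite natrM mulrACA E E' -natrM expnD mulnACA.
Qed.

Lemma graded_opp b k x : graded b k x -> graded b k (- x).
Proof.
move=> [s [se sk ->]]; exists [seq (z.1, - z.2) | z <- s]; split.
- by move=> _ /mapP [z /se [e1 e2] ->] /=; rewrite rmorphN e2 mulrN.
- by move=> _ /mapP [z /sk ? ->].
- by rewrite big_map /= sumrN.
Qed.

Lemma graded_add b k x y : graded b k x -> graded b k y -> graded b k (x + y).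
Proof.
move=> [s [se sk ->]] [t [te tk ->]]; exists (s ++ t); split.
- by move=> z; rewrite mem_cat => /orP[/se|/te].
- by move=> z; rewrite mem_cat => /orP[/sk|/tk].
- by rewrite big_cat.
Qed.

Lemma graded_mul b k k' x y : prime b -> graded b k x -> graded b k' y ->
  graded b (k + k') (x * y).
Proof.
move=> b_pr [s [se sk ->]] [t [te tk ->]].
exists [seq (z.1 * w.1, z.2 * w.2) | z <- s, w <- t]; split.
- move=> _ /allpairsP [[z w] /= [/se [z1 z2] /te [w1 w2] ->]] /=.
  by rewrite !rmorphM z1 z2 w1 w2 mulrACA.
- by move=> _ /allpairsP [[z w] /= [/sk zk /tk wk ->]]; exact: valuation_classM.
- by rewrite big_distrlr big_allpairs_dep.
Qed.

Lemma graded1 b : prime b -> graded b 0 1.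
Proof.
move=> b_pr; exists [:: (1, 1)]; split=> [z|z|]; rewrite ?big_seq1 //.
  by rewrite inE => /eqP -> /=; rewrite rmorph1 mulr1.
rewrite inE => /eqP -> /=; exists 1%N, 1%N.
by rewrite dvdn1 (gtn_eqF (prime_gt1 b_pr)) mulr1.
Qed.

Lemma graded_subring b : prime b -> subring (graded b 0).
Proof.
move=> b_pr; split; [exact: graded1|exact: graded_add|exact: graded_opp|].
by move=> x y gx gy; rewrite -[0%N]addn0; exact: graded_mul.
Qed.

Lemma graded_exp b k u j : prime b -> graded b k u -> graded b (k * j) (u ^+ j).
Proof.
move=> b_pr gu; elim: j => [|j IH]; first by rewrite muln0; exact: graded1.
by rewrite exprS mulnS; exact: graded_mul.
Qed.

(** For k > 0 the degrees [k * j] are distinct, so selecting the eigenvalues of valuation [k * j] in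
    the whole relation isolates [y j]. *)
Lemma graded_direct b k N (y : nat -> F) : prime b -> (0 < k)%N ->
    (forall j, graded b (k * j) (y j)) -> \sum_(j < N) y j = 0 ->
  forall j, (j < N)%N -> y j = 0.
Proof.
move=> b_pr k0 /choice [s sP] y0 j ltj.
pose t := flatten [seq s i | i <- iota 0 N].
have te : eigen_pairs t.
  by move=> z /flatten_mapP [i _ zi]; have [se _ _] := sP i; exact: se.
have sumE (P : pred F) : \sum_(z <- t | P z.1) z.2 = \sum_(i < N) \sum_(z <- s i | P z.1) z.2.
  rewrite big_flatten big_map -[N in LHS]subn0.
  by rewrite (big_mkord xpredT (fun i => \sum_(z <- s i | P z.1) z.2)).
have t0 : \sum_(z <- t) z.2 = 0.
  by rewrite (sumE xpredT) -[RHS]y0; apply: eq_bigr => i _; have [_ _ ->] := sP i.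
pose P := fun l => `[< valuation_class b (k * j) l >].
have := eigen_pred_eq0 P te t0; rewrite sumE (bigD1 (Ordinal ltj)) //= [X in _ + X]big1 ?addr0.
  move=> E; have [_ sj ->] := sP j; rewrite -[RHS]E big_seq [RHS]big_seq_cond.
  by apply: eq_bigl => z; case: (boolP (z \in s j)) => // /sj zj; apply/esym/asboolP.
move=> i nij; rewrite big_seq_cond big_pred0 // => z; apply/negP => /andP[zi /asboolP zj].
have [_ /(_ z zi) zi' _] := sP i.
move/eqP: (valuation_class_uniq b_pr zi' zj); rewrite eqn_pmul2l // => /eqP ij.
by case/eqP: nij; apply: val_inj.
Qed.

(** Algebraicity would give a polynomial with coefficients of degree 0. Its terms at u lie in the
    distinct degrees [k * j], so each vanishes separately, the leading one included. *)
Lemma graded_not_acl b k u t : prime b -> (0 < k)%N -> u != 0 -> graded b k u ->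
  (forall x, x \in t -> graded b 0 x) -> ~ acl t u.
Proof.
move=> b_pr k0 u0 gu gt tu.
have [p [p0 gp pu]] := algebraic_over_frac (graded_subring b_pr) gt tu.
have py j : graded b (k * j) (p`_j * u ^+ j).
  by rewrite -[(k * j)%N]add0n; apply: graded_mul => //; apply: graded_exp.
have sp : ((size p).-1 < size p)%N by rewrite prednK // size_poly_gt0.
move: pu; rewrite /root horner_coef => /eqP pu.
have /eqP := graded_direct b_pr k0 py pu sp.
by rewrite mulf_eq0 expf_eq0 (negPf u0) andbF orbF -lead_coefE lead_coef_eq0 (negPf p0).
Qed.

(** The eigenvalue is b^2 times an integral power of a; the exponent is encoded as the difference
    [j - i] of natural numbers. *)
Definition prime_eigenvector a b u := [/\ prime b, b != a, u != 0 &
  exists l i j, sigma u = l * u /\ l * (a ^ i)%:R = (b ^ 2 * a ^ j)%:R].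

Lemma prime_eigenvector_graded a b b' u : prime a -> prime b' -> b' != a ->
  prime_eigenvector a b u -> graded b' (if b' == b then 2 else 0) u.
Proof.
move=> a_pr b'_pr b'a [b_pr ba u0 [l [i [j [su lE]]]]].
have ai0 : (a ^ i)%:R != 0 :> F by rewrite natr_neq0 // expn_gt0 prime_gt0.
have sl : sigma l = l.
  apply: (mulIf ai0); rewrite lE -[in LHS](rmorph_nat sigma (a ^ i)) -rmorphM lE.
  by rewrite rmorph_nat.
have b'a_ndvd k : ~~ (b' %| a ^ k)%N.
  by rewrite Euclid_dvdX // negb_and dvdn_prime2 // b'a.
exists [:: (l, u)]; split=> [z|z|]; rewrite ?big_seq1 // inE => /eqP -> //=.
case: eqP => [b'b|/eqP b'b].
  by rewrite b'b in b'a_ndvd *; exists (a ^ j)%N, (a ^ i)%N.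
exists (b ^ 2 * a ^ j)%N, (a ^ i)%N; rewrite expn0 mul1n Euclid_dvdM // negb_or.
by rewrite Euclid_dvdX // dvdn_prime2 // (negPf b'b) b'a_ndvd.
Qed.

(* The eigenvalues b^2 a^e for distinct primes b are multiplicatively independent,
   which makes the eigenvectors algebraically independent. *)
Lemma eigenvectors_infinite_trdeg a : prime a ->
  (forall M, exists b u, (M < b)%N /\ prime_eigenvector a b u) -> ~ finite_trdeg F.
Proof.
move=> a_pr inf /finite_trdeg_indep_bounded [N bounded].
suff [t [M [szt it _]]] : exists t M, [/\ size t = N.+1, indep_over [::] t &
    forall x, x \in t -> exists2 b, (b <= M)%N & prime_eigenvector a b x].
  by have := bounded t it; rewrite szt ltnn.
elim: N.+1 => {N bounded} [|n [t [M [szt it tM]]]]; first by exists [::], 0%N.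
(* With b above all primes used so far, the earlier eigenvectors have b-degree 0 and the new one has
   b-degree 2. *)
have [b [u [ltMb ub]]] := inf M; have [b_pr ba u0 _] := ub.
exists (u :: t), b; split=> /=; rewrite ?szt //; last first.
  move=> x; rewrite inE => /predU1P[->|/tM [b' leb' xb']]; first by exists b.
  by exists b' => //; exact: leq_trans leb' (ltnW ltMb).
split=> //; rewrite cats0; apply: (graded_not_acl (k := 2) b_pr) => //.
  by have := prime_eigenvector_graded a_pr b_pr ba ub; rewrite eqxx.
move=> x /tM [b' leb' xb']; have := prime_eigenvector_graded a_pr b_pr ba xb'.
by rewrite gtn_eqF // (leq_ltn_trans leb').
Qed.

End Eigenvectors.

(** * Generation of SL_n by transvections *)

Definition transvection (F : fieldType) n (i j : 'I_n) (a : F) : 'M[F]_n :=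
  1%:M + a *: delta_mx i j.

Section Generation.
Variable F : fieldType.

Lemma transvectionD n (i j : 'I_n) (a b : F) : i != j ->
  transvection i j a *m transvection i j b = transvection i j (a + b).
Proof.
move=> ij; rewrite /transvection mulmxDl !mulmxDr !mul1mx mulmx1 -scalemxAl -scalemxAr.
by rewrite mul_delta_mx_0 1?eq_sym // !scaler0 addr0 scalerDl -addrA (addrC (b *: _)).
Qed.

Lemma transvection0 n (i j : 'I_n) : transvection i j (0 : F) = 1%:M.
Proof. by rewrite /transvection scale0r addr0. Qed.

Lemma transvection_mulE n (i j : 'I_n) (a : F) (x : 'M_n) k l :
  (transvection i j a *m x) k l = x k l + (k == i)%:R * a * x j l.
Proof.
rewrite /transvection mulmxDl mul1mx -scalemxAl !mxE; congr (_ + _).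
rewrite (bigD1 j) //= mxE eqxx andbT big1 ?addr0 => [|p pj]; first by rewrite mulrA (mulrC a).
by rewrite mxE (negPf pj) andbF mul0r.
Qed.

Lemma det_transvection n (i j : 'I_n) (a : F) : i != j -> \det (transvection i j a) = 1.
Proof.
have low (k l : 'I_n) b : (l < k)%N -> \det (transvection k l b) = 1.
  move=> lk; rewrite det_trig.
    rewrite big1 // => p _; rewrite !mxE eqxx; case: eqP => [->|]; last by rewrite mulr0 addr0.
    by rewrite -val_eqE (gtn_eqF lk) mulr0 addr0.
  apply/is_trig_mxP => p q pq; rewrite !mxE -val_eqE (ltn_eqF pq) add0r.
  case: eqP => [pk|]; last by rewrite mulr0.
  case: eqP => [ql|]; last by rewrite mulr0.
  by move: pq; rewrite pk ql ltnNge ltnW.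
move=> ij; case: (ltngtP j i) => [/low //|ji|/val_inj E]; last by rewrite E eqxx in ij.
by rewrite -det_tr raddfD /= trmx1 linearZ /= trmx_delta; apply: low.
Qed.

(** Gaussian elimination. A matrix with corner entry 1 factors into lower unipotent, block diagonal
    and upper unipotent parts; transvections bring the corner to 1. *)
Lemma sl_block_gen n (H : 'M[F]_(1 + n) -> Prop) :
    H 1%:M -> (forall x y, H x -> H y -> H (x *m y)) ->
    (forall i j a, i != j -> H (transvection i j a)) ->
    (forall D : 'M_n, \det D = 1 -> H (block_mx 1%:M 0 0 D)) ->
  forall x, \det x = 1 -> H x.
Proof.
move=> H1 HM HT HD.
have Hcol c : H (block_mx 1%:M 0 c 1%:M).
  rewrite [c]matrix_sum_delta exchange_big big_ord1 /=.
  apply: (big_ind (fun c => H (block_mx 1%:M 0 c 1%:M))) => [|c1 c2 h1 h2|i _].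
  - by rewrite -scalar_mx_block.
  - have := HM _ _ h1 h2.
    by rewrite mulmx_block !(mul0mx, mulmx0, mul1mx, mulmx1, addr0, add0r).
  - suff <- : transvection (rshift 1 i) (lshift n ord0) (c i 0) =
      block_mx 1%:M 0 (c i 0 *: delta_mx i 0) 1%:M by apply: HT.
    rewrite /transvection scalar_mx_block.
    have -> : delta_mx (rshift 1 i) (lshift n ord0) =
       block_mx 0 0 (delta_mx i 0) 0 :> 'M[F]_(1 + n).
      by rewrite delta_mx_dshift delta_mx_lshift /block_mx row_mx0.
    by rewrite scale_block_mx add_block_mx !scaler0 !addr0 add0r.
have Hrow r : H (block_mx 1%:M r 0 1%:M).
  rewrite [r]matrix_sum_delta big_ord1 /=.
  apply: (big_ind (fun r => H (block_mx 1%:M r 0 1%:M))) => [|c1 c2 h1 h2|i _].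
  - by rewrite -scalar_mx_block.
  - have := HM _ _ h2 h1.
    by rewrite mulmx_block !(mul0mx, mulmx0, mul1mx, mulmx1, addr0, add0r).
  - suff <- : transvection (lshift n ord0) (rshift 1 i) (r 0 i) =
      block_mx 1%:M (r 0 i *: delta_mx 0 i) 0 1%:M by apply: HT.
    rewrite /transvection scalar_mx_block.
    have -> : delta_mx (lshift n ord0) (rshift 1 i) =
       block_mx 0 (delta_mx 0 i) 0 0 :> 'M[F]_(1 + n).
      by rewrite delta_mx_ushift delta_mx_rshift /block_mx row_mx0.
    by rewrite scale_block_mx add_block_mx !scaler0 !addr0 add0r.
have Hone (x : 'M_(1 + n)) : ulsubmx x = 1%:M -> \det x = 1 -> H x.
  move=> x1 dx; pose D := drsubmx x - dlsubmx x *m ursubmx x.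
  have xE : x = block_mx 1%:M 0 (dlsubmx x) 1%:M *m block_mx 1%:M 0 0 D
                *m block_mx 1%:M (ursubmx x) 0 1%:M.
    rewrite !mulmx_block !(mul0mx, mulmx0, mul1mx, mulmx1, addr0, add0r) addrC subrK.
    by rewrite -{1}x1 submxK.
  rewrite xE; apply: (HM) => //; apply: (HM) => //; apply: HD.
  move: dx; rewrite xE !det_mulmx !det_lblock det_ublock !det1 !mulr1 !mul1r.
  by [].
have Hred i j a x : i != j -> H (transvection i j a *m x) -> H x.
  move=> ij Hx; have := HM _ _ (HT _ _ (- a) ij) Hx.
  by rewrite mulmxA transvectionD // addNr transvection0 mul1mx.
(* A nonzero entry below the corner lets a single row operation turn the corner into 1. *)
have Hpivot (x : 'M_(1 + n)) (i : 'I_(1 + n)) : i != 0 -> x i 0 != 0 -> \det x = 1 -> H x.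
  move=> i0 xi0 dx; have i0' : 0 != i by rewrite eq_sym.
  apply: (Hred 0 i ((1 - x 0 0) / x i 0) x i0'); apply: Hone.
    rewrite [LHS]mx11_scalar; congr (_%:M); rewrite [LHS]mxE [LHS]mxE.
    rewrite (_ : lshift n 0 = 0); last exact: val_inj.
    by rewrite transvection_mulE eqxx mul1r divfK // addrC subrK.
  by rewrite det_mulmx det_transvection // mul1r.
move=> x dx; have [/existsP [i /andP [i0 xi0]]|] := boolP [exists i, (i != 0) && (x i 0 != 0)].
  exact: Hpivot xi0 dx.
rewrite negb_exists => /forallP x0.
have x0E i : i != 0 -> x i 0 = 0 by move=> i0; have := x0 i; rewrite i0 negbK => /eqP.
have dlx : dlsubmx x = 0.
  apply/matrixP => i j; rewrite !mxE (_ : lshift n j = 0); last by rewrite ord1; apply: val_inj.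
  by rewrite x0E.
have := dx; rewrite -{1}[x]submxK dlx det_ublock => dx'.
(* The first column is now zero below the corner, so the corner is nonzero. In size 1 it is the
   determinant 1; otherwise adding the first row to the second creates the entry that [Hpivot] asks
   for. *)
case: n x H H1 HM HT HD Hcol Hrow Hone Hred Hpivot x0 x0E dlx dx dx'.
  move=> x H _ _ _ _ _ _ Hone _ _ _ _ _ dx; rewrite det_mx00 mulr1 => dx'.
  by apply: Hone => //; rewrite [ulsubmx x]mx11_scalar -[in RHS]dx' det_mx11.
move=> n' x H _ _ _ _ _ _ _ Hred Hpivot _ x0E _ dx dx'.
pose i : 'I_(1 + n'.+1) := rshift 1 ord0.
apply: (Hred i 0 1) => //; apply: (Hpivot _ i) => //.
  rewrite transvection_mulE eqxx x0E // add0r !mul1r.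
  apply/eqP => x00; move/eqP: dx'; rewrite det_mx11 !mxE.
  rewrite (_ : lshift n'.+1 0 = 0); last exact: val_inj.
  by rewrite x00 mul0r eq_sym oner_eq0.
by rewrite det_mulmx det_transvection // mul1r.
Qed.

Lemma sl_gen n (H : 'M[F]_n -> Prop) :
    H 1%:M -> (forall x y, H x -> H y -> H (x *m y)) ->
    (forall i j a, i != j -> H (transvection i j a)) ->
  forall x, \det x = 1 -> H x.
Proof.
elim: n H => [|n IH] H H1 HM HT.
  by move=> x _; rewrite flatmx0 -(flatmx0 1%:M).
apply: (@sl_block_gen n H) => // D.
refine (IH (fun D => H (block_mx (1%:M : 'M_1) 0 0 D)) _ _ _ D).
- by rewrite -scalar_mx_block.
- move=> x y hx hy; have := HM _ _ hx hy.
  by rewrite (@mulmx_block F 1 n 1 n 1 n) !(mul0mx, mulmx0, mul1mx, mulmx1, addr0, add0r).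
- move=> i j a ij.
  suff <- : transvection (rshift 1 i) (rshift 1 j) a = block_mx 1%:M 0 0 (transvection i j a).
    by apply: HT; rewrite (inj_eq (@rshift_inj 1 n)).
  rewrite /transvection (scalar_mx_block 1 n).
  have -> : delta_mx (rshift 1 i) (rshift 1 j) =
       block_mx 0 0 0 (delta_mx i j) :> 'M[F]_(1 + n).
    by rewrite delta_mx_dshift delta_mx_rshift /block_mx row_mx0.
  by rewrite scale_block_mx add_block_mx !scaler0 !addr0.
Qed.

End Generation.

(** * Automorphisms of SL_n *)

Section GroupAut.
Variables (F : fieldType) (n : nat).
Local Notation M := 'M[F]_n.
Local Notation SL_aut := (is_group_aut (@SLpred F n)).
Implicit Types (phi : M -> M) (x y : M).

Lemma det1_unitmx x : \det x = 1 -> x \in unitmx.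
Proof. by move=> dx; rewrite unitmxE dx unitr1. Qed.

Lemma det_invmx1 x : \det x = 1 -> \det (invmx x) = 1.
Proof. by move=> dx; rewrite det_inv dx invr1. Qed.

Lemma invmx_mul x y : x \in unitmx -> y \in unitmx ->
  invmx (x *m y) = invmx y *m invmx x.
Proof.
move=> ux uy; have uxy : x *m y \in unitmx by rewrite unitmx_mul ux.
apply: (can_inj (mulmxK uxy)); rewrite mulVmx // -mulmxA (mulmxA (invmx x)).
by rewrite mulVmx // mul1mx mulVmx.
Qed.

Section Facts.
Variables (phi : M -> M) (aut : SL_aut phi).

Lemma autSL x : \det x = 1 -> \det (phi x) = 1.
Proof. by case: aut => + _ _ _ => /(_ x); rewrite /SLpred => h /eqP /h /eqP. Qed.

Lemma autI x y : \det x = 1 -> \det y = 1 -> phi x = phi y -> x = y.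
Proof. by case: aut => _ + _ _ dx dy; apply; apply/eqP. Qed.

Lemma autS y : \det y = 1 -> exists2 x, \det x = 1 & phi x = y.
Proof. by case: aut => _ _ + _ /eqP dy => /(_ y dy) [x [/eqP dx <-]]; exists x. Qed.

Lemma autM x y : \det x = 1 -> \det y = 1 -> phi (x *m y) = phi x *m phi y.
Proof. by case: aut => _ _ _ + dx dy; apply; apply/eqP. Qed.

Lemma aut1 : phi 1%:M = 1%:M.
Proof.
have d1 := det1 F n; have u := det1_unitmx (autSL d1).
have := autM d1 d1; rewrite mulmx1 => /(congr1 (mulmx (invmx (phi 1%:M)))).
by rewrite mulKmx // mulVmx.
Qed.

Lemma aut_comm x y : \det x = 1 -> \det y = 1 ->
  (phi x *m phi y = phi y *m phi x) <-> (x *m y = y *m x).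
Proof.
move=> dx dy; rewrite -!autM //; split=> [|-> //]; apply: autI; by rewrite det_mulmx dx dy mulr1.
Qed.

Lemma aut_conj P : P \in unitmx -> SL_aut (fun x => P *m phi x *m invmx P).
Proof.
move=> uP; have dP : \det P * \det (invmx P) = 1 by rewrite -det_mulmx mulmxV // det1.
have dconj x : \det (P *m x *m invmx P) = \det x.
  by rewrite !det_mulmx mulrAC dP mul1r.
split; rewrite /SLpred.
- by move=> x /eqP /autSL dx; rewrite dconj dx.
- move=> x y /eqP dx /eqP dy E; apply: autI => //.
  by apply: (can_inj (mulKmx uP)); apply: (can_inj (mulmxK _)) E; rewrite unitmx_inv.
- move=> y /eqP dy; have [|x dx xE] := @autS (invmx P *m y *m P).
    by rewrite !det_mulmx mulrAC (mulrC (\det _)) dP mul1r.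
  exists x; rewrite dx xE; split=> //.
  by rewrite !mulmxA mulmxV // mul1mx mulmxK.
- move=> x y /eqP dx /eqP dy; rewrite autM // !mulmxA; congr (_ *m _ *m _).
  by rewrite mulmxKV.
Qed.

Lemma aut_contragredient : SL_aut (fun x => (invmx (phi x))^T).
Proof.
have dtr x : \det x = 1 -> \det (invmx x)^T = 1 by move=> dx; rewrite det_tr det_invmx1.
split; rewrite /SLpred.
- by move=> x /eqP /autSL /dtr ->.
- move=> x y /eqP dx /eqP dy /trmx_inj /(can_inj (@invmxK _ _)); exact: autI.
- move=> y /eqP dy; have [x dx xE] := autS (dtr _ dy).
  exists x; rewrite dx xE; split=> //.
  by rewrite trmx_inv trmxK invmxK.
- move=> x y /eqP dx /eqP dy; rewrite autM // invmx_mul ?trmx_mul // ?det1_unitmx ?autSL //.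
Qed.

End Facts.

Lemma diag_mx_comm (t x : M) : is_diag_mx t -> is_diag_mx x -> t *m x = x *m t.
Proof. by move=> /diag_mxP [d ->] /diag_mxP [e ->]; exact: diag_mxC. Qed.

Lemma comm_diag_offdiag (t : M) x i j : is_diag_mx t -> t *m x = x *m t ->
  (t i i == t j j) || (x i j == 0).
Proof.
move=> /diag_mxP [d ->] /matrixP /(_ i j); rewrite mul_diag_mx mul_mx_diag !mxE !eqxx /= !mulr1n.
by move/eqP; rewrite (mulrC _ (d 0 j)) -subr_eq0 -mulrBl mulf_eq0 subr_eq0.
Qed.

(** This describes the diagonal matrices as a centralizer, a notion that group automorphisms
    respect. *)
Lemma regular_comm_diag (t : M) x : is_diag_mx t -> (forall i j, i != j -> t i i != t j j) ->
  t *m x = x *m t <-> is_diag_mx x.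
Proof.
move=> dt treg; split=> [tx|dx]; last exact: diag_mx_comm.
apply/is_diag_mxP => i j; rewrite val_eqE => /treg tij.
by have := comm_diag_offdiag i j dt tx; rewrite (negPf tij) => /eqP.
Qed.

Lemma transvection_comm_diag (t : M) i j a : is_diag_mx t -> t i i = t j j ->
  t *m transvection i j a = transvection i j a *m t.
Proof.
move=> /diag_mxP [d ->]; rewrite !mxE !eqxx !mulr1n => dij.
rewrite /transvection mulmxDl mulmxDr mul1mx mulmx1 -scalemxAl -scalemxAr.
congr (_ + _ *: _); apply/matrixP => k l; rewrite mul_diag_mx mul_mx_diag !mxE mulrC.
by case: (k =P i) => [->|_]; case: (l =P j) => [->|_]; rewrite ?dij ?mul0r ?mulr0.
Qed.

Lemma transvectionE i j (a : F) k l :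
  (transvection i j a : M) k l = (k == l)%:R + a * ((k == i) && (l == j))%:R.
Proof. by rewrite !mxE. Qed.

Lemma transvection_offdiag i j (a : F) : i != j -> (transvection i j a : M) i j = a.
Proof. by move=> ij; rewrite transvectionE (negPf ij) !eqxx mulr1 add0r. Qed.

Lemma transvection_diagE i j (a : F) : i != j ->
  is_diag_mx (transvection i j a : M) -> a = 0.
Proof. by move=> ij /is_diag_mxP /(_ i j); rewrite val_eqE transvection_offdiag //; apply. Qed.

Lemma transvection_opposite_ncomm i j (a b : F) : i != j -> a != 0 -> b != 0 ->
  (transvection i j a : M) *m transvection j i b != transvection j i b *m transvection i j a.
Proof.
move=> ij a0 b0; apply/eqP => /matrixP /(_ i i); rewrite !transvection_mulE.
rewrite !transvectionE !eqxx /= (negPf ij) !(eq_sym j) (negPf ij) /=.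
rewrite !(mul0r, mulr0, mul1r, addr0, add0r, mulr1) => /eqP.
by rewrite -[X in _ == X]addr0 (inj_eq (addrI _)) mulf_eq0 (negPf a0) (negPf b0).
Qed.

End GroupAut.

(** * The image of the diagonal torus *)

Section Torus.
Variables (F : closedFieldType) (F0 : [pchar F] =i pred0).

Lemma nth_roots_of_unity k : (0 < k)%N ->
  exists r : seq F, uniq r /\ 'X^k - 1 = \prod_(z <- r) ('X - z%:P).
Proof.
move=> k0; have [r rE] := closed_field_poly_normal ('X^k - 1 : {poly F}).
exists r; rewrite (monicP _) ?scale1r in rE; last exact: monicXnsubC.
by split=> //; rewrite -separable_prod_XsubC -rE separable_Xn_sub_1 // (natr_neq0 F0).
Qed.

(** The minimal polynomial divides X^k - 1, which has simple roots in characteristic zero. *)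
Lemma torsion_diagonalizable n (s : 'M[F]_n.+1) k : (0 < k)%N -> s ^+ k = 1 ->
  exists2 P, P \in unitmx & is_diag_mx (P *m s *m invmx P).
Proof.
move=> k0 sk; have [r [ur rE]] := nth_roots_of_unity k0.
suff /(diagonalizableP s) [P uP] : exists2 rs, uniq rs & mxminpoly s %| \prod_(x <- rs) ('X - x%:P).
  move=> /diagonalizable_forPex [D /(simmxRL uP) DE]; exists P => //.
  by rewrite -DE diag_mx_is_diag.
exists r => //; rewrite -rE; apply: mxminpoly_min.
by rewrite rmorphB rmorphXn rmorph1 /= horner_mx_X sk subrr.
Qed.

Lemma diag_mx_exp n (d : 'rV[F]_n.+1) k : diag_mx d ^+ k = diag_mx (\row_i d 0 i ^+ k).
Proof.
elim: k => [|k IH].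
  by rewrite expr0; apply/matrixP => i j; rewrite !mxE expr0; case: eqP.
rewrite exprS IH -mulmxE mulmx_diag; congr diag_mx.
by apply/rowP => i; rewrite !mxE exprS.
Qed.

(** Finite order survives an automorphism and makes the image diagonalizable; distinct diagonal
    entries make the centralizer the torus. *)
Lemma exists_regular_torsion n : exists (t : 'M[F]_n.+1) k,
  [/\ is_diag_mx t, \det t = 1, forall i j, i != j -> t i i != t j j, (0 < k)%N & t ^+ k = 1].
Proof.
set N := n.+1; have [r [ur rE]] := @nth_roots_of_unity N isT.
have szr : size r = N.
  by move/(congr1 (fun p => size (p : {poly F}))): rE; rewrite size_XnsubC // size_prod_XsubC => -[].
have rN z : z \in r -> z ^+ N = 1.
  rewrite -root_prod_XsubC -rE rootE !hornerE subr_eq0 => /eqP.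
  by [].
pose c := \prod_(z <- r) z.
have cN : c ^+ N = 1.
  by rewrite /c -prodrXl big_seq big1 // => z /rN.
(* Scaling the N-th roots of unity by [d] gives determinant 1. Their product [c] is itself an N-th
   root of unity, so the exponent N * N suffices. *)
have [d dE] : exists d, d ^+ N = c^-1.
  have := @solve_monicpoly F N (fun i => if i == 0%N then c^-1 else 0) isT.
  case=> d dE; exists d; rewrite [LHS]dE big_ord_recl /= expr0 mulr1 big1 ?addr0 //.
  by move=> i _; rewrite mul0r.
have c0 : c != 0 by apply/eqP => c0; move/eqP: cN; rewrite c0 expr0n eq_sym oner_eq0.
have d0 : d != 0.
  by apply/eqP => d0; move/eqP: dE; rewrite d0 expr0n eq_sym invr_eq0 (negPf c0).
exists (diag_mx (\row_i (d * r`_i))), (N * N)%N; split=> //.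
- rewrite det_diag; under eq_bigr do rewrite mxE.
  rewrite big_split /= prodr_const card_ord dE -(big_mkord xpredT (fun i => r`_i)) -szr -(big_nth 0 xpredT id).
  by rewrite mulVf.
- move=> i j ij; rewrite !mxE !eqxx !mulr1n (inj_eq (mulfI d0)) nth_uniq ?szr //.
- rewrite diag_mx_exp; apply/matrixP => i j; rewrite !mxE; congr (_ *+ _).
  by rewrite exprMn !exprM dE (rN r`_i) ?mem_nth ?szr // exprVn cN invr1 expr1n mulr1.
Qed.

Lemma torus_normalization n (phi : 'M[F]_n.+1 -> 'M[F]_n.+1) :
    is_group_aut (@SLpred F n.+1) phi ->
  exists2 P, P \in unitmx &
    forall x, \det x = 1 -> is_diag_mx x <-> is_diag_mx (P *m phi x *m invmx P).
Proof.
move=> aut; have [t [k [dgt dt treg k0 tk]]] := exists_regular_torsion n.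
have dtj j : \det (t ^+ j) = 1.
  elim: j => [|j IH]; first by rewrite expr0 det1.
  by rewrite exprS det_mulmx dt IH mulr1.
have phitk : (phi t) ^+ k = 1.
  have -> : (phi t) ^+ k = phi (t ^+ k).
    elim: (k) => [|j IH]; first by rewrite !expr0 (aut1 aut).
    by rewrite !exprS IH [RHS]autM.
  by rewrite tk; exact: aut1.
have [P uP dP] := torsion_diagonalizable k0 phitk; exists P => //.
have autP := aut_conj aut uP; set psi := (fun x => _) in autP.
(* If two diagonal entries of [psi t] agreed, the opposite transvections at (i, j) and (j, i) would
   commute with [psi t]. Their preimages would commute with [t], hence be diagonal and commute with
   each other, which the transvections do not. *)
have psireg i j : i != j -> psi t i i != psi t j j.
  move=> ij; apply/negP => /eqP psiij.
  have /(_ (oner_neq0 _) (oner_neq0 _)) := @transvection_opposite_ncomm F n.+1 i j 1 1 ij.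
  have ji : j != i by rewrite eq_sym.
  have [u du uE] := autS autP (det_transvection (1 : F) ij).
  have [v dv vE] := autS autP (det_transvection (1 : F) ji).
  rewrite -uE -vE => /eqP; apply; apply/(aut_comm autP) => //; apply: diag_mx_comm.
    apply/(regular_comm_diag _ dgt treg)/(aut_comm autP) => //.
    by rewrite uE transvection_comm_diag.
  apply/(regular_comm_diag _ dgt treg)/(aut_comm autP) => //.
  by rewrite vE transvection_comm_diag.
move=> x dx; have psiE : P *m phi x *m invmx P = psi x by [].
rewrite psiE -(regular_comm_diag _ dgt treg) -(regular_comm_diag _ dP psireg).
by rewrite (aut_comm autP).
Qed.

End Torus.

Lemma diag_mx_det1_exists (F : fieldType) n (f : 'I_n -> F) : \prod_i f i = 1 ->
  exists t : 'M[F]_n, [/\ is_diag_mx t, \det t = 1 & forall i, t i i = f i].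
Proof.
move=> f1; exists (diag_mx (\row_i f i)); split=> //.
  by rewrite det_diag -[RHS]f1; apply: eq_bigr => i _; rewrite mxE.
by move=> i; rewrite !mxE eqxx.
Qed.

(** * Images of the root subgroups *)

Section RootSubgroups.
Variables (F : fieldType) (F0 : [pchar F] =i pred0) (n : nat).
Local Notation M := 'M[F]_n.
Implicit Types (x g h t s : M) (i j k l p q : 'I_n) (a b : F).

Let nat_neq0 m : m.+1%:R != 0 :> F. Proof. exact: natr_neq0 F0 _ _. Qed.

Lemma diag_pair_exists i j c : c != 0 -> i != j ->
  exists t : M, [/\ is_diag_mx t, \det t = 1, t i i = c & t j j = c^-1].
Proof.
move=> c0 ij; have ji : j != i by rewrite eq_sym.
have [|t [dt t1 tE]] := @diag_mx_det1_exists F n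
    (fun k => if k == i then c else if k == j then c^-1 else 1).
  rewrite (bigD1 i) //= (bigD1 j) //= !eqxx (negPf ji) big1 ?mulr1 ?mulfV //.
  by move=> k /andP[/negPf -> /negPf ->].
by exists t; rewrite !tE !eqxx (negPf ji).
Qed.

(** The kernel of the root t_i / t_j on the torus of SL_n determines the root up to sign, because
    every other index can be separated by a torus element lying in that kernel. *)
Lemma root_kernel_sub i j p q : i != j -> p != q ->
    (forall t, is_diag_mx t -> \det t = 1 -> t i i = t j j -> t p p = t q q) ->
  (p = i /\ q = j) \/ (p = j /\ q = i).
Proof.
move=> ij pq sub; have ji : j != i by rewrite eq_sym.
(* Entries 1/4 at [r], 2 at [i] and [j], and 1 elsewhere: the determinant is 1 and the entry at [r]
   differs from all others. *)
have outside r : r != i -> r != j -> exists t, [/\ is_diag_mx t, \det t = 1, t i i = t j j &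
    forall r', r' != r -> t r' r' != t r r].
  move=> ri rj; have [|t [dt t1 tE]] := @diag_mx_det1_exists F n
    (fun k => if k == r then 4%:R^-1 else if (k == i) || (k == j) then 2%:R else 1).
    rewrite (bigD1 r) //= (bigD1 i) 1?eq_sym //= (bigD1 j) /=; last by rewrite eq_sym rj.
    rewrite !eqxx !(eq_sym _ r) (negPf ri) (negPf rj) orbT big1 => [|k].
      by rewrite mulr1 -natrM mulVf.
    by rewrite eq_sym => /andP[/andP[/negPf -> /negPf ->] /negPf ->].
  exists t; rewrite !tE !eqxx !(eq_sym _ r) (negPf ri) (negPf rj) orbT; split=> // r' r'r.
  rewrite tE (negPf r'r); apply/eqP => /(congr1 (fun z => z * 4%:R)).
  rewrite mulVf //; case: ifP => _ /eqP.
    by rewrite -natrM -subr_eq0 -[1]/(1%:R) -natrB // (negPf (nat_neq0 _)).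
  by rewrite mul1r -subr_eq0 -[X in _ - X]/(1%:R) -natrB // (negPf (nat_neq0 _)).
have [/eqP pE|pi] := boolP (p == i); have [/eqP qE|qj] := boolP (q == j); first by left.
- have [/eqP qi|qi] := boolP (q == i); first by rewrite pE qi eqxx in pq.
  have [t [dt t1 tij tq]] := outside q qi qj.
  by have := tq p pq; rewrite sub // eqxx.
- have [/eqP pj|pj] := boolP (p == j); first by rewrite pj qE eqxx in pq.
  have [t [dt t1 tij tp]] := outside p pi pj.
  by have := tp q (contra_neq esym pq); rewrite sub // eqxx.
- have [/eqP pj|pj] := boolP (p == j); last first.
    have [t [dt t1 tij tp]] := outside p pi pj.
    by have := tp q (contra_neq esym pq); rewrite sub // eqxx.
  have [/eqP qi|qi] := boolP (q == i); first by right.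
  have [t [dt t1 tij tq]] := outside q qi qj.
  by have := tq p pq; rewrite sub // eqxx.
Qed.

Lemma not_diagP x : ~ is_diag_mx x -> exists k l, k != l /\ x k l != 0.
Proof.
move=> /negP; rewrite /is_diag_mx negb_forall => /existsP [k].
by rewrite negb_forall => /existsP [l]; rewrite negb_imply => /andP[kl xkl]; exists k, l.
Qed.

Variables (phi : M -> M) (aut : is_group_aut (@SLpred F n) phi).
Hypothesis torus : forall x, \det x = 1 -> is_diag_mx x <-> is_diag_mx (phi x).

(** The kernels of two roots correspond under phi. The condition does not distinguish a root from
    its opposite. *)
Definition same_kernel i j k l := forall t, is_diag_mx t -> \det t = 1 ->
  t i i = t j j <-> phi t k k = phi t l l.

(** Torus elements commuting with the transvection have images commuting with its image, which gives
    one inclusion. The same argument for a preimage of the transvection at (k, l) puts the pullback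
    of the kernel of (k, l) inside the kernel of some root (p, q); then ker(i, j) lies in ker(p, q),
    and the two roots agree up to sign. *)
Lemma same_kernel_support i j a k l : i != j -> k != l ->
  phi (transvection i j a) k l != 0 -> same_kernel i j k l.
Proof.
move=> ij kl gkl.
have T_kl t : is_diag_mx t -> \det t = 1 -> t i i = t j j -> phi t k k = phi t l l.
  move=> dt t1 tij; have := transvection_comm_diag a dt tij.
  move/(aut_comm aut t1 (det_transvection a ij)).
  by move/(comm_diag_offdiag k l ((torus t1).1 dt)); rewrite (negPf gkl) orbF => /eqP.
have [y dy yE] := autS aut (det_transvection 1 kl).
have [p [q [pq ypq]]] : exists p q, p != q /\ y p q != 0.
  apply: not_diagP => /(torus dy); rewrite yE => /transvection_diagE => /(_ kl) /eqP.
  by rewrite oner_eq0.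
have kl_T t : is_diag_mx t -> \det t = 1 -> phi t k k = phi t l l -> t p p = t q q.
  move=> dt t1 tkl; have := transvection_comm_diag 1 ((torus t1).1 dt) tkl.
  rewrite -yE => /(aut_comm aut t1 dy) /(comm_diag_offdiag p q dt).
  by rewrite (negPf ypq) orbF => /eqP.
have pqE : (p = i /\ q = j) \/ (p = j /\ q = i).
  by apply: root_kernel_sub => // t dt t1 tij; apply: kl_T => //; apply: T_kl.
move=> t dt t1; split; first exact: T_kl.
by move=> /(kl_T t dt t1); case: pqE => [[-> ->]|[-> ->]].
Qed.

Lemma same_kernel_uniq i j k l p q : k != l -> p != q ->
  same_kernel i j k l -> same_kernel i j p q -> (p = k /\ q = l) \/ (p = l /\ q = k).
Proof.
move=> kl pq skl spq; apply: root_kernel_sub => // s ds s1.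
have [t dt tE] := autS aut s1; rewrite -tE in ds *.
have dgt : is_diag_mx t by apply/torus.
by move=> /(skl t dgt dt) /(spq t dgt dt).
Qed.

Lemma support_exists i j a : i != j -> a != 0 ->
  exists k l, k != l /\ phi (transvection i j a) k l != 0.
Proof.
move=> ij a0; apply: not_diagP => /(torus (det_transvection a ij)) /(transvection_diagE ij) aE.
by rewrite aE eqxx in a0.
Qed.

(* The shape forced by commuting with all torus conjugates. *)
Definition triangular_on p q g := [/\ p != q,
  (forall k l, k != l -> g k l != 0 -> k = p /\ l = q), g p q != 0 & g p p = g q q].

Lemma mul_supported k l g h p q : (forall u v, u != v -> g u v != 0 ->
    (u = k /\ v = l) \/ (u = l /\ v = k)) -> k != l -> p != q -> ((p = k /\ q = l) \/ (p = l /\ q = k)) ->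
  forall r, (g *m h) p r = g p p * h p r + g p q * h q r.
Proof.
move=> gs kl pq pqE r; rewrite mxE (bigD1 p) //= (bigD1 q) /=; last by rewrite eq_sym.
rewrite big1 ?addr0 // => u /andP[up uq]; have [->|gpu] := eqVneq (g p u) 0; first by rewrite mul0r.
have pu : p != u by rewrite eq_sym.
by move: up uq kl pq; case: (gs p u pu gpu) => -[? ?]; case: pqE => -[? ?]; subst; rewrite ?eqxx.
Qed.

Lemma transvection_conj_diag t i j a : is_diag_mx t -> t j j != 0 -> 
  t *m transvection i j a = transvection i j (t i i * a / t j j) *m t.
Proof.
move=> /diag_mxP [d ->]; rewrite !mxE !eqxx !mulr1n => dj.
rewrite /transvection mulmxDl mulmxDr mul1mx mulmx1 -scalemxAl -scalemxAr.
congr (_ + _); apply/matrixP => k l; rewrite [LHS]mxE [RHS]mxE mul_diag_mx mul_mx_diag !mxE.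
case: (k =P i) => [->|_]; case: (l =P j) => [->|_]; rewrite ?(mul0r, mulr0) // mulr1 mul1r.
by rewrite divfK // mulrC.
Qed.

(** Conjugating the image [g] by a torus element [s] gives the image [g'] of another transvection of
    the same root subgroup, so [g] and [g'] commute. With entries 2 and 1/2 in [s], the entry at (k,
    l) is multiplied by 4 and that at (l, k) divided by 4; comparing the products forces [g l k] to
    vanish and the two diagonal entries to agree. *)
Lemma root_image_triangular i j a : i != j -> a != 0 ->
  exists p q, same_kernel i j p q /\ triangular_on p q (phi (transvection i j a)).
Proof.
move=> ij a0; have [k [l [kl gkl]]] := support_exists ij a0.
have lk : l != k by rewrite eq_sym.
have skl := same_kernel_support ij kl gkl; set g := phi _ in gkl *.
have gs u v : u != v -> g u v != 0 -> (u = k /\ v = l) \/ (u = l /\ v = k).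
  by move=> uv guv; apply: (same_kernel_uniq kl uv skl); apply: same_kernel_support guv.
have [s [ds s1 sk sl]] := diag_pair_exists (nat_neq0 1) kl.
have [t t1 tE] := autS aut s1; have dt : is_diag_mx t by apply/torus; rewrite ?tE.
have tj0 : t j j != 0.
  have := det1_unitmx t1; move/diag_mxP: (dt) => [d ->].
  rewrite unitmxE det_diag unitfE => /prodf_neq0 /(_ j isT).
  by rewrite !mxE eqxx.
pose g' := phi (transvection i j (t i i * a / t j j)).
have tg : s *m g = g' *m s.
  by rewrite -tE -!(autM aut) ?det_transvection // transvection_conj_diag.
have g'E u v : s v v != 0 -> g' u v = s u u * g u v / s v v.
  move=> sv; apply: (mulIf sv); rewrite divfK //.
  move/matrixP/(_ u v): tg; move/diag_mxP: ds => [d ->].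
  by rewrite mul_diag_mx mul_mx_diag !mxE !eqxx !mulr1n.
have gg' : g *m g' = g' *m g.
  by rewrite -!(autM aut) ?det_transvection // !transvectionD // addrC.
have sk0 : s k k != 0 by rewrite sk.
have sl0 : s l l != 0 by rewrite sl invr_neq0.
have g's u v : u != v -> g' u v != 0 -> (u = k /\ v = l) \/ (u = l /\ v = k).
  by move=> uv guv; apply: (same_kernel_uniq kl uv skl); apply: same_kernel_support guv.
have g'kl : g' k l = 4%:R * g k l by rewrite g'E // sk sl invrK; ring.
have g'lk : g' l k = g l k / 4%:R by rewrite g'E // sk sl; field; rewrite ?(nat_neq0 _).
have g'kk : g' k k = g k k by rewrite g'E // mulrAC mulfV // mul1r.
have g'll : g' l l = g l l by rewrite g'E // mulrAC mulfV // mul1r.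
have E0 u v : (g *m g') u v = (g' *m g) u v by rewrite gg'.
have kE : (k = k /\ l = l) \/ (k = l /\ l = k) by left.
have lE : (l = k /\ k = l) \/ (l = l /\ k = k) by right.
have glk0 : g l k = 0.
  move: (E0 k k); rewrite (mul_supported _ gs kl kl kE) (mul_supported _ g's kl kl kE).
  rewrite g'kk g'kl g'lk => /addrI /eqP; rewrite -subr_eq0.
  have -> : g k l * (g l k / 4) - 4 * g k l * g l k = - (15%:R / 4%:R) * (g k l * g l k).
    by field; rewrite ?(nat_neq0 _).
  rewrite !mulf_eq0 oppr_eq0 mulf_eq0 invr_eq0 (negPf gkl) /=.
  by rewrite !(negPf (nat_neq0 _)) /= => /eqP.
exists k, l; split=> //; split=> //.
  move=> u v uv guv; case: (gs u v uv guv) => // -[uE vE].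
  by rewrite uE vE glk0 eqxx in guv.
move: (E0 k l); rewrite (mul_supported _ gs kl kl kE) (mul_supported _ g's kl kl kE).
rewrite g'kk g'kl g'll => /eqP; rewrite -subr_eq0.
have -> : g k k * (4 * g k l) + g k l * g l l - (g k k * g k l + 4 * g k l * g l l) =
   3%:R * g k l * (g k k - g l l) by ring.
by rewrite !mulf_eq0 (negPf gkl) (negPf (nat_neq0 _)) /= subr_eq0 => /eqP.
Qed.

Lemma triangular_on_row0 p q g r : triangular_on p q g -> r != p -> \det g = 1 -> g r r != 0.
Proof.
move=> [pq gs _ _] rp dg; apply/eqP => grr.
have r0 : row r g = 0.
  apply/rowP => c; rewrite !mxE; have [<-//|rc] := eqVneq r c.
  apply/eqP/negPn/negP => /(gs r c rc) [rE _]; by rewrite rE eqxx in rp.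
have : row r g *m invmx g = row r (1%:M : M) by rewrite -row_mul mulmxV ?det1_unitmx.
rewrite r0 mul0mx => /rowP /(_ r); rewrite !mxE eqxx => /eqP.
by rewrite eq_sym oner_eq0.
Qed.

(** What remains is that the diagonal of [g] is 1. The transvection is a commutator of a torus
    element with a member [h] of its root subgroup, so that [g *m h] is conjugate to the image of
    that member by a diagonal matrix and has the same diagonal. *)
Lemma root_image_transvection i j a : i != j -> a != 0 ->
  exists p q b, [/\ p != q, same_kernel i j p q, b != 0 & phi (transvection i j a) = transvection p q b].
Proof.
move=> ij a0; have [p [q [spq]]] := root_image_triangular ij a0.
set g := phi _ => gtri; have [pq gs gpq gE] := gtri.
have qp : q != p by rewrite eq_sym.
(* Conjugation by a torus element with entries 2 and 1/2 multiplies the parameter by 4, and a + b =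
   4 b. *)
pose b := a / 3%:R; have b0 : b != 0 by rewrite mulf_neq0 ?invr_neq0.
have [p' [q' [spq']]] := root_image_triangular ij b0.
set h := phi _ => htri; have [p'q' hs hpq hE] := htri.
have gh : g *m h = h *m g.
  by rewrite -!(autM aut) ?det_transvection // !transvectionD // addrC.
have hpqE := same_kernel_uniq pq p'q' spq spq'.
have hsupp u v : u != v -> h u v != 0 -> (u = p /\ v = q) \/ (u = q /\ v = p).
  by move=> uv /(hs u v uv) [-> ->].
have gsupp u v : u != v -> g u v != 0 -> (u = p /\ v = q) \/ (u = q /\ v = p).
  by move=> uv /(gs u v uv) [-> ->]; left.
have kE : (p = p /\ q = q) \/ (p = q /\ q = p) by left.
have lE : (q = p /\ p = q) \/ (q = q /\ p = p) by right.
have gqp : g q p = 0.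
  by apply/eqP/negPn/negP => /(gs q p qp) [E _]; rewrite E eqxx in qp.
have hqp : h q p = 0.
  move/matrixP/(_ q q): gh; rewrite (mul_supported _ gsupp pq qp lE) (mul_supported _ hsupp pq qp lE).
  rewrite gqp mul0r addr0 mulrC => /eqP; rewrite -subr_eq0 opprD addrA subrr sub0r oppr_eq0.
  by rewrite mulf_eq0 (negPf gpq) orbF => /eqP.
(* [h] is supported at (p, q) or at (q, p); commuting with [g] excludes the second. *)
have {}htri : triangular_on p q h.
  case: hpqE htri hpq => [[-> ->] //|[-> ->] _]; by rewrite hqp eqxx.
have {hs hpq hE p' q' spq' p'q' hpqE} [_ hs hpq hE] := htri.
have dh : \det h = 1 by apply: (autSL aut); rewrite det_transvection.
have hrr r : h r r != 0.
  have [->|rp] := eqVneq r p; last exact: triangular_on_row0 htri rp dh.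
  by rewrite hE; apply: triangular_on_row0 htri qp dh.
have [t [dt t1 ti tj]] := diag_pair_exists (nat_neq0 1) ij.
have tj0 : t j j != 0 by rewrite tj invr_neq0.
have [ds s1] := ((torus t1).1 dt, autSL aut t1).
have sr r : phi t r r != 0.
  have := det1_unitmx s1; move/diag_mxP: (ds) => [e ->].
  rewrite unitmxE det_diag unitfE => /prodf_neq0 /(_ r isT).
  by rewrite !mxE eqxx.
have ghs : g *m h *m phi t = phi t *m h.
  rewrite -!(autM aut) ?det_mulmx ?det_transvection ?t1 ?mulr1 //; congr phi.
  rewrite (@transvection_conj_diag t) // transvectionD //; congr (transvection i j _ *m _).
  by rewrite ti tj invrK /b; field; exact: nat_neq0.
have ghrr r : (g *m h) r r = h r r.
  apply: (mulIf (sr r)); move/matrixP/(_ r r): ghs; move/diag_mxP: ds => [e ->].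
  by rewrite mul_diag_mx mul_mx_diag !mxE !eqxx !mulr1n mulrC => ->; rewrite mulrC.
have grr r : g r r = 1.
  apply: (mulIf (hrr r)); rewrite mul1r -[RHS]ghrr mxE (bigD1 r) //= big1 ?addr0 // => u ur.
  have ru : r != u by rewrite eq_sym.
  have [->|gru] := eqVneq (g r u) 0; first by rewrite mul0r.
  have [-> ->] := gs r u ru gru; by rewrite hqp mulr0.
exists p, q, (g p q); split=> //; apply/matrixP => u v; rewrite transvectionE.
have [->|uv] := eqVneq u v.
  rewrite grr; case: (v =P p) => [->|]; last by rewrite mulr0 addr0.
  by rewrite (negPf pq) mulr0 addr0.
rewrite add0r; case: (boolP ((u == p) && (v == q))) => [/andP[/eqP -> /eqP ->]|nuv].
  by rewrite mulr1.
rewrite mulr0; apply/eqP/negPn/negP => /(gs u v uv) [uE vE].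
by rewrite uE vE !eqxx in nuv.
Qed.

Lemma root_images : exists tau : 'I_n -> 'I_n -> 'I_n * 'I_n, exists f : 'I_n -> 'I_n -> F -> F,
  forall i j, i != j -> [/\ (tau i j).1 != (tau i j).2, same_kernel i j (tau i j).1 (tau i j).2 &
    forall a, phi (transvection i j a) = transvection (tau i j).1 (tau i j).2 (f i j a)].
Proof.
have root_pair (ij : 'I_n * 'I_n) : exists pq : 'I_n * 'I_n, ij.1 != ij.2 ->
    [/\ pq.1 != pq.2, same_kernel ij.1 ij.2 pq.1 pq.2 & forall a, exists b,
      phi (transvection ij.1 ij.2 a) = transvection pq.1 pq.2 b].
  case: ij => i j /=; have [->|ij] := eqVneq i j; first by exists (j, j).
  have [p [q [b [pq spq b0 E]]]] := root_image_transvection ij (oner_neq0 F).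
  exists (p, q) => _; split=> // a /=; have [->|a0] := eqVneq a 0.
    by exists 0; rewrite !transvection0; exact: aut1 aut.
  have [p' [q' [c [pq' spq' c0 E']]]] := root_image_transvection ij a0.
  (* The ordered pair is the same for all parameters, since nontrivial transvections at opposite
     positions do not commute. *)
  exists c; rewrite E'; case: (same_kernel_uniq pq pq' spq spq') => -[pE qE]; first by rewrite pE qE.
  rewrite pE qE in E'; have := transvection_opposite_ncomm pq b0 c0; rewrite -E' -E.
  by rewrite -!(autM aut) ?det_transvection // !transvectionD // addrC eqxx.
have [tau tauP] := choice root_pair.
have /choice [f fP] (ija : 'I_n * 'I_n * F) : exists b, ija.1.1 != ija.1.2 ->
    phi (transvection ija.1.1 ija.1.2 ija.2) = transvection (tau ija.1).1 (tau ija.1).2 b.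
  case: (eqVneq ija.1.1 ija.1.2) => [|ij]; first by exists 0.
  by have [_ _ /(_ ija.2) [b bE]] := tauP ija.1 ij; exists b.
exists (fun i j => tau (i, j)), (fun i j a => f (i, j, a)) => i j ij.
have [tij sij _] := tauP (i, j) ij; split=> // a.
exact: (fP (i, j, a) ij).
Qed.

End RootSubgroups.

Lemma rmorphism_of_morph (F : fieldType) (f : F -> F) : {morph f : x y / x + y} ->
  {morph f : x y / x * y} -> f 1 = 1 -> exists sigma : {rmorphism F -> F}, sigma =1 f.
Proof.
move=> fD fM f1.
have f0 : f 0 = 0 by apply: (addrI (f 0)); rewrite -fD !addr0.
have fB : zmod_morphism f.
  by move=> x y; apply: (addIr (f y)); rewrite -fD !subrK.
pose a := GRing.isZmodMorphism.Build F F f fB.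
pose m := GRing.isMonoidMorphism.Build F F f (conj f1 fM).
pose sigma : {rmorphism F -> F} := HB.pack f a m.
by exists sigma.
Qed.

(** * Relations between transvections *)

Section Commutators.
Variables (F : fieldType) (n : nat).
Local Notation M := 'M[F]_n.
Implicit Types (i j k l p q r : 'I_n) (a b c : F).

Lemma mul_transvectionE (y : M) i j a k l :
  (y *m transvection i j a) k l = y k l + y k i * a * (l == j)%:R.
Proof.
rewrite /transvection mulmxDr mulmx1 -scalemxAr !mxE; congr (_ + _).
rewrite (bigD1 i) //= mxE eqxx big1 ?addr0 => [|p pi]; first by rewrite mulrA (mulrC a).
by rewrite mxE (negPf pi) mulr0.
Qed.

Lemma transvection_inj i j a b : i != j ->
  transvection i j a = transvection i j b :> M -> a = b.
Proof. by move=> ij /matrixP /(_ i j); rewrite !transvection_offdiag. Qed.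

Lemma transvection_ends i j k l a : i != j -> k != l -> a != 0 -> forall b,
  transvection i j a = transvection k l b :> M -> i = k /\ j = l.
Proof.
move=> ij kl a0 b /matrixP /(_ i j); rewrite transvection_offdiag // transvectionE (negPf ij) add0r.
case: (i =P k) => [->|_]; case: (j =P l) => [->|_] // /eqP;
  by rewrite /= mulr0 (negPf a0).
Qed.

Lemma transvection_commute i j k l a b : j != k -> i != l ->
  transvection i j a *m transvection k l b = transvection k l b *m transvection i j a :> M.
Proof.
move=> jk il; rewrite /transvection !mulmxDl !mulmxDr !mul1mx !mulmx1.
rewrite -!scalemxAl -!scalemxAr (mul_delta_mx_0 _ _ _ jk) mul_delta_mx_0 1?eq_sym //.
by rewrite !scaler0 !addr0 -!addrA (addrC (a *: _)).
Qed.

(** The Chevalley commutator relation, written without inverses. *)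
Lemma transvection_chain i j k a b : i != k -> i != j -> j != k ->
  transvection i j a *m transvection j k b =
  transvection i k (a * b) *m transvection j k b *m transvection i j a :> M.
Proof.
move=> ik ij jk; have [ki ji kj] : [/\ k != i, j != i & k != j] by rewrite !(eq_sym k) (eq_sym j).
apply/matrixP => u v; rewrite !mul_transvectionE !transvectionE.
rewrite ?eqxx ?(negPf ik) ?(negPf ki) ?(negPf jk) ?(negPf kj) ?(negPf ij) ?(negPf ji).
by rewrite -!mulnb !natrM /=; ring.
Qed.

(** The Weyl element [w] is a monomial matrix that exchanges the two opposite root subgroups. *)
Lemma weyl_conj i j a c : i != j -> a != 0 ->
  let w : M := transvection i j a *m transvection j i (- a^-1) *m transvection i j a in
  w *m transvection i j c = transvection j i (- c / a ^+ 2) *m w.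
Proof.
move=> ij a0 /=; have ji : j != i by rewrite eq_sym.
apply/matrixP => k l; rewrite transvection_mulE !mul_transvectionE !transvectionE.
rewrite !eqxx ?(negPf ij) ?(negPf ji) -!mulnb !natrM /= (eq_sym i l).
by field.
Qed.

(* Two opposite root subgroups multiply as in SL_2, so the relation satisfied by
   Weyl elements determines both parameters. *)
Lemma weyl_conj_inv i j a b c d : i != j -> c != 0 ->
  let w : M := transvection i j a *m transvection j i b *m transvection i j a in
  w *m transvection i j c = transvection j i d *m w -> 1 + a * b = 0 /\ d * a = c * b.
Proof.
move=> ij c0 /= /matrixP E; have ji : j != i by rewrite eq_sym.
have := E i j; have := E j j.
rewrite !transvection_mulE !mul_transvectionE !transvectionE.
rewrite !eqxx ?(negPf ij) ?(negPf ji) -?mulnb ?natrM /= => /eqP Ejj /eqP Eij.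
have ab : 1 + a * b = 0.
  move: Eij; rewrite -subr_eq0; set Z := (X in X == 0).
  have -> : Z = (1 + a * b) * c by rewrite /Z; ring.
  by rewrite mulf_eq0 (negPf c0) orbF => /eqP.
split=> //; apply/eqP; move: Ejj; rewrite -subr_eq0; set Z := (X in X == 0).
have -> : Z = c * b - d * a * (1 + (1 + a * b)) by rewrite /Z; ring.
by rewrite ab addr0 mulr1 subr_eq0 eq_sym.
Qed.

End Commutators.

(** Transvections whose positions compose in neither order commute, so a nontrivial commutator
    leaves only the two orders of composition. *)
Lemma transvection_chain_ends (F : fieldType) n (p q r s t u : 'I_n) (a b c : F) :
    p != q -> r != s -> t != u -> a != 0 -> b != 0 -> c != 0 -> (q = r -> p != s) ->
    transvection p q a *m transvection r s b =
    transvection t u c *m transvection r s b *m transvection p q a ->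
  [/\ q = r, t = p & u = s] \/ [/\ p = s, t = r & u = q].
Proof.
move=> pq rs tu a0 b0 c0 qr_ps E.
have cancel (x y z : 'M[F]_n) : \det z = 1 -> x *m z = y *m z -> x = y.
  by move=> dz; apply: (can_inj (mulmxK (det1_unitmx dz))).
have d1 : \det (transvection r s b *m transvection p q a) = 1.
  by rewrite det_mulmx !det_transvection // mulr1.
rewrite -mulmxA in E; have [qr|qr] := eqVneq q r.
  left; have ps := qr_ps qr; subst r; move: E; rewrite transvection_chain // -mulmxA.
  move=> /(cancel _ _ _ d1) /esym E.
  by have [-> ->] := transvection_ends tu ps c0 E.
have [ps|ps] := eqVneq p s.
  right; subst p; have rq : r != q by rewrite eq_sym.
  have rqd x : \det (transvection r q x : 'M[F]_n) = 1 by exact: det_transvection.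
  move: E; rewrite (transvection_chain b a rq rs pq) mulmxA => /esym E.
  have E' : transvection t u c *m transvection r q (b * a) = 1%:M :> 'M[F]_n.
    have d2 : \det (transvection s q a *m transvection r s b) = 1.
      by rewrite det_mulmx !det_transvection // mulr1.
    by apply: (cancel _ _ _ d2); rewrite mul1mx -[RHS]E !mulmxA.
  have {}E' : transvection t u c = transvection r q (- (b * a)) :> 'M[F]_n.
    by apply: (cancel _ _ _ (rqd (b * a))); rewrite E' transvectionD // addNr transvection0.
  by have [-> ->] := transvection_ends tu rq c0 E'.
case/eqP: (c0); apply: (transvection_inj tu); rewrite transvection0.
by apply: (cancel _ _ _ d1); rewrite mul1mx -E transvection_commute.
Qed.

(** * The permutation of indices induced on the roots *)

Section RootPermutation.
Variables (F : fieldType) (F0 : [pchar F] =i pred0) (m : nat).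
Local Notation n := m.+2.
Local Notation M := 'M[F]_n.
Implicit Types (i j k l : 'I_n) (a b : F).
Variables (phi : M -> M) (aut : is_group_aut (@SLpred F n) phi).
Variables (tau : 'I_n -> 'I_n -> 'I_n * 'I_n) (f : 'I_n -> 'I_n -> F -> F).
Hypothesis tauP : forall i j, i != j ->
  [/\ (tau i j).1 != (tau i j).2, same_kernel phi i j (tau i j).1 (tau i j).2 &
    forall a, phi (transvection i j a) = transvection (tau i j).1 (tau i j).2 (f i j a)].
Hypothesis torus : forall x, \det x = 1 -> is_diag_mx x <-> is_diag_mx (phi x).

Lemma root_param_neq0 i j a : i != j -> a != 0 -> f i j a != 0.
Proof.
move=> ij; apply: contra_neq => fa0; have [_ _ /(_ a)] := tauP ij.
rewrite fa0 transvection0 -(aut1 aut) => /(autI aut); rewrite det_transvection // det1.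
by rewrite -(transvection0 F i j) => /(_ erefl erefl) /transvection_inj; apply.
Qed.

(** Opposite roots have the same kernel, so their images coincide or are opposite; coinciding
    positions would make the two images commute. *)
Lemma root_image_opp i j : i != j -> tau j i = ((tau i j).2, (tau i j).1).
Proof.
move=> ij; have ji : j != i by rewrite eq_sym.
have [pq spq phiE] := tauP ij; have [pq' spq' phiE'] := tauP ji.
have spq'' : same_kernel phi i j (tau j i).1 (tau j i).2.
  by move=> t dt t1; rewrite -(spq' t dt t1); split=> ->.
case: (same_kernel_uniq F0 aut torus pq pq' spq spq'') => -[E1 E2]; last first.
  by rewrite [LHS]surjective_pairing E1 E2.
have := transvection_opposite_ncomm ij (oner_neq0 F) (oner_neq0 F).
have /(aut_comm aut (det_transvection _ ij) (det_transvection _ ji)) -> :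
    phi (transvection i j 1) *m phi (transvection j i 1) =
    phi (transvection j i 1) *m phi (transvection i j 1); last by rewrite eqxx.
by rewrite phiE phiE' E1 E2 !transvectionD // addrC.
Qed.

Lemma root_image_inj i j k l : i != j -> k != l -> tau i j = tau k l -> i = k /\ j = l.
Proof.
move=> ij kl tE; have [pq spq _] := tauP ij; have [_ spq' _] := tauP kl.
have : (i = k /\ j = l) \/ (i = l /\ j = k).
  apply: (root_kernel_sub F0 kl ij) => t dt t1 /(spq' t dt t1); rewrite -tE.
  exact: (spq t dt t1).2.
case=> // -[iE jE]; move: tE pq; rewrite -iE -jE (root_image_opp ij).
by case: (tau i j) => p q /= [->]; rewrite eqxx.
Qed.

Lemma root_image_chain i j k : i != j -> j != k -> i != k ->
    ((tau i j).2 = (tau j k).1 /\ tau i k = ((tau i j).1, (tau j k).2)) \/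
    ((tau i j).1 = (tau j k).2 /\ tau i k = ((tau j k).1, (tau i j).2)).
Proof.
move=> ij jk ik; have [pq _ Eij] := tauP ij; have [rs _ Ejk] := tauP jk.
have [tu _ Eik] := tauP ik; have F1 := oner_neq0 F.
have injjk : (tau j k).1 = (tau i j).2 -> (tau i j).1 != (tau j k).2.
  move=> E1; apply/eqP => E2; have ji : j != i by rewrite eq_sym.
  have /(root_image_inj jk ji) [_ kE] : tau j k = tau j i.
    by rewrite (root_image_opp ij) -E1 E2 -surjective_pairing.
  by rewrite kE eqxx in ik.
have fij := root_param_neq0 ij F1; have fjk := root_param_neq0 jk F1.
have fik := root_param_neq0 ik F1.
have := congr1 phi (transvection_chain 1 1 ik ij jk).
rewrite !(autM aut) ?det_mulmx ?det_transvection ?mulr1 // Eij Ejk Eik => E.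
have [qr|[qr tE uE]|[ps tE uE]] := transvection_chain_ends pq rs tu fij fjk fik _ E.
- exact/injjk/esym.
- by left; split; rewrite // [LHS]surjective_pairing tE uE.
- by right; split; rewrite // [LHS]surjective_pairing tE uE.
Qed.

Lemma root_permutation : exists2 pi : 'I_n -> 'I_n, injective pi &
  (forall i j, i != j -> tau i j = (pi i, pi j)) \/
  (forall i j, i != j -> tau i j = (pi j, pi i)).
Proof.
pose z : 'I_n := ord0; pose P i := (tau z i).1; pose Q i := (tau z i).2.
have tauz i : z != i -> tau z i = (P i, Q i) by rewrite -surjective_pairing.
have tauz' i : z != i -> tau i z = (Q i, P i) by move=> zi; rewrite root_image_opp.
have chain i j : z != i -> z != j -> j != i ->
    (P j = P i /\ tau j i = (Q j, Q i)) \/ (Q j = Q i /\ tau j i = (P i, P j)).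
  move=> zi zj ji; have jz : j != z by rewrite eq_sym.
  by have := root_image_chain jz zi ji; rewrite tauz // tauz'.
have chain_neq i j : z != i -> z != j -> j != i -> (P j != P i) || (Q j != Q i).
  move=> zi zj ji; rewrite -negb_and; apply/negP => /andP[/eqP Pij /eqP Qij].
  have /(root_image_inj zj zi) [_ E] : tau z j = tau z i by rewrite !tauz // Pij Qij.
  by rewrite E eqxx in ji.
pose e : 'I_n := lift ord0 ord0; have ze : z != e by [].
(* If [i] differs from [e] in P and [j] differs from [e] in Q, then [i] and [j] share neither
   coordinate. In size 2 both alternatives hold. *)
have dich : (forall i, z != i -> P i = P e) \/ (forall i, z != i -> Q i = Q e).
  case: (pselect (forall i, z != i -> P i = P e)) => [|nP]; first by left.
  case: (pselect (forall i, z != i -> Q i = Q e)) => [|nQ]; first by right.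
  have [i zi Pi] : exists2 i, z != i & P i != P e.
    apply: contrapT => H; apply: nP => i zi; apply/eqP/negPn/negP => Pi; by apply: H; exists i.
  have [j zj Qj] : exists2 j, z != j & Q j != Q e.
    apply: contrapT => H; apply: nQ => j zj; apply/eqP/negPn/negP => Qj; by apply: H; exists j.
  have ie : i != e by apply: contraNneq Pi => ->.
  have je : j != e by apply: contraNneq Qj => ->.
  have Qi : Q i = Q e by case: (chain e i ze zi ie) => -[] // E _; rewrite E eqxx in Pi.
  have Pj : P j = P e by case: (chain e j ze zj je) => -[] // E _; rewrite E eqxx in Qj.
  have ij : i != j by apply: contraNneq Pi => ->; rewrite Pj.
  case: (chain j i zj zi ij) => -[E _].
    by rewrite E Pj eqxx in Pi.
  by rewrite -E Qi eqxx in Qj.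
pose pi (R S : 'I_n -> 'I_n) i := if i == z then R e else S i.
have piI R S : (forall i j, i != j -> tau i j = (pi R S i, pi R S j) \/
    tau i j = (pi R S j, pi R S i)) -> injective (pi R S).
  move=> E i j Eij; apply/eqP/negPn/negP => ij.
  by have [+ _ _] := tauP ij; case: (E i j ij) => ->; rewrite /= Eij eqxx.
case: dich => [PE|QE].
  have E i j : i != j -> tau i j = (pi P Q i, pi P Q j).
    move=> ij; rewrite /pi; case: (eqVneq i z) ij => [->|iz ij].
      by rewrite eq_sym => jz; rewrite (negPf jz) tauz 1?eq_sym // PE 1?eq_sym.
    case: (eqVneq j z) => [->|jz]; first by rewrite tauz' 1?eq_sym // PE 1?eq_sym.
    have [zi zj] : z != i /\ z != j by rewrite !(eq_sym z).
    case: (chain j i zj zi ij) => -[E1 E2] //.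
    by have := chain_neq j i zj zi ij; rewrite E1 eqxx orbF !PE ?eqxx.
  by exists (pi P Q); [apply: piI => i j ij; left; exact: E | left].
have E i j : i != j -> tau i j = (pi Q P j, pi Q P i).
  move=> ij; rewrite /pi; case: (eqVneq i z) ij => [->|iz ij].
    by rewrite eq_sym => jz; rewrite (negPf jz) tauz 1?eq_sym // QE 1?eq_sym.
  case: (eqVneq j z) => [->|jz]; first by rewrite tauz' 1?eq_sym // QE 1?eq_sym.
  have [zi zj] : z != i /\ z != j by rewrite !(eq_sym z).
  case: (chain j i zj zi ij) => -[E1 E2] //.
  by have := chain_neq j i zj zi ij; rewrite E1 eqxx /= !QE ?eqxx.
by exists (pi Q P); [apply: piI => i j ij; right; exact: E | right].
Qed.

End RootPermutation.

(** * Root parameters as a field endomorphism *)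

Section Normalized.
Variables (F : fieldType) (F0 : [pchar F] =i pred0) (m : nat).
Local Notation n := m.+2.
Local Notation M := 'M[F]_n.
Implicit Types (i j k l : 'I_n) (a b : F).
Variables (phi : M -> M) (aut : is_group_aut (@SLpred F n) phi) (f : 'I_n -> 'I_n -> F -> F).
Hypothesis phiE : forall i j a, i != j -> phi (transvection i j a) = transvection i j (f i j a).
Hypothesis f1 : forall j, j != 0 -> f 0 j 1 = 1.

Lemma paramD i j : i != j -> {morph f i j : a b / a + b}.
Proof.
move=> ij a b; apply: (transvection_inj ij); rewrite -transvectionD // -!phiE //.
by rewrite -(autM aut) ?det_transvection // transvectionD.
Qed.

Lemma param0 i j : i != j -> f i j 0 = 0.
Proof. by move=> ij; apply: (addrI (f i j 0)); rewrite -paramD // !addr0. Qed.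

Lemma paramN i j a : i != j -> f i j (- a) = - f i j a.
Proof. by move=> ij; apply: (addrI (f i j a)); rewrite -paramD // !subrr param0. Qed.

Lemma param_neq0 i j a : i != j -> a != 0 -> f i j a != 0.
Proof.
move=> ij; apply: contra_neq => fa0; apply: (transvection_inj ij).
by apply: (autI aut); rewrite ?det_transvection // !phiE // fa0 param0.
Qed.

Lemma param_chain i j k a b : i != j -> j != k -> i != k ->
  f i k (a * b) = f i j a * f j k b.
Proof.
move=> ij jk ik; have := congr1 phi (transvection_chain a b ik ij jk).
rewrite !(autM aut) ?det_mulmx ?det_transvection ?mulr1 // !phiE //.
rewrite transvection_chain // -!mulmxA => /(can_inj (mulmxK _)) E.
apply/esym/(transvection_inj ik)/E/det1_unitmx.
by rewrite det_mulmx !det_transvection // mulr1.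
Qed.

(** In size 2 there are no three distinct indices, so multiplicativity cannot be read off from the
    commutator relation; the Weyl elements replace it within a pair of opposite root subgroups. *)
Lemma param_weyl i j a c : i != j -> a != 0 -> c != 0 ->
  f i j a * f j i a^-1 = 1 /\ f j i (c / a ^+ 2) * f i j a = f i j c * f j i a^-1.
Proof.
move=> ij a0 c0; have ji : j != i by rewrite eq_sym.
have := congr1 phi (weyl_conj c ij a0).
rewrite !(autM aut) ?det_mulmx ?det_transvection ?mulr1 // !phiE // => E.
have [] := weyl_conj_inv ij (param_neq0 ij c0) E.
rewrite mulNr !paramN // mulrN => /eqP; rewrite subr_eq0 => /eqP ->; split=> //.
by apply: oppr_inj; rewrite -mulNr -mulrN.
Qed.

(** The parameters of the opposite root at a^-1 and a^-2 are eliminated between three Weyl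
    relations. *)
Lemma param_sqr i j a : i != j -> f i j 1 = 1 -> f i j (a ^+ 2) = f i j a ^+ 2.
Proof.
move=> ij fij1; have [->|a0] := eqVneq a 0; first by rewrite expr0n /= param0 // expr0n.
have [E1 _] := param_weyl ij a0 (oner_neq0 _).
have [_ E2] := param_weyl ij a0 (oner_neq0 _).
have [E3 _] := param_weyl ij (expf_neq0 2 a0) (oner_neq0 _).
have fa0 := param_neq0 ij a0.
move: E2; rewrite mul1r fij1 mul1r => E2.
have : f i j (a ^+ 2) * (f j i (a ^+ 2)^-1 * f i j a) * f i j a = f i j (a ^+ 2) * (f i j a * f j i a^-1).
  by rewrite E2; ring.
by rewrite E1 mulr1 mulrA E3 mul1r expr2 => <-.
Qed.

(** An additive map that preserves squares preserves products, by polarization and division by 2. *)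
Lemma paramM i j : i != j -> f i j 1 = 1 -> {morph f i j : a b / a * b}.
Proof.
move=> ij fij1 a b; have n2 : 2%:R != 0 :> F by exact: natr_neq0.
apply: (mulIf n2); rewrite !mulr_natr.
have := param_sqr (a + b) ij fij1; rewrite sqrrD !paramD // !param_sqr // sqrrD.
by rewrite !mulr2n ?paramD // => /addIr /addrI ->.
Qed.

Lemma normalized_field_aut : exists sigma : {rmorphism F -> F},
  forall x, \det x = 1 -> phi x = map_mx sigma x.
Proof.
pose e : 'I_n := lift ord0 ord0; have e0 : e != 0 by [].
have z_ne i : i != 0 -> 0 != i by rewrite eq_sym.
have [sigma sE] := rmorphism_of_morph (paramD (z_ne e e0)) (paramM (z_ne e e0) (f1 e0)) (f1 e0).
have f1' i : i != 0 -> f i 0 =1 f 0 i.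
  move=> i0 a; have [->|a0] := eqVneq a 0; first by rewrite !param0 // z_ne.
  have zi := z_ne i i0; have ai0 : a^-1 != 0 by rewrite invr_eq0.
  have [+ _] := param_weyl zi ai0 (oner_neq0 _); rewrite invrK.
  move=> E; apply: (mulfI (param_neq0 zi ai0)); rewrite E -paramM ?f1 //.
  by rewrite mulVf // f1.
(* The root (e, i) factors through 0 with parameters (a, 1) and (1, a); comparing both identifies
   the parameters of (0, i) with those of (0, e). *)
have fs i : i != 0 -> f 0 i =1 sigma.
  move=> i0 a; rewrite sE; have [->//|ie] := eqVneq i e.
  have ei : e != i by rewrite eq_sym.
  have := param_chain a 1 (e0 : e != 0) (z_ne i i0) ei.
  have := param_chain 1 a (e0 : e != 0) (z_ne i i0) ei.
  rewrite mulr1 mul1r !f1' // !f1 // mulr1 mul1r => -> //.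
have fsigma i j : i != j -> f i j =1 sigma.
  move=> ij a; have [i0|i0] := eqVneq i 0.
    by rewrite i0 fs //; rewrite i0 eq_sym in ij.
  have [j0|j0] := eqVneq j 0; first by rewrite j0 f1' // fs.
  by rewrite -[a]mul1r (param_chain 1 a i0 (z_ne j j0) ij) f1' // f1 // mul1r fs // mul1r.
exists sigma => x dx.
have : \det x = 1 /\ phi x = map_mx sigma x; last by case.
apply: (sl_gen (H := fun x => \det x = 1 /\ phi x = map_mx sigma x)) dx.
- by rewrite det1 map_mx1 (aut1 aut).
- by move=> y z [dy yE] [dz zE]; rewrite det_mulmx dy dz mulr1 (autM aut) // yE zE map_mxM.
- move=> i j a ij; rewrite det_transvection // phiE // fsigma //; split=> //.
  by rewrite /transvection map_mxD map_mx1 map_mxZ map_delta_mx.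
Qed.

End Normalized.

(** * Classification of the automorphisms of SL_n *)

Section Classification.
Variables (F : closedFieldType) (F0 : [pchar F] =i pred0) (m : nat).
Local Notation n := m.+2.
Local Notation M := 'M[F]_n.
Implicit Types (phi : M -> M).

Definition semilinear_conj phi := exists2 Q : M, Q \in unitmx &
  exists sigma : {rmorphism F -> F},
    forall x, \det x = 1 -> phi x = Q *m map_mx sigma x *m invmx Q.

Lemma semilinear_of_roots phi (pi : 'I_n -> 'I_n) (f : 'I_n -> 'I_n -> F -> F) :
    is_group_aut (@SLpred F n) phi -> injective pi ->
    (forall i j a, i != j -> phi (transvection i j a) = transvection (pi i) (pi j) (f i j a)) ->
  semilinear_conj phi.
Proof.
move=> aut piI phiE.
have f0 i j : i != j -> f i j 1 != 0.
  move=> ij; have pij : pi i != pi j by rewrite (inj_eq piI).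
  apply/eqP => fa0; have := phiE i j 1 ij; rewrite fa0 transvection0 -(aut1 aut).
  move=> /(autI aut); rewrite det1 det_transvection // => /(_ erefl erefl).
  by rewrite -(transvection0 F i j) => /(transvection_inj ij) /eqP; rewrite oner_eq0.
pose s : 'S_n := perm piI; pose S : M := perm_mx s.
have uS : S \in unitmx by exact: unitmx_perm.
(* After [S] has undone the permutation, conjugation by [D] multiplies the parameter at (0, i) by
   d_0 / d_i, which turns [f 0 i 1] into 1. *)
pose d (i : 'I_n) : F := if i == 0 then 1 else f 0 i 1.
pose D : M := diag_mx (\row_i d i).
have d0 i : d i != 0.
  rewrite /d; case: (eqVneq i 0) => [_|i0]; first exact: oner_neq0.
  by apply: f0; rewrite eq_sym.
have uD : D \in unitmx.
  rewrite unitmxE det_diag unitfE; apply/prodf_neq0 => i _; by rewrite mxE d0.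
have DE i : D i i = d i by rewrite !mxE eqxx.
have permE i j a : S *m transvection (pi i) (pi j) a = transvection i j a *m S.
  rewrite /S -row_permE -[s in RHS]invgK -col_permE; apply/matrixP => k l.
  rewrite !mxE -{1 2}(permKV s l) !permE !(inj_eq piI) //.
pose Q := D *m S; have uQ : Q \in unitmx by rewrite unitmx_mul uD uS.
have autQ := aut_conj aut uQ; set psi := (fun x => _) in autQ.
have psiE i j a : i != j -> psi (transvection i j a) = transvection i j (d i * f i j a / d j).
  move=> ij; rewrite /psi phiE // invmx_mul // -!mulmxA (mulmxA S) permE.
  rewrite -!mulmxA mulKVmx // (mulmxA D) transvection_conj_diag ?DE ?diag_mx_is_diag // mulmxK //.
have [|sigma sE] := normalized_field_aut F0 autQ psiE.
  move=> j j0; rewrite /d eqxx (negPf j0) mul1r divff // f0 // eq_sym //.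
exists (invmx Q); first by rewrite unitmx_inv.
have conjK (A B : M) : A \in unitmx -> B = invmx A *m (A *m B *m invmx A) *m A.
  by move=> uA; rewrite -!mulmxA mulKmx // mulVmx // mulmx1.
by exists sigma => x dx; rewrite -sE // invmxK; exact: conjK.
Qed.

Lemma semilinear_conj_conj phi P : P \in unitmx ->
  semilinear_conj (fun x => P *m phi x *m invmx P) -> semilinear_conj phi.
Proof.
move=> uP [Q uQ [sigma sE]]; exists (invmx P *m Q); first by rewrite unitmx_mul unitmx_inv uP.
exists sigma => x dx; rewrite invmx_mul ?unitmx_inv // invmxK.
have := congr1 (fun y => invmx P *m y *m P) (sE x dx).
by rewrite /= !mulmxA mulVmx // mul1mx mulmxKV.
Qed.

(** In the order-reversing case the contragredient restores the order: inversion negates the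
    parameter of a transvection and transposition exchanges its indices. *)
Lemma sl_aut_classification phi : is_group_aut (@SLpred F n) phi ->
  semilinear_conj phi \/ semilinear_conj (fun x => (invmx (phi x))^T).
Proof.
move=> aut; have [P uP torus] := torus_normalization F0 aut.
have autP := aut_conj aut uP; set psi := (fun x => _) in autP torus.
have [tau [f tauP]] := root_images F0 autP torus.
have [pi piI [tE|tE]] := root_permutation F0 autP tauP torus.
  left; apply: (semilinear_conj_conj uP); apply: (semilinear_of_roots (f := f) autP piI).
  by move=> i j a ij; have [_ _ ->] := tauP i j ij; rewrite tE.
right; pose P' := (invmx P)^T; have uP' : P' \in unitmx by rewrite unitmx_tr unitmx_inv.
apply: (semilinear_conj_conj uP').
have E x : \det x = 1 -> P' *m (invmx (phi x))^T *m invmx P' = (invmx (psi x))^T.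
  move=> dx; have u := det1_unitmx (autSL aut dx).
  rewrite /P' /psi -trmx_inv invmxK -!trmx_mul !invmx_mul ?unitmx_mul ?unitmx_inv ?uP // invmxK.
  by rewrite mulmxA.
have [|Q uQ [sigma sE]] := semilinear_of_roots (f := fun i j a => - f i j a) (aut_contragredient autP) piI.
  move=> i j a ij; have [_ _ ->] := tauP i j ij; rewrite tE //=.
  have pij : pi j != pi i by rewrite (inj_eq piI) eq_sym.
  have -> : invmx (transvection (pi j) (pi i) (f i j a)) = transvection (pi j) (pi i) (- f i j a).
    have d x : \det (transvection (pi j) (pi i) x : M) = 1 by exact: det_transvection.
    apply: (can_inj (mulmxK (det1_unitmx (d (f i j a))))).
    by rewrite mulVmx ?det1_unitmx // transvectionD // addNr transvection0.
  by rewrite /transvection raddfD /= trmx1 linearZ /= trmx_delta.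
by exists Q => //; exists sigma => x dx; rewrite E // sE.
Qed.

End Classification.

(** * Finite transcendence degree *)

(** If y does not serve arbitrarily large b, it serves none beyond some M; restricting [I] to b > M
    removes y from the list. *)
Lemma infinite_pigeonhole (T : eqType) (s : seq T) (I : nat -> Prop) (P : nat -> T -> Prop) :
    (forall M, exists2 b, (M < b)%N & I b) -> (forall b, I b -> exists2 y, y \in s & P b y) ->
  exists y, forall M, exists2 b, (M < b)%N & I b /\ P b y.
Proof.
elim: s I => [|y s IH] I Iinf IP.
  by have [b _ /IP [y]] := Iinf 0%N.
have [yinf|] := pselect (forall M, exists2 b, (M < b)%N & I b /\ P b y); first by exists y.
move=> /existsNP [M /forall2NP yM].
have [||z zP] := IH (fun b => I b /\ (M < b)%N).
- move=> N; have [b ltb Ib] := Iinf (maxn M N); exists b; last split=> //.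
    exact: leq_ltn_trans (leq_maxr _ _) ltb.
  exact: leq_ltn_trans (leq_maxl _ _) ltb.
- move=> b [Ib ltMb]; have [z] := IP b Ib; rewrite inE => /predU1P [->|zs] Pz; last by exists z.
  by case: (yM b) => // -[]; split.
by exists z => N; have [b ltb [[Ib _] Pz]] := zP N; exists b.
Qed.

Section FiniteTrdeg.
Variables (F : closedFieldType) (F0 : [pchar F] =i pred0) (m : nat).
Local Notation n := m.+2.
Local Notation M := 'M[F]_n.
Implicit Types (a b : nat) (w x y z : M).

Let e : 'I_n := lift ord0 ord0.

(** Booleans read as exponents: [ratio_mx b] has b at [e], 1/b at 0 and 1 elsewhere. In this form
    the powers of the second prime can later be carried along without distinguishing columns. *)
Definition num_exp (i : 'I_n) : nat := (i == e).
Definition den_exp (i : 'I_n) : nat := (i == 0).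

Definition ratio_mx b : M := diag_mx (\row_i ((b ^ num_exp i)%:R / (b ^ den_exp i)%:R)).

(** The matrix of a bilinear form: an antidiagonal block with entries 1 and b at the indices 0 and
    [e], the identity elsewhere. *)
Definition twist_mx b : M := \matrix_(i, j)
  if i == 0 then (j == e)%:R else if i == e then (j == 0)%:R * b%:R else (i == j)%:R.

(** Congruence of bilinear forms X induces conjugacy of their cosquares X X^-T; this form is chosen
    to have the diagonal ratio matrix as cosquare. *)
Lemma twist_mxE b : prime b -> ratio_mx b *m (twist_mx b)^T = twist_mx b.
Proof.
move=> b_pr; have b0 : b%:R != 0 :> F by rewrite (natr_neq0 F0) ?prime_gt0.
apply/matrixP => i j; rewrite mul_diag_mx !mxE /num_exp /den_exp.
have e0 : (e == 0) = false by [].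
have z0 : (0 == e) = false by [].
have [->|i0] := eqVneq i 0; have [->|j0] := eqVneq j 0; rewrite ?eqxx ?z0 ?e0 /=.
- by rewrite mulr0.
- case: (eqVneq j e) => [jE|je]; first by rewrite !mul1r mulVf.
  by rewrite mulr0.
- case: (eqVneq i e) => [iE|ie]; first by rewrite !mul1r divr1 mulr1.
  by rewrite mulr0 (negPf i0).
- case: (eqVneq i e) => [iE|ie]; case: (eqVneq j e) => [jE|je] /=.
  + by rewrite !mul0r mulr0.
  + by rewrite iE (negPf je) mul0r mulr0.
  + by rewrite jE (negPf ie) mul0r mulr0.
  + by rewrite expn0 divr1 mul1r eq_sym.
Qed.

Lemma ratio_mx_unit b : prime b -> ratio_mx b \in unitmx.
Proof.
move=> b_pr; rewrite unitmxE det_diag unitfE; apply/prodf_neq0 => i _; rewrite mxE.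
by rewrite mulf_neq0 ?invr_neq0 // (natr_neq0 F0) // expn_gt0 prime_gt0.
Qed.

Lemma twist_mx_unit b : prime b -> twist_mx b \in unitmx.
Proof.
move=> b_pr; have b0 : b%:R != 0 :> F by rewrite (natr_neq0 F0) ?prime_gt0.
have e0 : (e == 0) = false by [].
pose Y : M := \matrix_(i, j)
  if i == 0 then (j == e)%:R / b%:R else if i == e then (j == 0)%:R else (i == j)%:R.
suff /mulmx1_unit [] : twist_mx b *m Y = 1%:M by [].
apply/matrixP => i j; rewrite !mxE.
have [->|i0] := eqVneq i 0.
  rewrite (bigD1 e) //= big1 ?addr0 => [|k /negPf ke]; last by rewrite !mxE eqxx ke mul0r.
  by rewrite !mxE !eqxx e0 mul1r eq_sym.
have [->|ie] := eqVneq i e.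
  rewrite (bigD1 0) //= big1 ?addr0 => [|k /negPf k0]; last by rewrite !mxE e0 eqxx k0 !mul0r.
  by rewrite !mxE e0 !eqxx mul1r mulrC divfK // eq_sym.
rewrite (bigD1 i) //= big1 ?addr0 => [|k]; last first.
  by rewrite eq_sym => /negPf ik; rewrite !mxE (negPf i0) (negPf ie) ik mul0r.
by rewrite !mxE (negPf i0) (negPf ie) eqxx mul1r.
Qed.

Lemma map_twist_mx (sigma : {rmorphism F -> F}) b : map_mx sigma (twist_mx b) = twist_mx b.
Proof.
apply/matrixP => i j; rewrite !mxE; case: ifP => _; first exact: rmorph_nat.
by case: ifP => _; rewrite ?rmorphM !rmorph_nat.
Qed.

Lemma unitmx_row_neq0 w i : w \in unitmx -> exists j, w i j != 0.
Proof.
move=> uw; apply: contrapT => H.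
have r0 : row i w = 0.
  by apply/rowP => j; rewrite !mxE; apply/eqP/negPn/negP => wij; apply: H; exists j.
have : row i w *m invmx w = row i (1%:M : M) by rewrite -row_mul mulmxV.
by rewrite r0 mul0mx => /rowP /(_ i); rewrite !mxE eqxx => /eqP; rewrite eq_sym oner_eq0.
Qed.

(** An entry of [w] in row 0 is multiplied by b k and one in row [e] by k / b under tau, up to
    powers of a. In their quotient k cancels and b^2 remains. *)
Lemma ratio_eigenvector (tau : {rmorphism F -> F}) a b w k :
    prime a -> prime b -> b != a -> w \in unitmx -> k != 0 ->
    ratio_mx b *m map_mx tau w = k *: (w *m ratio_mx a) ->
  exists u, prime_eigenvector tau a b u.
Proof.
move=> a_pr b_pr ba uw k0 E.
have [l wl] := unitmx_row_neq0 0 uw; have [l' wl'] := unitmx_row_neq0 e uw.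
have nz c i : prime c -> (c ^ i)%:R != 0 :> F.
  by move=> c_pr; rewrite (natr_neq0 F0) // expn_gt0 prime_gt0.
have b0 : b%:R != 0 :> F by rewrite (natr_neq0 F0) ?prime_gt0.
have entry i j : (b ^ num_exp i)%:R / (b ^ den_exp i)%:R * tau (w i j) =
    k * (w i j * ((a ^ num_exp j)%:R / (a ^ den_exp j)%:R)).
  by move/matrixP/(_ i j): E; rewrite /ratio_mx mul_diag_mx mul_mx_diag !mxE.
have := entry 0 l; have := entry e l'.
rewrite /num_exp /den_exp !eqxx (_ : (e == 0) = false) // (_ : (0 == e) = false) //.
rewrite !expn0 !expn1 divr1 mul1r.
set j1 := (l == e : nat); set i1 := (l == 0 : nat).
set j2 := (l' == e : nat); set i2 := (l' == 0 : nat) => E2 E1.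
exists (w 0 l / w e l'); split=> //; first by rewrite mulf_neq0 ?invr_neq0.
exists (b%:R ^+ 2 * ((a ^ j1)%:R / (a ^ i1)%:R) * ((a ^ i2)%:R / (a ^ j2)%:R)), (i1 + j2)%N, (j1 + i2)%N.
have [a1 a2 a3 a4] := And4 (nz a i1 a_pr) (nz a j1 a_pr) (nz a i2 a_pr) (nz a j2 a_pr).
split; last first.
  by rewrite !expnD !natrM !natrX; field; rewrite -!natrX a4 a1.
have {E1}E1 : tau (w 0 l) = b%:R * (k * (w 0 l * ((a ^ j1)%:R / (a ^ i1)%:R))).
  by rewrite -E1 mulVKf.
have {E2}E2 : tau (w e l') = b%:R^-1 * (k * (w e l' * ((a ^ j2)%:R / (a ^ i2)%:R))).
  by rewrite -E2 mulKf.
rewrite fmorph_div E1 E2; field.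
by rewrite wl' a4 a3 a1 b0 k0.
Qed.

(** One y serves infinitely many primes; one of these is fixed as [a], and the others yield
    eigenvectors. [P] abstracts the relation to y, which differs between the two kinds of
    automorphism. *)
Lemma ratio_infinite_trdeg (tau : {rmorphism F -> F}) (s : seq M) (P : nat -> M -> Prop) :
    (forall b, prime b -> exists2 y, y \in s & P b y) ->
    (forall a b y, prime a -> prime b -> P a y -> P b y -> exists w k,
       [/\ w \in unitmx, k != 0 & ratio_mx b *m map_mx tau w = k *: (w *m ratio_mx a)]) ->
  ~ finite_trdeg F.
Proof.
move=> sP PP.
have [|y yinf] := infinite_pigeonhole (I := fun b => prime b) _ sP.
  by move=> N; have [p] := prime_above N; exists p.
have [a _ [a_pr Pa]] := yinf 0%N.
apply: (eigenvectors_infinite_trdeg F0 (sigma := tau) a_pr) => N.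
have [b ltb [b_pr Pb]] := yinf (maxn a N).
have ba : b != a by rewrite gtn_eqF // (leq_ltn_trans (leq_maxl _ _) ltb).
have [w [k [uw k0 E]]] := PP a b y a_pr b_pr Pa Pb.
have [u uP] := ratio_eigenvector a_pr b_pr ba uw k0 E.
by exists b, u; rewrite (leq_ltn_trans (leq_maxr _ _) ltb).
Qed.

(** Finiteness up to scalars, with conjugating elements of determinant 1. It follows from finiteness
    of R(phi) on SL_n and on GL_n alike, and it tolerates the rescaling of test matrices. *)
Definition projectively_finite (phi : M -> M) := exists s : seq M,
  (forall y, y \in s -> y \in unitmx) /\
  forall x, \det x = 1 -> exists y z c,
    [/\ y \in s, \det z = 1, c != 0 & x = c *: (z *m y *m invmx (phi z))].

Lemma exists_det1_scaling (Q D : M) : Q \in unitmx -> D \in unitmx ->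
  exists2 c, c != 0 & \det (c *: (D *m Q)) = 1.
Proof.
move=> uQ uD; have d0 : \det (D *m Q) != 0 by rewrite -unitfE -unitmxE unitmx_mul uD.
have [c cE] : exists c, c ^+ n = (\det (D *m Q))^-1.
  have := @solve_monicpoly F n (fun i => if i == 0%N then (\det (D *m Q))^-1 else 0) isT.
  case=> c cE; exists c; rewrite [LHS]cE big_ord_recl /= expr0 mulr1 big1 ?addr0 //.
  by move=> i _; rewrite mul0r.
exists c; last by rewrite detZ cE mulVf.
by apply: contraTneq isT => c0; move/eqP: cE; rewrite c0 expr0n eq_sym invr_eq0 (negPf d0).
Qed.

(** Since phi(z) = Q sigma(z) Q^-1, testing on multiples of [ratio_mx b *m invmx Q] absorbs Q into
    the representative y. Two primes with a common representative are then compared through z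
    z'^-1. *)
Lemma semilinear_not_finite phi : is_group_aut (@SLpred F n) phi -> semilinear_conj phi ->
  projectively_finite phi -> ~ finite_trdeg F.
Proof.
move=> aut [Q uQ [sigma sE]] [s [su sP]].
pose P b y := exists z c, [/\ z \in unitmx, c != 0 &
  ratio_mx b *m map_mx sigma z = c *: (z *m y)].
apply: (@ratio_infinite_trdeg sigma [seq y *m Q | y <- s] P).
  move=> b b_pr; have uQ' : invmx Q \in unitmx by rewrite unitmx_inv.
  have [d d0 dx] := exists_det1_scaling uQ' (ratio_mx_unit b_pr).
  have [y [z [c [ys dz c0 xE]]]] := sP _ dx.
  exists (y *m Q); first exact: map_f.
  have uz := det1_unitmx dz; have us : map_mx sigma z \in unitmx by rewrite map_unitmx.
  exists z, (d^-1 * c); split=> //; first by rewrite mulf_neq0 ?invr_neq0.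
  move: xE; rewrite sE // !invmx_mul ?unitmx_mul ?uQ ?unitmx_inv // invmxK.
  move/(congr1 (fun x => d^-1 *: (x *m Q *m map_mx sigma z))).
  rewrite -!scalemxAl scalerA mulVf // scale1r mulmxKV // => ->.
  rewrite scalerA; congr (_ *: _); rewrite !mulmxA mulmxKV // mulmxKV //.
move=> a b y a_pr b_pr [z' [c' [uz' c'0 E']]] [z [c [uz c0 E]]].
have us' : map_mx sigma z' \in unitmx by rewrite map_unitmx.
exists (z *m invmx z'), (c / c'); split.
- by rewrite unitmx_mul uz unitmx_inv.
- by rewrite mulf_neq0 ?invr_neq0.
- rewrite map_mxM map_invmx mulmxA E -scalemxAl -scalerA; congr (_ *: _).
  apply: (canLR (mulmxK us')); rewrite -scalemxAl -!mulmxA E' -!scalemxAr scalerA mulVf //.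
  by rewrite scale1r (mulmxA (invmx z')) mulVmx // mul1mx.
Qed.

(** Here phi(z)^-1 is conjugate by Q^T to sigma(z)^T, so the classes are those of bilinear forms
    under sigma-twisted congruence, tested on multiples of [twist_mx b *m Q^T]. *)
Lemma contragredient_not_finite phi : is_group_aut (@SLpred F n) phi ->
  semilinear_conj (fun x => (invmx (phi x))^T) -> projectively_finite phi -> ~ finite_trdeg F.
Proof.
move=> aut [Q uQ [sigma sE]] [s [su sP]].
have uQt : Q^T \in unitmx by rewrite unitmx_tr.
have uQ' : invmx Q^T \in unitmx by rewrite unitmx_inv.
pose P b y := exists z c, [/\ z \in unitmx, c != 0 &
  twist_mx b = c *: (z *m y *m (map_mx sigma z)^T)].
apply: (@ratio_infinite_trdeg (sigma \o sigma) [seq y *m invmx Q^T | y <- s] P).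
  move=> b b_pr; have [d d0 dx] := exists_det1_scaling uQt (twist_mx_unit b_pr).
  have [y [z [c [ys dz c0 xE]]]] := sP _ dx.
  exists (y *m invmx Q^T); first exact: map_f.
  exists z, (d^-1 * c); split; [exact: det1_unitmx | by rewrite mulf_neq0 ?invr_neq0|].
  move: xE; rewrite -[invmx (phi z)]trmxK sE // !trmx_mul trmx_inv.
  move/(congr1 (fun x => d^-1 *: (x *m invmx Q^T))).
  rewrite -!scalemxAl scalerA mulVf // scale1r mulmxK // => ->.
  by rewrite scalerA; congr (_ *: _); rewrite !mulmxA mulmxK.
move=> a b y a_pr b_pr [z' [c' [uz' c'0 E']]] [z [c [uz c0 E]]].
pose w := z *m invmx z'; have uw : w \in unitmx by rewrite unitmx_mul uz unitmx_inv.
pose k := c / c'; have k0 : k != 0 by rewrite mulf_neq0 ?invr_neq0.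
have sk0 : sigma k != 0 by rewrite fmorph_eq0.
have us : map_mx sigma w \in unitmx by rewrite map_unitmx.
have [ua ub] := (twist_mx_unit a_pr, twist_mx_unit b_pr).
(* X_b = k w X_a sigma(w)^T; comparing with its sigma-transpose eliminates sigma(w). *)
have XE : twist_mx b = k *: (w *m twist_mx a *m (map_mx sigma w)^T).
  rewrite E E' /w /k map_mxM map_invmx -!scalemxAr -!scalemxAl scalerA -mulrA mulVf // mulr1.
  congr (_ *: _); rewrite trmx_mul trmx_inv !mulmxA mulmxKV //.
  by rewrite mulmxK // unitmx_tr map_unitmx.
clearbody w k.
have sXE : (twist_mx b)^T = sigma k *: (map_mx (sigma \o sigma) w *m (twist_mx a)^T *m (map_mx sigma w)^T).
  rewrite -[in LHS](map_twist_mx sigma) XE map_mxZ !map_mxM -map_trmx map_twist_mx.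
  rewrite linearZ /= !trmx_mul trmxK mulmxA; congr (_ *: (_ *m _ *m _)).
  by apply/matrixP => i j; rewrite !mxE.
exists w, (k / sigma k); split=> //; first by rewrite mulf_neq0 ?invr_neq0.
have ust : (map_mx sigma w)^T \in unitmx by rewrite unitmx_tr.
have uat : (twist_mx a)^T \in unitmx by rewrite unitmx_tr.
apply: (can_inj (mulmxK uat)); apply: (can_inj (mulmxK ust)).
apply: (scalerI sk0); rewrite -!scalemxAl scalerA mulrCA divff // mulr1.
have := twist_mxE b_pr; rewrite sXE -scalemxAr !mulmxA => ->.
by rewrite XE -[in LHS](twist_mxE a_pr) !mulmxA.
Qed.

Lemma sl_aut_not_projectively_finite phi : is_group_aut (@SLpred F n) phi ->
  finite_trdeg F -> ~ projectively_finite phi.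
Proof.
move=> aut Ffin pf; case: (sl_aut_classification F0 aut) => semi.
  exact: semilinear_not_finite semi pf Ffin.
exact: contragredient_not_finite semi pf Ffin.
Qed.

End FiniteTrdeg.

(** * Reduction of SL_n and GL_n to projective finiteness *)

Section Rinfty.
Variables (F : closedFieldType) (F0 : [pchar F] =i pred0) (m : nat).
Local Notation n := m.+2.
Local Notation M := 'M[F]_n.
Implicit Types (x y z : M).

Lemma sl_reidemeister_projective (phi : M -> M) : reidemeister_finite (@SLpred F n) phi ->
  projectively_finite phi.
Proof.
move=> [s [sSL sP]]; exists s; split=> [y /sSL /eqP /det1_unitmx //|x /eqP dx].
have [y [ys [z [/eqP dz xE]]]] := sP x dx.
by exists y, z, 1; rewrite scale1r oner_neq0.
Qed.

Lemma central_scalar (K : M) : (forall i j, i != j ->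
  K *m transvection i j 1 = transvection i j 1 *m K) -> K = (K 0 0)%:M.
Proof.
move=> KC; have E i j k l : i != j -> K k i * (l == j)%:R = (k == i)%:R * K j l.
  move=> /KC /matrixP /(_ k l); rewrite mul_transvectionE transvection_mulE !mulr1.
  exact: addrI.
have off k i : k != i -> K k i = 0.
  by move=> ki; have := E i k k k; rewrite eq_sym ki eqxx (negPf ki) mul0r mulr1; apply.
apply/matrixP => i j; rewrite !mxE; have [->|ij] := eqVneq i j; last by rewrite off.
have [->//|j0] := eqVneq j 0.
by have := E j 0 j 0 j0; rewrite !eqxx mul1r mulr1.
Qed.

Section GL.
Variables (phi : M -> M) (aut : is_group_aut (@GLpred F n) phi).

Lemma gl_autU x : x \in unitmx -> phi x \in unitmx.
Proof. by case: aut => + _ _ _; apply. Qed.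

Lemma gl_autI x y : x \in unitmx -> y \in unitmx -> phi x = phi y -> x = y.
Proof. by case: aut => _ + _ _; apply. Qed.

Lemma gl_autS y : y \in unitmx -> exists2 x, x \in unitmx & phi x = y.
Proof. by case: aut => _ _ + _ => /(_ y) h /h [x [ux <-]]; exists x. Qed.

Lemma gl_autM x y : x \in unitmx -> y \in unitmx -> phi (x *m y) = phi x *m phi y.
Proof. by case: aut => _ _ _; apply. Qed.

Lemma gl_aut1 : phi 1%:M = 1%:M.
Proof.
have u1 := unitmx1 F n; have := gl_autM u1 u1; rewrite mulmx1.
by move=> /(congr1 (mulmx (invmx (phi 1%:M)))); rewrite mulKmx ?mulVmx ?gl_autU.
Qed.

Lemma transvection_unit i j (a : F) : i != j -> (transvection i j a : M) \in unitmx.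
Proof. by move=> ij; apply/det1_unitmx/det_transvection. Qed.

(* Conjugation by a diagonal matrix can square a transvection, which forces
   determinant 1 in any image or preimage. *)
Lemma transvection_square_conj i j (a : F) : i != j -> exists2 t : M, t \in unitmx &
  t *m transvection i j a = transvection i j a *m transvection i j a *m t.
Proof.
move=> ij; have n2 : 2%:R != 0 :> F by exact: natr_neq0.
pose d (k : 'I_n) : F := if k == i then 2%:R else 1.
have d0 k : d k != 0 by rewrite /d; case: ifP => _ //; exact: oner_neq0.
exists (diag_mx (\row_k d k)).
  by rewrite unitmxE det_diag unitfE; apply/prodf_neq0 => k _; rewrite mxE.
have dj : d j = 1 by rewrite /d eq_sym (negPf ij).
have tE k : (diag_mx (\row_k d k) : M) k k = d k by rewrite !mxE eqxx.
rewrite transvectionD // transvection_conj_diag ?diag_mx_is_diag ?tE // dj divr1 /d eqxx.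
by rewrite mulr_natl mulr2n.
Qed.

Lemma square_conj_det1 (t x : M) : t \in unitmx -> x \in unitmx ->
  t *m x = x *m x *m t -> \det x = 1.
Proof.
rewrite !unitmxE !unitfE => t0 x0 /(congr1 determinant); rewrite !det_mulmx => E.
by apply/esym/(mulfI x0)/(mulIf t0); rewrite mulr1 -E mulrC.
Qed.

(** Both directions are checked on transvections, which generate SL_n: their images and preimages
    are conjugate to their own squares. *)
Lemma gl_aut_sl : is_group_aut (@SLpred F n) phi.
Proof.
have slU x : \det x = 1 -> x \in unitmx by exact: det1_unitmx.
have phi_det x : \det x = 1 -> \det (phi x) = 1.
  move=> dx; have [] : \det x = 1 /\ \det (phi x) = 1; last by [].
  apply: (sl_gen (H := fun x => \det x = 1 /\ \det (phi x) = 1)) dx.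
  - by rewrite gl_aut1 det1.
  - move=> y z [dy py] [dz pz]; rewrite det_mulmx dy dz mulr1.
    by rewrite gl_autM ?slU // det_mulmx py pz mulr1.
  - move=> i j a ij; rewrite det_transvection //; split=> //.
    have [t ut E] := transvection_square_conj a ij; have ux := transvection_unit a ij.
    apply: (square_conj_det1 (gl_autU ut) (gl_autU ux)).
    by rewrite -!gl_autM ?unitmx_mul ?ux // E.
split; rewrite /SLpred.
- by move=> x /eqP /phi_det ->.
- by move=> x y /eqP /slU ux /eqP /slU uy; exact: gl_autI.
- move=> y /eqP dy; have : exists x, \det x = 1 /\ phi x = y; last first.
    by case=> x [dx xE]; exists x; rewrite dx.
  apply: (sl_gen (H := fun y => exists x, \det x = 1 /\ phi x = y)) dy.
  + by exists 1%:M; rewrite det1 gl_aut1.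
  + move=> _ _ [x [dx <-]] [z [dz <-]]; exists (x *m z).
    by rewrite det_mulmx dx dz mulr1 gl_autM ?slU.
  + move=> i j a ij; have [x ux xE] := gl_autS (transvection_unit a ij); exists x; split=> //.
    have [t ut E] := transvection_square_conj a ij; have [s us sE] := gl_autS ut.
    apply: (square_conj_det1 us ux); apply: gl_autI; rewrite ?unitmx_mul ?us ?ux //.
    by rewrite !gl_autM ?unitmx_mul ?ux // xE sE.
- by move=> x y /eqP /slU ux /eqP /slU uy; exact: gl_autM.
Qed.

(** A scalar brings z to determinant 1. As phi maps scalar matrices to scalar matrices, phi(z) also
    changes by a scalar only, and the relation persists projectively. *)
Lemma gl_reidemeister_projective : reidemeister_finite (@GLpred F n) phi ->
  projectively_finite phi.
Proof.
move=> [s [sGL sP]]; exists s; split=> [y /sGL //|x dx].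
have [y [ys [z [uz xE]]]] := sP x (det1_unitmx dx).
have uy : y \in unitmx by exact: sGL.
have [c c0 dz] := exists_det1_scaling (unitmx1 F n) uz; rewrite mulmx1 in dz.
have uc : (c%:M : M) \in unitmx by rewrite unitmxE det_scalar unitrX ?unitfE.
have [k kE] : exists k, phi c%:M = k%:M.
  exists (phi c%:M 0 0); apply: central_scalar => i j ij.
  have [u uu <-] := gl_autS (transvection_unit 1 ij).
  by rewrite -!gl_autM // scalar_mxC.
have k0 : k != 0.
  have := gl_autU uc; rewrite kE unitmxE det_scalar unitfE expf_eq0 /= => h.
  by apply: contraNneq h => ->; rewrite eqxx.
exists y, (c *: z), (k / c); split=> //; first by rewrite mulf_neq0 ?invr_neq0.
have cz : phi (c *: z) = k *: phi z by rewrite -mul_scalar_mx gl_autM // kE mul_scalar_mx.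
have ukz : k *: phi z \in unitmx by rewrite -cz gl_autU // unitmxZ ?unitfE.
rewrite cz invmxZ // -!scalemxAl -scalemxAr !scalerA xE.
by rewrite divfK // mulfV // scale1r.
Qed.

End GL.

Lemma finite_trdeg_R_infty : finite_trdeg F ->
  R_infty_property (@SLpred F n) /\ R_infty_property (@GLpred F n).
Proof.
move=> Ffin; split=> phi aut fin.
  exact: (sl_aut_not_projectively_finite F0 aut Ffin (sl_reidemeister_projective fin)).
apply: (sl_aut_not_projectively_finite F0 (gl_aut_sl aut) Ffin).
exact: gl_reidemeister_projective.
Qed.

End Rinfty.

(** * Lang's theorem for solvable difference fields *)

Section Lang.
Variables (F : fieldType) (sigma : {rmorphism F -> F}).

(** The equations with c0 = 0 and t nonzero produce fixed vectors; those with d = 1 and arbitrary c0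
    fill in the entries below the corner in the induction for Lang's theorem. *)
Definition twisted_solvable := forall d (c : nat -> F) c0, (exists2 i, (i < d)%N & c i != 0) ->
  exists2 t, t != 0 & t = c0 + \sum_(i < d) c i * iter i.+1 sigma t.

Hypothesis solv : twisted_solvable.

(** On the span of the iterates of one vector, the sigma-linear map f has a companion matrix. For a
    combination of the iterates, being fixed by f determines every coordinate from the last one, t,
    and leaves a single scalar equation for t. *)
Lemma fixed_row n (A : 'M[F]_n.+1) : A \in unitmx ->
  exists2 w : 'rV[F]_n.+1, w != 0 & map_mx sigma w *m A = w.
Proof.
move=> uA; pose f (x : 'rV[F]_n.+1) := map_mx sigma x *m A.
have fD x y : f (x + y) = f x + f y by rewrite /f map_mxD mulmxDl.
have fZ a x : f (a *: x) = sigma a *: f x by rewrite /f map_mxZ scalemxAl.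
have f0 : f 0 = 0 by rewrite /f map_mx0 mul0mx.
have f_eq0 x : f x = 0 -> x = 0.
  move=> fx; apply/eqP; rewrite -(map_mx_eq0 sigma); apply/eqP.
  by apply: (can_inj (mulmxK uA)); rewrite mul0mx.
pose v k := iter k f (delta_mx 0 0).
have v_neq0 k : v k != 0.
  elim: k => [|k IH]; last by apply: contra_neq IH => /f_eq0.
  by apply/eqP => /rowP /(_ 0); rewrite !mxE !eqxx /= => /eqP; rewrite oner_eq0.
(* Dependence among the first [d] iterates. The least such number is later written as a successor,
   so that v_d is a combination of the independent v_0, ..., v_(d-1). *)
pose dep d := exists2 a : nat -> F, exists2 i, (i < d)%N & a i != 0 & \sum_(i < d) a i *: v i = 0.
have ex_dep : exists d, `[< dep d >].
  exists n.+2; apply/asboolP; pose V := \matrix_(i < n.+2) v i.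
  have : kermx V != 0.
    rewrite kermx_eq0; apply/negP => /eqP rV.
    by have := rank_leq_col V; rewrite rV ltnn.
  case/rowV0Pn => u /sub_kermxP uV u0.
  have [i ui] : exists i, u 0 i != 0.
    apply: contrapT => H; case/eqP: u0; apply/rowP => i; rewrite mxE.
    by apply/eqP/negPn/negP => ui; apply: H; exists i.
  exists (fun k => u 0 (inord k)); first by exists i; rewrite ?inord_val.
  rewrite -[RHS]uV mulmx_sum_row; apply: eq_bigr => k _.
  by rewrite inord_val rowK.
case: (ex_minnP ex_dep) => d /asboolP [u [i0 ltid ui0] udep] dmin.
have {dmin} dmin d' (a : nat -> F) i : (d' < d)%N -> (i < d')%N -> a i != 0 ->
    \sum_(i < d') a i *: v i <> 0.
  move=> ltd' ltid' ai E; have : (d <= d')%N by apply/dmin/asboolP; exists a => //; exists i.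
  by rewrite leqNgt ltd'.
case: d => // d in i0 ltid ui0 udep dmin.
have ud : u d != 0.
  apply/eqP => ud; move: udep; rewrite big_ord_recr /= ud scale0r addr0.
  apply: (dmin d u i0) => //; move: ltid; rewrite ltnS leq_eqVlt => /predU1P [i0d|//].
  by rewrite i0d ud eqxx in ui0.
pose a i := - (u i / u d).
have vd : v d = \sum_(i < d) a i *: v i.
  move: udep; rewrite big_ord_recr /= addrC => /eqP; rewrite addr_eq0 => /eqP udv.
  apply: (scalerI ud); rewrite udv scaler_sumr -sumrN; apply: eq_bigr => i _.
  by rewrite scalerA /a mulrN mulrC divfK // scaleNr.
have d0 : (0 < d)%N.
  by case: (d) vd (v_neq0 d) => // ->; rewrite big_ord0 eqxx.
have [j ltjd aj] : exists2 j, (j < d)%N & a j != 0.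
  apply: contrapT => H; case/eqP: (v_neq0 d); rewrite vd big1 // => i _.
  by apply/eqP; rewrite scaler_eq0; apply/orP; left; apply/negPn/negP => ai; apply: H; exists i.
have iterD k x y : iter k sigma (x + y) = iter k sigma x + iter k sigma y.
  by elim: k => //= k ->; rewrite rmorphD.
have iter_neq0 k x : x != 0 -> iter k sigma x != 0.
  by move=> x0; elim: k => //= k IH; rewrite fmorph_eq0.
(* Unrolling the recursion for the coordinates [x] below gives t = sum_i sigma^i(a_(d-1-i))
   sigma^(i+1)(t); some a_j is nonzero because v_d is. *)
have [|t t0] := @solv d (fun i => iter i sigma (a (d.-1 - i)%N)) 0.
  exists (d.-1 - j)%N; first by rewrite (leq_ltn_trans (leq_subr _ _)) ?prednK.
  by rewrite subKn ?iter_neq0 // -ltnS prednK.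
rewrite add0r => tE.
pose x := fix x i := if i is i'.+1 then sigma (x i') + sigma t * a i'.+1 else sigma t * a 0%N.
have xE i : x i = \sum_(k < i.+1) iter k sigma (a (i - k)%N) * iter k.+1 sigma t.
  elim: i => [|i IH]; first by rewrite big_ord1 /= mulrC.
  rewrite big_ord_recl /= subn0 addrC IH rmorph_sum mulrC; congr (_ + _).
  by apply: eq_bigr => k _; rewrite rmorphM /= subSS.
clear i0 ltid ui0 udep ud j ltjd aj.
have vS k : f (v k) = v k.+1 by [].
clear ex_dep; clearbody a v.
case: d => // e in dmin vd d0 tE *.
have xe : x e = t by rewrite xE -tE.
pose w := \sum_(k < e.+1) x k *: v k.
have fw : f w = w.
  have -> : f w = \sum_(k < e.+1) sigma (x k) *: v k.+1.
    rewrite /w (big_morph f fD f0); by apply: eq_bigr => k _; rewrite fZ vS.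
  rewrite big_ord_recr /= xe vd /w big_ord_recl [in RHS]big_ord_recl /= scalerDr scalerA.
  rewrite addrCA; congr (_ + _); rewrite scaler_sumr -big_split; apply: eq_bigr => k _ /=.
  by rewrite scalerDl scalerA.
exists w => //; apply/eqP => w0.
by apply: (dmin e.+1 x e) => //; rewrite xe.
Qed.

Lemma row_completion (K : fieldType) n (w : 'rV[K]_(1 + n)) : w != 0 ->
  exists2 P : 'M_(1 + n), P \in unitmx & usubmx P = w.
Proof.
move=> w0; pose R : 'M_(1 + n) := row_ebase w; pose C : 'M_1 := col_ebase w.
have rw : \rank w = 1%N by rewrite rank_rV w0.
have uP : block_mx C 0 0 1%:M *m R \in unitmx.
  rewrite unitmx_mul row_ebase_unit andbT unitmxE det_lblock det1 mulr1 -unitmxE.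
  exact: col_ebase_unit.
exists (block_mx C 0 0 1%:M *m R) => //.
rewrite -{1}[R]vsubmxK mul_block_col col_mxKu mul0mx addr0.
rewrite -[RHS]mulmx_ebase rw -/C -/R -mulmxA; congr (_ *m _).
rewrite -{2}[R]vsubmxK pid_mx_row mul_row_col mul0mx addr0 mul1mx.
reflexivity.
Qed.

(** In a basis that begins with a fixed row, A becomes block lower triangular with corner 1. The
    induction hypothesis handles the smaller block, and inhomogeneous scalar equations the column
    below the corner. *)
Lemma lang n (A : 'M[F]_n) : A \in unitmx ->
  exists2 Z, Z \in unitmx & Z = map_mx sigma Z *m A.
Proof.
elim: n A => [|n IH] A uA.
  by exists 1%:M; [exact: unitmx1 | rewrite [LHS]flatmx0 [RHS]flatmx0].
have [w w0 wE] := fixed_row uA.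
have [P uP Pw] := row_completion (w0 : (w : 'rV_(1 + n)) != 0).
have usP : map_mx sigma P \in unitmx by rewrite map_unitmx.
pose B : 'M_(1 + n) := map_mx sigma P *m A *m invmx P.
have uB : B \in unitmx by rewrite !unitmx_mul usP uA unitmx_inv.
have BP : B *m P = map_mx sigma P *m A by rewrite mulmxKV.
have uBE : usubmx B = row_mx 1%:M 0.
  apply: (can_inj (mulmxK uP)); rewrite mul_usub_mx BP -mul_usub_mx -map_usubmx Pw wE.
  by rewrite -{1}[P]vsubmxK mul_row_col mul1mx mul0mx addr0 Pw.
pose b := dlsubmx B; pose A' := drsubmx B.
have BE : B = block_mx 1%:M 0 b A'.
  rewrite -[LHS]submxK; congr block_mx; rewrite /ulsubmx /ursubmx uBE ?row_mxKl ?row_mxKr //.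
have uA' : A' \in unitmx.
  by move: uB; rewrite BE unitmxE det_lblock det1 mul1r -unitmxE.
have [Z' uZ' Z'E] := IH A' uA'.
have /choice [y yE] i : exists t, t = sigma t + (map_mx sigma Z' *m b) i 0.
  have [|t _ tE] := @solv 1 (fun=> 1) ((map_mx sigma Z' *m b) i 0).
    by exists 0%N => //; exact: oner_neq0.
  by exists t; rewrite [LHS]tE big_ord1 mul1r addrC.
pose Y : 'M_(1 + n) := block_mx 1%:M 0 (\col_i y i) Z'.
have YE : Y = map_mx sigma Y *m B.
  rewrite BE map_block_mx mulmx_block !map_mx0 map_mx1 !mul0mx !mulmx0 !mulmx1 ?mul1mx.
  rewrite !addr0 add0r -Z'E; congr block_mx; apply/matrixP => i j; rewrite !ord1 !mxE.
  by rewrite [LHS]yE mxE.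
exists (Y *m P).
  by rewrite unitmx_mul uP andbT unitmxE /Y (@det_lblock _ 1 n) det1 mul1r -unitmxE.
by rewrite map_mxM -mulmxA -BP mulmxA -YE.
Qed.

(** Because det A = 1, the determinant of Z is fixed by sigma, so dividing the first row of Z by it
    preserves the equation. *)
Lemma lang_sl n (A : 'M[F]_n) : \det A = 1 ->
  exists2 Z, \det Z = 1 & Z = map_mx sigma Z *m A.
Proof.
case: n A => [|n] A dA.
  by exists 1%:M; [exact: det1 | rewrite [LHS]flatmx0 [RHS]flatmx0].
have [|Z uZ ZE] := @lang n.+1 A; first by rewrite unitmxE dA unitr1.
have d0 : \det Z != 0 by rewrite -unitfE -unitmxE.
have sd : sigma (\det Z) = \det Z.
  by rewrite {2}ZE det_mulmx dA mulr1 det_map_mx.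
pose r : 'rV[F]_n.+1 := \row_i if i == 0 then (\det Z)^-1 else 1.
have sr : map_mx sigma (diag_mx r) = diag_mx r.
  apply/matrixP => i j; rewrite !mxE; case: ifP => _; rewrite rmorphMn ?fmorphV ?sd //.
  by rewrite rmorph1.
exists (diag_mx r *m Z); last by rewrite map_mxM sr -mulmxA -ZE.
rewrite det_mulmx det_diag (bigD1 0) //= mxE eqxx big1 ?mulr1 ?mulVf // => i /negPf i0.
by rewrite mxE i0.
Qed.

End Lang.

(** * Automorphisms with a single twisted class *)

Section FiniteReidemeister.
Variables (F : fieldType) (sigma : {rmorphism F -> F}).
Hypotheses (solv : twisted_solvable sigma) (surj : forall y, exists x, sigma x = y).

Lemma map_mx_surj n (y : 'M[F]_n) : exists x, map_mx sigma x = y.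
Proof.
have [g gE] := choice surj; exists (map_mx g y).
by apply/matrixP => i j; rewrite !mxE gE.
Qed.

Lemma map_mx_lang n (x Z : 'M[F]_n) : x \in unitmx -> Z \in unitmx ->
  Z = map_mx sigma Z *m invmx x -> x = invmx Z *m 1%:M *m invmx (map_mx sigma (invmx Z)).
Proof.
move=> ux uZ ZE; rewrite map_invmx invmxK mulmx1.
by apply: (can_inj (mulKmx uZ)); rewrite mulKVmx // {1}ZE mulmxKV.
Qed.

Lemma gl_not_R_infty n : ~ R_infty_property (@GLpred F n).
Proof.
move=> /(_ (map_mx sigma)); apply; first split; rewrite /GLpred.
- by move=> x; rewrite map_unitmx.
- by move=> x y _ _ /map_mx_inj.
- move=> y uy; have [x xE] := map_mx_surj y; exists x; split=> //.
  by rewrite -(map_unitmx sigma) xE.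
- by move=> x y _ _; rewrite map_mxM.
exists [:: 1%:M]; split=> [y|x ux]; first by rewrite inE => /eqP ->; rewrite /GLpred unitmx1.
exists 1%:M; split; first by rewrite inE.
have [|Z uZ ZE] := lang solv (A := invmx x); first by rewrite unitmx_inv.
by exists (invmx Z); rewrite /GLpred unitmx_inv; split=> //; exact: map_mx_lang.
Qed.

Lemma sl_not_R_infty n : ~ R_infty_property (@SLpred F n).
Proof.
move=> /(_ (map_mx sigma)); apply; first split; rewrite /SLpred.
- by move=> x /eqP dx; rewrite det_map_mx dx rmorph1.
- by move=> x y _ _ /map_mx_inj.
- move=> y /eqP dy; have [x xE] := map_mx_surj y; exists x; split=> //.
  by apply/eqP/(fmorph_inj sigma); rewrite -det_map_mx xE dy rmorph1.
- by move=> x y _ _; rewrite map_mxM.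
exists [:: 1%:M]; split=> [y|x /eqP dx]; first by rewrite inE => /eqP ->; rewrite /SLpred det1.
exists 1%:M; split; first by rewrite inE.
have [|Z dZ ZE] := lang_sl solv (A := invmx x); first by rewrite det_inv dx invr1.
exists (invmx Z); rewrite /SLpred det_inv dZ invr1; split=> //.
by apply: map_mx_lang; rewrite ?unitmxE ?dx ?dZ ?unitr1.
Qed.

End FiniteReidemeister.

(** * The Frobenius in positive characteristic *)

Section Frobenius.
Variables (F : closedFieldType) (p : nat) (charFp : p \in [pchar F]).
Local Notation frob := (pFrobenius_aut charFp).

Let p_pr : prime p. Proof. exact: pcharf_prime charFp. Qed.

Lemma iter_frob k x : iter k frob x = x ^+ (p ^ k).
Proof.
elim: k => [|k IH]; first by rewrite expn0 expr1.
by rewrite iterS IH pFrobenius_autE -exprM expnSr.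
Qed.

Lemma frob_surj y : exists x, frob x = y.
Proof.
have := @solve_monicpoly F p (fun i => if i == 0%N then y else 0) (prime_gt0 p_pr).
case=> x xE; exists x; rewrite pFrobenius_autE [LHS]xE.
case: (p) (prime_gt0 p_pr) => // p' _; rewrite big_ord_recl /= expr0 mulr1 big1 ?addr0 //.
by move=> i _; rewrite mul0r.
Qed.

(** The equation is polynomial in t, and a nonzero c_i makes it nonconstant. If c0 = 0, one factor t
    is divided out and the constant term -1 excludes the root 0; otherwise c0 excludes it. *)
Lemma frob_twisted_solvable : twisted_solvable frob.
Proof.
move=> d c c0 [i ltid ci].
have pk k : (1 < p ^ k.+1)%N by rewrite -{1}(exp1n k.+1) ltn_exp2r // prime_gt1.
(* [e] is the power of t divided out: 1 when c0 = 0, and 0 otherwise. *)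
have coefE e : (e <= 1)%N -> (\sum_(k < d) c k *: 'X^(p ^ k.+1 - e))`_(p ^ i.+1 - e) = c i.
  move=> e1; rewrite coef_sum (bigD1 (Ordinal ltid)) //= coefZ coefXn eqxx mulr1 big1 ?addr0 //.
  move=> k ki; rewrite coefZ coefXn; case: eqP => [E|]; last by rewrite mulr0.
  have {}E : (p ^ i.+1 = p ^ k.+1)%N.
    have le j : (e <= p ^ j.+1)%N by rewrite (leq_trans e1) // ltnW.
    by rewrite -[LHS](subnK (le i)) E subnK.
  move/eqP: E; rewrite eqn_exp2l ?prime_gt1 // eqSS => /eqP E.
  by case/eqP: ki; apply: val_inj.
have size_gt (q : {poly F}) N : (0 < N)%N -> q`_N != 0 -> exists t, root q t.
  move=> N0 qN; apply/closed_rootP; apply: contraNneq qN => sq.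
  by rewrite nth_default // sq.
have [c00|c00] := eqVneq c0 0.
  pose q := \sum_(k < d) c k *: 'X^(p ^ k.+1 - 1) - 1.
  have [||t /eqP] := size_gt q (p ^ i.+1 - 1)%N.
  - by rewrite subn_gt0.
  - by rewrite coefB coefE // coef1 subn_eq0 leqNgt pk subr0.
  rewrite !hornerE horner_sum => qt.
  have t0 : t != 0.
    apply: contra_eq_neq qt => ->; rewrite big1 ?add0r ?oppr_eq0 ?oner_neq0 //.
    move=> k _; rewrite hornerZ hornerXn expr0n subn_eq0 leqNgt pk mulr0 //.
  exists t => //; rewrite c00 add0r; apply: (mulIf (invr_neq0 t0)).
  rewrite mulfV // mulr_suml; apply/eqP; rewrite eq_sym -subr_eq0; apply/eqP; rewrite -[RHS]qt.
  congr (_ - _); apply: eq_bigr => k _; rewrite hornerZ hornerXn iter_frob -mulrA; congr (_ * _).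
  by rewrite -{1}(subnK (ltnW (pk k))) exprD expr1 mulfK.
pose q := \sum_(k < d) c k *: 'X^(p ^ k.+1 - 0) - 'X + c0%:P.
have [||t /eqP] := size_gt q (p ^ i.+1 - 0)%N.
- by rewrite subn0 ltnW.
- rewrite coefD coefB coefE // coefX coefC subn0 (gtn_eqF (pk i)) subr0.
  by rewrite (gtn_eqF (ltnW (pk i))) addr0.
rewrite !hornerE horner_sum => qt.
exists t.
  apply: contra_eq_neq qt => ->; rewrite big1 ?sub0r ?oppr0 ?add0r //.
  by move=> k _; rewrite hornerZ hornerXn subn0 expr0n (gtn_eqF (ltnW (pk k))) mulr0.
apply/eqP; rewrite eq_sym -subr_eq0; apply/eqP; rewrite -[RHS]qt (addrC c0) addrAC.
congr (_ - _ + _).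
by apply: eq_bigr => k _; rewrite hornerZ hornerXn iter_frob subn0.
Qed.

End Frobenius.

(** * Zorn, and pairings on infinite types *)

Section ClassicalSets.
Local Open Scope classical_set_scope.

(** Zorn's lemma is applied to the sets S whose union with [A0] is good, so that the empty chain
    yields [A0] itself. *)
Lemma zorn_above (T : Type) (good : set T -> Prop) (A0 : set T) : good A0 ->
    (forall C : set (set T), C !=set0 -> C `<=` good -> (forall A, C A -> A0 `<=` A) ->
      total_on C subset -> good (\bigcup_(A in C) A)) ->
  exists2 A, good A /\ A0 `<=` A & forall A', A `<=` A' -> good A' -> A' `<=` A.
Proof.
move=> good0 chain; pose P S := good (A0 `|` S).
have [|S [PS Smax]] := @Zorn_bigcup T P.
  move=> C CP Ctot; have [->|C0] := eqVneq C set0.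
    by rewrite /P bigcup_set0 setU0.
  have /set0P [S0 CS0] := C0.
  rewrite /P (_ : _ `|` _ = \bigcup_(A in [set A0 `|` S | S in C]) A).
    apply: chain.
    - by exists (A0 `|` S0), S0.
    - by move=> _ [S CS <-]; exact: CP.
    - by move=> _ [S CS <-]; exact: subsetUl.
    - move=> _ _ [S CS <-] [S' CS' <-].
      by case: (Ctot S S' CS CS') => SS; [left|right]; exact: setUS.
  rewrite eqEsubset; split=> [x [A0x|[S CS Sx]]|x [_ [S CS <-] [A0x|Sx]]].
  - by exists (A0 `|` S0); [exists S0 | left].
  - by exists (A0 `|` S); [exists S | right].
  - by left.
  - by right; exists S.
exists (A0 `|` S); first by split=> //; exact: subsetUl.
move=> A' SA' gA'; apply: contrapT => nA'.
apply: (Smax A'); last by rewrite /P (_ : A0 `|` A' = A') //; apply/setUidr => x A0x; apply: SA'; left.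
split=> [x Sx|A'S]; first by apply: SA'; right.
by apply: nA' => x /A'S Sx; right.
Qed.

Lemma chain_pair (T : Type) (C : set (set T)) A B : total_on C subset -> C A -> C B ->
  exists2 D, C D & A `<=` D /\ B `<=` D.
Proof.
move=> tot CA CB; case: (tot A B CA CB) => AB; [exists B | exists A] => //; split=> // x.
Qed.

Lemma chain_seq (T : eqType) (C : set (set T)) (s : seq T) : C !=set0 -> total_on C subset ->
    (forall x, x \in s -> exists2 A, C A & A x) ->
  exists2 A, C A & forall x, x \in s -> A x.
Proof.
move=> [A0 CA0] tot; elim: s => [|x s IH] sC; first by exists A0.
have [|A CA As] := IH; first by move=> y ys; apply: sC; rewrite inE ys orbT.
have [B CB Bx] := sC x (mem_head _ _).
have [D CD [AD BD]] := chain_pair tot CA CB.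
exists D => // y; rewrite inE => /predU1P [->|/As]; [exact: BD | exact: AD].
Qed.

(** Comparability of cardinals: a maximal graph of a partial injection is defined on all of [X] or
    reaches all of [Y]. *)
Lemma injection_total (T : Type) (X Y : set T) :
  (exists h : T -> T, (forall x, X x -> Y (h x)) /\ forall x x', X x -> X x' -> h x = h x' -> x = x') \/
  (exists h : T -> T, (forall y, Y y -> X (h y)) /\ forall y y', Y y -> Y y' -> h y = h y' -> y = y').
Proof.
pose good (G : set (T * T)) := [/\ forall x y, G (x, y) -> X x /\ Y y,
  forall x y y', G (x, y) -> G (x, y') -> y = y' & forall x x' y, G (x, y) -> G (x', y) -> x = x'].
have [||G [[GXY Gf Gi] _] Gmax] := @zorn_above _ good set0; first by split.
  move=> C C0 Cgood _ tot; split.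
  - by move=> x y [G CG Gxy]; have [h _ _] := Cgood G CG; exact: h Gxy.
  - move=> x y y' [G CG Gxy] [G' CG' Gxy'].
    have [D CD [GD GD']] := chain_pair tot CG CG'; have [_ h _] := Cgood D CD.
    exact: h (GD _ Gxy) (GD' _ Gxy').
  - move=> x x' y [G CG Gxy] [G' CG' Gxy'].
    have [D CD [GD GD']] := chain_pair tot CG CG'; have [_ _ h] := Cgood D CD.
    exact: h (GD _ Gxy) (GD' _ Gxy').
have [XG|] := pselect (forall x, X x -> exists y, G (x, y)).
  left; have /choice [h hP] (x : T) : exists y, X x -> G (x, y).
    by case: (pselect (X x)) => [/XG [y Gy]|nX]; [exists y | exists x].
  exists h; split=> [x Xx|x x' Xx Xx' E]; first exact: (GXY _ _ (hP x Xx)).2.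
  by apply: Gi (hP x Xx) _; rewrite E; exact: hP.
move=> /existsNP [x0 /not_implyP [Xx0 nG0]]; right.
have YG y : Y y -> exists x, G (x, y).
  move=> Yy; apply: contrapT => nGy.
  have good' : good (G `|` [set (x0, y)]).
    split=> [a b [/GXY //|[-> ->]] //|a b b' [Gab|[E Eb]] [Gab'|[E' E'']]|a a' b [Gab|[E E2]] [Gab'|[E' E2']]].
    + exact: Gf Gab Gab'.
    + by case: nG0; exists b; rewrite -E'.
    + by case: nG0; exists b'; rewrite -E.
    + by rewrite Eb E''.
    + exact: Gi Gab Gab'.
    + by case: nGy; exists a; rewrite -E2'.
    + by case: nGy; exists a'; rewrite -E2.
    + by rewrite E E'.
  by apply: nG0; exists y; apply: (Gmax _ _ good') => [p Gp|]; [left|right].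
have /choice [h hP] (y : T) : exists x, Y y -> G (x, y).
  by case: (pselect (Y y)) => [/YG [x Gx]|nY]; [exists x | exists y].
exists h; split=> [y Yy|y y' Yy Yy' E]; first exact: (GXY _ _ (hP y Yy)).1.
by apply: Gf (hP y Yy) _; rewrite E; exact: hP.
Qed.

Definition pairing_on (T : Type) (X : set T) (g : T -> T -> T) :=
  (forall x y, X x -> X y -> X (g x y)) /\
  (forall x y x' y', X x -> X y -> X x' -> X y' -> g x y = g x' y' -> x = x' /\ y = y').

(* A disjoint sum of two copies of X injects into X through the pairing. *)
Lemma pairing_absorb (T : Type) (X Y : set T) (g : T -> T -> T) (k : T -> T) x0 x1 :
    pairing_on X g -> X x0 -> X x1 -> x0 <> x1 ->
    (forall y, Y y -> X (k y)) -> (forall y y', Y y -> Y y' -> k y = k y' -> y = y') ->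
  exists c : T -> T, (forall x, X x \/ Y x -> X (c x)) /\
    (forall x x', X x \/ Y x -> X x' \/ Y x' -> c x = c x' -> x = x').
Proof.
move=> [gX gI] X0 X1 x01 kX kI; exists (fun x => if `[< X x >] then g x0 x else g x1 (k x)).
split=> [x XYx|x x' XYx XYx'].
  by case: asboolP => Xx; apply: gX => //; case: XYx => // /kX.
have Yof y : X y \/ Y y -> ~ X y -> Y y by case.
case: asboolP => Xx; case: asboolP => Xx' E.
- by have [] := gI _ _ _ _ X0 Xx X0 Xx' E.
- by have [] := gI _ _ _ _ X0 Xx X1 (kX _ (Yof _ XYx' Xx')) E.
- by have [E' _] := gI _ _ _ _ X1 (kX _ (Yof _ XYx Xx)) X0 Xx' E; case: x01.
- have [Yx Yx'] := (Yof _ XYx Xx, Yof _ XYx' Xx').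
  by have [_ E'] := gI _ _ _ _ X1 (kX _ Yx) X1 (kX _ Yx') E; exact: kI.
Qed.

(** An infinite cardinal equals its square. Take a maximal injective pairing on a set X containing
    the image of [iota]. If the complement embeds in X, then T embeds in X and inherits a pairing;
    otherwise X has a disjoint copy Y, and the pairing extends to their union, against
    maximality. *)
Lemma infinite_pairing (T : Type) (iota : nat -> T) : injective iota ->
  exists g : T -> T -> T, forall x y x' y', g x y = g x' y' -> x = x' /\ y = y'.
Proof.
(* The underlying set is recovered from the graph through the diagonal of its domain, so that graphs
   alone are ordered by inclusion. *)
move=> iotaI; pose fld (G : set (T * T * T)) x := exists z, G (x, x, z).
pose good (G : set (T * T * T)) := [/\
  forall p z z', G (p, z) -> G (p, z') -> z = z', forall p p' z, G (p, z) -> G (p', z) -> p = p',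
  forall x y z, G (x, y, z) -> [/\ fld G x, fld G y & fld G z] &
  forall x y, fld G x -> fld G y -> exists z, G (x, y, z)].
pose pr m n := iota (pickle (m : nat, n : nat)).
have prI m n m' n' : pr m n = pr m' n' -> m = m' /\ n = n'.
  by move=> /iotaI /(pcan_inj (@pickleK _)) [-> ->].
pose G0 : set (T * T * T) := [set p | exists m n, p = (iota m, iota n, pr m n)].
have fld0 x : fld G0 x <-> exists m, x = iota m.
  split=> [[z [m [n [-> _ _]]]]|[m ->]]; first by exists m.
  by exists (pr m m), m, m.
have good0 : good G0.
  split.
  - move=> p z z' [m [n [-> ->]]] [m' [n' [/iotaI -> /iotaI -> ->]]] //.
  - by move=> p p' z [m [n [-> ->]]] [m' [n' [-> /prI [-> ->]]]].
  - move=> x y z [m [n [-> -> ->]]]; split; apply/fld0; [by exists m | by exists n|].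
    by exists (pickle (m, n)).
  - by move=> x y /fld0 [m ->] /fld0 [n ->]; exists (pr m n), m, n.
have fld_mono (G G' : set _) x : G `<=` G' -> fld G x -> fld G' x by move=> GG' [z /GG']; exists z.
have [|G [[Gf Gi Gfld Gtot] G0G] Gmax] := @zorn_above _ good G0 good0.
  move=> C [G1 CG1] Cgood _ tot.
  have fldU x : fld (\bigcup_(A in C) A) x -> exists2 G, C G & fld G x.
    by move=> [z [G CG Gz]]; exists G => //; exists z.
  split.
  - move=> p z z' [G CG Gz] [G' CG' Gz'].
    have [D CD [GD GD']] := chain_pair tot CG CG'; have [h _ _ _] := Cgood D CD.
    exact: h (GD _ Gz) (GD' _ Gz').
  - move=> p p' z [G CG Gz] [G' CG' Gz'].
    have [D CD [GD GD']] := chain_pair tot CG CG'; have [_ h _ _] := Cgood D CD.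
    exact: h (GD _ Gz) (GD' _ Gz').
  - move=> x y z [G CG Gxyz]; have [_ _ h _] := Cgood G CG; have [fx fy fz] := h _ _ _ Gxyz.
    by split; [move: fx|move: fy|move: fz]; apply: fld_mono => p Gp; exists G.
  - move=> x y /fldU [G CG Gx] /fldU [G' CG' Gy].
    have [D CD [GD GD']] := chain_pair tot CG CG'; have [_ _ _ h] := Cgood D CD.
    have [z Dz] := h x y (fld_mono _ _ _ GD Gx) (fld_mono _ _ _ GD' Gy).
    by exists z, D.
pose X := fld G.
have /choice [g' g'P] (p : T * T) : exists z, X p.1 -> X p.2 -> G (p, z).
  case: (pselect (X p.1 /\ X p.2)) => [[X1 X2]|nX]; last first.
    by exists p.1 => X1 X2; case: nX.
  have [z Gz] := Gtot _ _ X1 X2; exists z => _ _; by rewrite (surjective_pairing p).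
pose g x y := g' (x, y).
have gG x y : X x -> X y -> G (x, y, g x y) by move=> Xx Xy; exact: (g'P (x, y)).
have gX : pairing_on X g.
  split=> [x y Xx Xy|x y x' y' Xx Xy Xx' Xy' E].
    by have [] := Gfld _ _ _ (gG x y Xx Xy).
  by have := gG x y Xx Xy; rewrite E => /Gi /(_ (gG x' y' Xx' Xy')) [-> ->].
have Xi m : X (iota m) by apply: fld_mono G0G _; apply/fld0; exists m.
have i01 : iota 0 <> iota 1 by move=> /iotaI.
case: (injection_total (~` X) X) => -[h [hX hI]].
  have [c [cX cI]] := pairing_absorb gX (Xi 0%N) (Xi 1%N) i01 hX hI.
  have all x : X x \/ (~` X) x by case: (pselect (X x)); [left|right].
  exists (fun x y => g (c x) (c y)) => x y x' y' E.
  have [] := gX.2 _ _ _ _ (cX _ (all x)) (cX _ (all y)) (cX _ (all x')) (cX _ (all y')) E.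
  by move=> /(cI _ _ (all _) (all _)) -> /(cI _ _ (all _) (all _)) ->.
pose Y := [set h x | x in X].
have /choice [k kP] (y : T) : exists x, Y y -> X x /\ h x = y.
  by case: (pselect (Y y)) => [[x Xx E]|nY]; [exists x | exists y].
have kX y : Y y -> X (k y) by move=> /kP [].
have kI y y' : Y y -> Y y' -> k y = k y' -> y = y'.
  by move=> /kP [_ {2}<-] /kP [_ {2}<-] ->.
have [c [cX cI]] := pairing_absorb gX (Xi 0%N) (Xi 1%N) i01 kX kI.
pose Z x := X x \/ Y x.
have XY x : X x -> Y x -> False by move=> Xx [y Xy E]; move: Xx; rewrite -E; exact: hX Xy.
(* Pairs not in X x X take values in the copy [Y]: [c] embeds the union in X, [g] pairs there, and
   [h] moves the result to [Y]. *)
pose new (p : T * T * T) := [/\ Z p.1.1, Z p.1.2, ~ (X p.1.1 /\ X p.1.2) & p.2 = h (g (c p.1.1) (c p.1.2))].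
pose G' : set (T * T * T) := fun p => G p \/ new p.
have newY p : new p -> Y p.2.
  by case=> Z1 Z2 _ ->; exists (g (c p.1.1) (c p.1.2)) => //; apply: gX.1; exact: cX.
have fldG' x : fld G' x <-> Z x.
  split=> [[z [Gz|[Zx _ _ _]]]|Zx] //; first by left; exists z.
  case: (pselect (X x)) => [[z Gz]|nX]; first by exists z; left.
  by exists (h (g (c x) (c x))); right; split=> // -[].
have good' : good G'.
  split.
  - move=> p z z' [Gz|nz] [Gz'|nz'].
    + exact: Gf Gz Gz'.
    + case: nz' => _ _ nX _; case: nX; rewrite (surjective_pairing p) in Gz.
      by have [] := Gfld _ _ _ Gz.
    + case: nz => _ _ nX _; case: nX; rewrite (surjective_pairing p) in Gz'.
      by have [] := Gfld _ _ _ Gz'.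
    + by case: nz nz' => _ _ _ /= -> [_ _ _ /= ->].
  - move=> [x y] [x' y'] z [Gz|nz] [Gz'|nz'].
    + exact: Gi Gz Gz'.
    + by have [_ _ /XY] := Gfld _ _ _ Gz; case/(_ (newY _ nz')).
    + by have [_ _ /XY] := Gfld _ _ _ Gz'; case/(_ (newY _ nz)).
    + case: nz nz' => /= Zx Zy _ -> [/= Zx' Zy' _].
      have [cx cy cx' cy'] := And4 (cX _ Zx) (cX _ Zy) (cX _ Zx') (cX _ Zy').
      move=> /(hI _ _ (gX.1 _ _ cx cy) (gX.1 _ _ cx' cy')) /(gX.2 _ _ _ _ cx cy cx' cy').
      by case=> /(cI _ _ Zx Zx') -> /(cI _ _ Zy Zy') ->.
  - move=> x y z [/Gfld [fx fy fz]|nz]; first by split; apply/fldG'; left.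
    have /= Yz := newY _ nz; case: nz => /= Zx Zy _ _.
    by split; apply/fldG' => //; right.
  - move=> x y /fldG' Zx /fldG' Zy; case: (pselect (X x /\ X y)) => [[Xx Xy]|nX].
      by exists (g x y); left; exact: gG.
    by exists (h (g (c x) (c y))); right.
have Yh : Y (h (iota 0)) by exists (iota 0%N).
have : X (h (iota 0)).
  apply: (fld_mono G'); last by apply/fldG'; right.
  by apply: Gmax good' => p Gp; left.
by move=> /XY /(_ Yh).
Qed.

End ClassicalSets.

(** * Transcendence bases *)

Section Basis.
Local Open Scope classical_set_scope.
Variable F : fieldType.
Implicit Types (B : set F) (x y : F).

Definition indep_set B := forall x, B x -> ~ cl (fun y => B y /\ y <> x) x.

Lemma exists_basis : exists2 B, indep_set B & forall x, cl B x.
Proof.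
have [||B [Bind _] Bmax] := @zorn_above _ indep_set set0; first by move=> x.
  move=> C C0 Cind _ tot x [A CA Ax] [s [sU sx]].
  have [y|D CD Ds] := @chain_seq _ C (x :: s) C0 tot.
    by rewrite inE => /predU1P [->|/sU [[E CE Ey] _]]; [exists A | exists E].
  apply: (Cind D CD x); first by apply: Ds; rewrite mem_head.
  by exists s; split=> // y ys; split; [apply: Ds; rewrite inE ys orbT | have [] := sU y ys].
exists B => // x; apply: contrapT => nx.
have nBx : ~ B x by move=> /cl_self.
apply: nBx; apply: (Bmax (fun y => B y \/ y = x)); [by left| |by right].
move=> y [By|->] cy.
  apply: nx; have : cl (fun z => (B z /\ z <> y) \/ z = y) x; last first.
    by apply: cl_subset => z [[]|->].
  apply: cl_exchange (Bind y By).
  by apply: cl_subset cy => z [[Bz|->] zy]; [left|right].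
by apply: nx; apply: cl_subset cy => z [[]].
Qed.

Lemma indep_set_seq B s : indep_set B -> uniq s -> (forall x, x \in s -> B x) ->
  indep_over [::] s.
Proof.
move=> Bind; elim: s => //= x s IH /andP[xs us] sB; split.
  by apply: IH => // y ys; apply: sB; rewrite inE ys orbT.
rewrite cats0 => sx; apply: (Bind x (sB x (mem_head _ _))).
exists s; split=> // y ys; split; first by apply: sB; rewrite inE ys orbT.
by move=> yx; rewrite -yx ys in xs.
Qed.

Lemma basis_infinite B : ~ finite_trdeg F -> indep_set B -> (forall x, cl B x) ->
  exists2 iota : nat -> F, injective iota & forall k, B (iota k).
Proof.
move=> nfin Bind Bcl.
have /choice [nxt nxtP] (s : seq F) : exists x, B x /\ x \notin s.
  apply: contrapT => nx; apply: nfin.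
  have Bs x : B x -> x \in s by move=> Bx; apply/negPn/negP => xs; apply: nx; exists x.
  pose t := undup [seq x <- s | `[< B x >]].
  have tE x : x \in t <-> B x.
    rewrite mem_undup mem_filter; split=> [/andP[/asboolP]//|Bx].
    by rewrite asboolT // Bs.
  have ti : indep_over [::] t.
    by apply: (indep_set_seq Bind); [exact: undup_uniq | move=> x /tE].
  exists (rev t); split; first exact: indep_over_rev.
  move=> x; have [u [uB ux]] := Bcl x; apply: acl_sub ux => y /uB /tE.
  by rewrite mem_rev.
pose lst := fix lst k := if k is k'.+1 then nxt (lst k') :: lst k' else [::].
exists (fun k => nxt (lst k)); last by move=> k; have [] := nxtP (lst k).
have lt_mem m k : (m < k)%N -> nxt (lst m) \in lst k.
  elim: k => // k IH; rewrite ltnS leq_eqVlt => /predU1P [->|/IH] /=; first exact: mem_head.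
  by rewrite inE => ->; rewrite orbT.
move=> m k E; case: (ltngtP m k) => // [/lt_mem|/lt_mem]; rewrite ?E => h.
  by have [_] := nxtP (lst k); rewrite h.
by have [_] := nxtP (lst m); rewrite E h.
Qed.

End Basis.

(** * The basis has the cardinality of the field *)

Section Coding.
Variable F : closedFieldType.
Implicit Types (B : set F) (x y : F) (t : seq F).

(** Field expressions are stored as trees of a countable type; the labels 0 to 3 stand for sum,
    opposite, product and inverse. *)
Fixpoint eval_tree t (u : GenTree.tree nat) : F :=
  match u with
  | GenTree.Leaf i => nth 0 t i
  | GenTree.Node 0 [:: a; b] => eval_tree t a + eval_tree t b
  | GenTree.Node 1 [:: a] => - eval_tree t a
  | GenTree.Node 2 [:: a; b] => eval_tree t a * eval_tree t b
  | GenTree.Node 3 [:: a] => (eval_tree t a)^-1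
  | GenTree.Node _ _ => 1
  end.

Lemma gen_subfield_eval t x : gen_subfield t x -> exists u, eval_tree t u = x.
Proof.
elim=> [{}x xt||{}x y _ [u <-] _ [v <-]|{}x _ [u <-]|{}x y _ [u <-] _ [v <-]|{}x _ [u <-]].
- by exists (GenTree.Leaf (index x t)); rewrite /= nth_index.
- by exists (GenTree.Node 4 [::]).
- by exists (GenTree.Node 0 [:: u; v]).
- by exists (GenTree.Node 1 [:: u]).
- by exists (GenTree.Node 2 [:: u; v]).
- by exists (GenTree.Node 3 [:: u]).
Qed.

(** An algebraic element is coded by expressions for the coefficients of a polynomial and its index
    in a list of the roots. *)
Lemma acl_countable : exists dec : seq F -> nat -> F, forall t x, acl t x -> exists k, dec t k = x.
Proof.
have /choice [rts rtsP] (p : {poly F}) : exists r : seq F, p != 0 -> forall x, root p x -> x \in r.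
  have [r rE] := closed_field_poly_normal p; exists r => p0 x; rewrite rE rootZ ?lead_coef_eq0 //.
  by rewrite root_prod_XsubC.
pose T := (seq (GenTree.tree nat) * nat)%type.
pose dec t (k : nat) := if (unpickle k : option T) is Some (l, i) then
  nth 0 (rts (Poly (map (eval_tree t) l))) i else 0.
exists dec => t x [p [p0 pt px]].
have /choice [u uE] i := gen_subfield_eval (pt i).
have pE : Poly (map (eval_tree t) (map u (iota 0 (size p)))) = p.
  apply/polyP => i; rewrite coef_Poly; case: (ltnP i (size p)) => ip.
    by rewrite (nth_map (GenTree.Leaf 0%N)) ?size_map ?size_iota // (nth_map 0%N) ?size_iota // nth_iota.
  by rewrite !nth_default // !size_map size_iota.
exists (pickle ((map u (iota 0 (size p)), index x (rts p)) : T)).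
by rewrite /dec pickleK pE nth_index // rtsP.
Qed.

(** An element of F is coded by finitely many basis elements and a natural number, and the pairing
    on the infinite set [B] codes finite lists. Lists over F with two numbers therefore embed in
    [B]. *)
Lemma basis_coding B (iota : nat -> F) : injective iota -> (forall k, B (iota k)) ->
    (forall x, cl B x) ->
  exists2 e : seq F -> nat -> nat -> F, (forall l i k, B (e l i k)) &
    forall l i k l' i' k', e l i k = e l' i' k' -> [/\ l = l', i = i' & k = k'].
Proof.
move=> iotaI iotaB Bcl; pose TB := {x : F | B x}.
pose ib k : TB := exist _ (iota k) (iotaB k).
have ibI : injective ib by move=> k k' /(congr1 sval) /iotaI.
have [g gI] := infinite_pairing ibI.
(* The length is stored because the fold alone does not reveal where a list ends. *)
pose encS (s : seq TB) : TB := g (ib (size s)) (foldr g (ib 0%N) s).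
have encSI : injective encS.
  move=> s s' /gI [/ibI]; elim: s s' => [|x s IH] [|x' s'] //= [sz] /gI [-> E].
  by rewrite (IH s').
have [dec decP] := acl_countable.
have /choice [supp suppP] (x : F) : exists s : seq TB, acl (map sval s) x.
  have [s [sB sx]] := Bcl x.
  have [s' s'E] : exists s' : seq TB, map sval s' = s.
    elim: s sB {sx} => [|y s IH] sB; first by exists [::].
    have [|s' E] := IH; first by move=> z zs; apply: sB; rewrite inE zs orbT.
    by exists (exist _ y (sB y (mem_head _ _)) :: s'); rewrite /= E.
  by exists s'; rewrite s'E.
have /choice [idx idxP] (x : F) := decP _ _ (suppP x).
pose encF (x : F) : TB := g (encS (supp x)) (ib (idx x)).
have encFI : injective encF.
  by move=> x x' /gI [/encSI E /ibI E']; rewrite -(idxP x) -(idxP x') E E'.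
exists (fun l i k => sval (g (encS (map encF l)) (g (ib i) (ib k)))).
  by move=> l i k; exact: svalP.
have svalI (u v : TB) : sval u = sval v -> u = v.
  by case: u v => a pa [b pb] /=; exact: eq_exist.
by move=> l i k l' i' k' /svalI /gI [/encSI /(inj_map encFI) -> /gI [/ibI -> /ibI ->]].
Qed.

End Coding.

(** * Partial isomorphisms *)

Section PartialIso.
Local Open Scope classical_set_scope.
Variable F : closedFieldType.
Implicit Types (R S : set (F * F)) (x y u v : F) (P Q A C E : {poly F}).

(* A partial isomorphism is encoded by its graph, a subfield-like subset of F * F. *)
Definition partial_iso R := [/\ R (1, 1), forall x x' y y', R (x, y) -> R (x', y') -> R (x + x', y + y'),
  forall x y, R (x, y) -> R (- x, - y), forall x x' y y', R (x, y) -> R (x', y') -> R (x * x', y * y') &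
  [/\ forall x y, R (x, y) -> R (x^-1, y^-1), forall y, R (0, y) -> y = 0 & forall x, R (x, 0) -> x = 0]].

Definition pdom R x := exists y, R (x, y).
Definition pran R y := exists x, R (x, y).
Definition pflip R : set (F * F) := fun p => R (p.2, p.1).

Lemma partial_iso_flip R : partial_iso R -> partial_iso (pflip R).
Proof.
case=> R1 RD RN RM [RV R0y Rx0]; rewrite /pflip; split=> //=.
- by move=> x x' y y'; exact: RD.
- by move=> x y; exact: RN.
- by move=> x x' y y'; exact: RM.
- by split=> // x y; exact: RV.
Qed.

Section Related.
Variables (R : set (F * F)) (iR : partial_iso R).

Lemma related00 : R (0, 0).
Proof. by case: iR => R1 RD RN _ _; have := RD _ _ _ _ R1 (RN _ _ R1); rewrite subrr. Qed.

Lemma related_fun x y y' : R (x, y) -> R (x, y') -> y = y'.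
Proof.
case: iR => _ RD RN _ [_ R0y _] Ry Ry'; apply/eqP; rewrite -subr_eq0; apply/eqP/R0y.
by have := RD _ _ _ _ Ry (RN _ _ Ry'); rewrite subrr.
Qed.

Lemma related_eq0 x y : R (x, y) -> (x == 0) = (y == 0).
Proof.
case: iR => _ _ _ _ [_ R0y Rx0] Rxy.
by apply/eqP/eqP => E; [apply: R0y; rewrite -E | apply: Rx0; rewrite -E].
Qed.

Lemma pdom_subfield : subfield (pdom R).
Proof.
case: iR => R1 RD RN RM [RV _ _]; split; first by exists 1.
- by move=> x x' [y Ry] [y' Ry']; exists (y + y'); exact: RD.
- by move=> x [y Ry]; exists (- y); exact: RN.
- by move=> x x' [y Ry] [y' Ry']; exists (y * y'); exact: RM.
- by move=> x [y Ry]; exists y^-1; exact: RV.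
Qed.

Definition related P Q := forall i, R (P`_i, Q`_i).

Lemma related_size P Q : related P Q -> size P = size Q.
Proof.
move=> PQ; apply/eqP; rewrite eqn_leq; apply/andP; split; apply/leq_sizeP => j.
  by move=> /(nth_default 0) Qj; apply/eqP; rewrite (related_eq0 (PQ j)) Qj.
by move=> /(nth_default 0) Pj; apply/eqP; rewrite -(related_eq0 (PQ j)) Pj.
Qed.

Lemma relatedD P Q P' Q' : related P Q -> related P' Q' -> related (P + P') (Q + Q').
Proof. by case: iR => _ RD _ _ _ PQ PQ' i; rewrite !coefD; exact: RD. Qed.

Lemma relatedN P Q : related P Q -> related (- P) (- Q).
Proof. by case: iR => _ _ RN _ _ PQ i; rewrite !coefN; exact: RN. Qed.

Lemma related_sum (I : Type) (r : seq I) (f g : I -> F) :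
  (forall i, R (f i, g i)) -> R (\sum_(i <- r) f i, \sum_(i <- r) g i).
Proof.
case: iR => _ RD _ _ _ fg; elim: r => [|i r IH]; first by rewrite !big_nil; exact: related00.
by rewrite !big_cons; exact: RD.
Qed.

Lemma relatedM P Q P' Q' : related P Q -> related P' Q' -> related (P * P') (Q * Q').
Proof.
case: iR => _ _ _ RM _ PQ PQ' i; rewrite !coefM; apply: related_sum => j; exact: RM.
Qed.

Lemma relatedC x y : R (x, y) -> related x%:P y%:P.
Proof. by move=> Rxy i; rewrite !coefC; case: eqP => // _; exact: related00. Qed.

Lemma relatedXn k : related 'X^k 'X^k.
Proof.
case: iR => R1 _ _ _ _ i; rewrite !coefXn; case: eqP => // _; exact: related00.
Qed.

Lemma related_lift P : (forall i, pdom R P`_i) -> exists Q, related P Q.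
Proof.
move=> /choice [f fP]; exists (\poly_(i < size P) f i) => i; rewrite coef_poly.
by case: ltnP => // /(nth_default 0) ->; exact: related00.
Qed.

(** Euclidean division carried out on both sides at once, so that quotients and remainders stay
    related. *)
Lemma related_div P P' A A' : P != 0 -> related P P' -> related A A' ->
  exists C C' E E', [/\ related C C', related E E', A = C * P + E, A' = C' * P' + E' &
    (size E < size P)%N].
Proof.
move=> P0 PP'; have [n] := ubnP (size A); elim: n A A' => // n IH A A' szA AA'.
case: (ltnP (size A) (size P)) => [ltAP|lePA].
  exists 0, 0, A, A'; rewrite !mul0r !add0r; split=> // i; rewrite coef0; exact: related00.
have [R1 RD RN RM [RV _ _]] := iR.
have P'0 : P' != 0 by rewrite -size_poly_eq0 -(related_size PP') size_poly_eq0.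
pose k := (size A - size P)%N.
pose a := lead_coef A / lead_coef P; pose a' := lead_coef A' / lead_coef P'.
have aa' : R (a, a').
  by rewrite /a /a' !lead_coefE -(related_size PP') -(related_size AA'); apply: RM; [|apply: RV].
pose M := a%:P * 'X^k; pose M' := a'%:P * 'X^k.
have MM' : related M M' by apply: relatedM; [exact: relatedC | exact: relatedXn].
have A1 : related (A - M * P) (A' - M' * P').
  by apply: relatedD => //; apply: relatedN; exact: relatedM.
have szA1 : (size (A - M * P)%R < n)%N.
  have szP : (0 < size P)%N by rewrite size_poly_gt0.
  suff: (size (A - M * P)%R <= (size A).-1)%N by move: szA lePA szP; lia.
  apply/leq_sizeP => j lej; rewrite coefB -mulrA coefCM coefXnM ltnNge.
  have -> /= : (k <= j)%N by rewrite /k; move: lePA szP lej; lia.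
  have [jE|jA] := eqVneq j (size A).-1.
    have -> : (j - k = (size P).-1)%N by rewrite jE /k; move: lePA szP; lia.
    by rewrite jE -!lead_coefE divfK ?lead_coef_eq0 // subrr.
  have szAj : (size A <= j)%N by move: lePA szP lej jA; lia.
  have szPj : (size P <= j - k)%N by rewrite /k; move: lePA szP szAj; lia.
  by rewrite !nth_default // mulr0 subr0.
have [C [C' [E [E' [CC' EE' AE AE' ltE]]]]] := IH _ _ szA1 A1.
exists (C + M), (C' + M'), E, E'; split=> //; first exact: relatedD.
  by rewrite mulrDl addrAC -AE subrK.
by rewrite mulrDl addrAC -AE' subrK.
Qed.

(** The graph of the extension sending x to y, on quotients of polynomial values. That related
    polynomials vanish simultaneously at x and y, assumed below, makes it well defined and
    injective. *)
Definition simple_ext x y : set (F * F) := fun p => exists P P' Q Q',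
  [/\ related P P', related Q Q', Q.[x] != 0, Q'.[y] != 0 & p = (P.[x] / Q.[x], P'.[y] / Q'.[y])].

Section SimpleExtension.
Variables (x y : F).
Hypothesis xy : forall P P', related P P' -> (P.[x] == 0) = (P'.[y] == 0).

Lemma simple_ext_poly P P' : related P P' -> simple_ext x y (P.[x], P'.[y]).
Proof.
move=> PP'; case: (iR) => R1 _ _ _ _; exists P, P', 1, 1.
by rewrite !hornerC !divr1 oner_neq0; split=> //; exact: relatedC.
Qed.

Lemma simple_ext_sub : R `<=` simple_ext x y.
Proof.
by move=> [u v] Ruv; rewrite -(hornerC u x) -(hornerC v y); apply/simple_ext_poly/relatedC.
Qed.

Lemma simple_ext_gen : simple_ext x y (x, y).
Proof.
rewrite -{2}(hornerX x) -{2}(hornerX y); apply: simple_ext_poly.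
exact: (relatedXn 1).
Qed.

Lemma simple_ext_partial_iso : partial_iso (simple_ext x y).
Proof.
split.
- exact/simple_ext_sub/(let: And5 h _ _ _ _ := iR in h).
- move=> _ _ _ _ [P [P' [Q [Q' [PP QQ Q0 Q'0 [-> ->]]]]]] [A [A' [C [C' [AA CC C0 C'0 [-> ->]]]]]].
  exists (P * C + A * Q), (P' * C' + A' * Q'), (Q * C), (Q' * C').
  rewrite !hornerE !mulf_neq0 // !addf_div //; split=> //; last exact: relatedM.
  by apply: relatedD; exact: relatedM.
- move=> _ _ [P [P' [Q [Q' [PP QQ Q0 Q'0 [-> ->]]]]]]; exists (- P), (- P'), Q, Q'.
  by rewrite !hornerE !mulNr; split=> //; exact: relatedN.
- move=> _ _ _ _ [P [P' [Q [Q' [PP QQ Q0 Q'0 [-> ->]]]]]] [A [A' [C [C' [AA CC C0 C'0 [-> ->]]]]]].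
  exists (P * A), (P' * A'), (Q * C), (Q' * C').
  by rewrite !hornerM !mulf_neq0 // !mulf_div; split=> //; exact: relatedM.
- split.
  + move=> _ _ [P [P' [Q [Q' [PP QQ Q0 Q'0 [-> ->]]]]]]; case: (eqVneq P.[x] 0) => [Px|Px].
      have /eqP P'y : P'.[y] == 0 by rewrite -(xy PP) Px.
      by rewrite Px P'y !mul0r invr0; exact/simple_ext_sub/related00.
    exists Q, Q', P, P'; rewrite -(xy PP) Px !invf_div; split=> //.
  + move=> _ [P [P' [Q [Q' [PP QQ Q0 Q'0 [/esym/eqP + ->]]]]]].
    by rewrite mulf_eq0 invr_eq0 (negPf Q0) orbF (xy PP) => /eqP ->; rewrite mul0r.
  + move=> _ [P [P' [Q [Q' [PP QQ Q0 Q'0 [-> /esym/eqP]]]]]].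
    by rewrite mulf_eq0 invr_eq0 (negPf Q'0) orbF -(xy PP) => /eqP ->; rewrite mul0r.
Qed.

Lemma simple_ext_dom (K : F -> Prop) : subfield K -> (forall u, pdom R u -> K u) -> K x ->
  forall u, pdom (simple_ext x y) u -> K u.
Proof.
move=> [K1 KD KN KM KV] RK Kx u [v [P [P' [Q [Q' [PP QQ Q0 Q'0 [-> _]]]]]]].
have Khorner A A' : related A A' -> K A.[x].
  have Ksub : subring K by split.
  move=> AA; rewrite horner_coef; apply: subring_sum => // i _.
  by apply: KM; [apply: RK; exists A'`_i | exact: subring_exp].
by apply: KM; [|apply: KV]; apply: Khorner; eassumption.
Qed.

Lemma simple_ext_ran (K : F -> Prop) : subfield K -> (forall u, pran R u -> K u) -> K y ->
  forall u, pran (simple_ext x y) u -> K u.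
Proof.
move=> [K1 KD KN KM KV] RK Ky u [v [P [P' [Q [Q' [PP QQ Q0 Q'0 [_ ->]]]]]]].
have Khorner A A' : related A A' -> K A'.[y].
  have Ksub : subring K by split.
  move=> AA; rewrite horner_coef; apply: subring_sum => // i _.
  by apply: KM; [apply: RK; exists A`_i | exact: subring_exp].
by apply: KM; [|apply: KV]; apply: Khorner; eassumption.
Qed.

End SimpleExtension.

Lemma transcendental_related x y : ~ algebraic_over (pdom R) x -> ~ algebraic_over (pran R) y ->
  forall P P', related P P' -> (P.[x] == 0) = (P'.[y] == 0).
Proof.
move=> nx ny P P' PP; apply/eqP/eqP => E.
  have /eqP P0 : P == 0.
    apply: contra_notT nx => P0; exists P; split=> //; last exact/eqP.
    by move=> i; exists P'`_i.
  have -> : P' = 0 by apply/eqP; rewrite -size_poly_eq0 -(related_size PP) P0 size_poly0.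
  by rewrite horner0.
have /eqP P0 : P' == 0.
  apply: contra_notT ny => P0; exists P'; split=> //; last exact/eqP.
  by move=> i; exists P`_i.
have -> : P = 0 by apply/eqP; rewrite -size_poly_eq0 (related_size PP) P0 size_poly0.
by rewrite horner0.
Qed.

(* y is taken to be a root of the image of the minimal polynomial of x. *)
Lemma algebraic_related x : algebraic_over (pdom R) x -> exists2 y, algebraic_over (pran R) y &
  forall P P', related P P' -> (P.[x] == 0) = (P'.[y] == 0).
Proof.
move=> xalg; pose ann k := exists P P', [/\ P != 0, related P P', root P x & size P = k].
have ex_ann : exists k, `[< ann k >].
  have [P [P0 PR Px]] := xalg; have [P' PP] := related_lift PR.
  by exists (size P); apply/asboolP; exists P, P'.
case: (ex_minnP ex_ann) => k /asboolP [P [P' [P0 PP Px szP]]] kmin.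
have Pmin A A' : related A A' -> root A x -> (size A < size P)%N -> A = 0.
  move=> AA Ax ltA; apply/eqP/negPn/negP => A0.
  have : (k <= size A)%N by apply: kmin; apply/asboolP; exists A, A'.
  by rewrite leqNgt -szP ltA.
have P'0 : P' != 0 by rewrite -size_poly_eq0 -(related_size PP) size_poly_eq0.
have szP1 : (1 < size P)%N.
  rewrite ltn_neqAle size_poly_gt0 P0 andbT eq_sym; apply/negP => /size_poly1P [c c0 E].
  by move: Px; rewrite E rootC (negPf c0).
have [y P'y] : exists y, root P' y by apply/closed_rootP; rewrite -(related_size PP) gtn_eqF.
exists y; first by exists P'; split=> // i; exists P`_i.
have fwd A A' : related A A' -> A.[x] == 0 -> A'.[y] == 0.
  move=> AA /eqP Ax; have [C [C' [E [E' [CC EE AE A'E ltE]]]]] := related_div P0 PP AA.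
  have Ex : root E x by move: Ax; rewrite AE hornerD hornerM (rootP Px) mulr0 add0r => /eqP.
  have E0 := Pmin E E' EE Ex ltE.
  have -> : A' = C' * P' + 0.
    by rewrite A'E; congr (_ + _); apply/eqP; rewrite -size_poly_eq0 -(related_size EE) E0 size_poly0.
  by rewrite addr0 hornerM (rootP P'y) mulr0.
move=> A A' AA; apply/idP/idP; first exact: fwd AA.
(* For the converse, take Q of least degree with Q' vanishing at y. It divides P, and the cofactor
   cannot vanish at x, as minimality of P would then make Q constant. So Q vanishes at x, and so
   does A, a multiple of Q. *)
move=> A'y; pose ann' k := exists Q Q', [/\ Q != 0, related Q Q', root Q' y & size Q = k].
have ex_ann' : exists k, `[< ann' k >] by exists (size P); apply/asboolP; exists P, P'.
case: (ex_minnP ex_ann') => k' /asboolP [Q [Q' [Q0 QQ Q'y szQ]]] k'min.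
have Qmin E E' : related E E' -> root E' y -> (size E < size Q)%N -> E = 0.
  move=> EE Ey ltE; apply/eqP/negPn/negP => E0.
  have : (k' <= size E)%N by apply: k'min; apply/asboolP; exists E, E'.
  by rewrite leqNgt -szQ ltE.
have Qdvd E E' : related E E' -> root E' y -> exists2 C, (exists C', related C C') & E = C * Q.
  move=> EE Ey; have [C [C' [D [D' [CC DD EE1 EE2 ltD]]]]] := related_div Q0 QQ EE.
  exists C; first by exists C'.
  rewrite EE1 (Qmin D D' DD _ ltD) ?addr0 //.
  by move: Ey; rewrite EE2 /root hornerD hornerM (rootP Q'y) mulr0 add0r.
have [C [C' CC] PE] := Qdvd P P' PP P'y.
have C0 : C != 0 by apply: contraNneq P0 => C0; rewrite PE C0 mul0r.
have Qx : root Q x.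
  move: Px; rewrite PE rootM => /orP[Cx|//].
  have szC : (size P <= size C)%N.
    rewrite leqNgt; apply/negP => ltC; by rewrite (Pmin C C' CC Cx ltC) eqxx in C0.
  have szQ1 : size Q = 1%N.
    apply/eqP; rewrite eqn_leq size_poly_gt0 Q0 andbT.
    have sC : (0 < size C)%N by rewrite size_poly_gt0.
    move: szC sC; rewrite PE size_mul //; move: (size C) (size Q) => c q; lia.
  have /size_poly1P [c c0 E] : size Q' == 1%N by rewrite -(related_size QQ) szQ1.
  by move: Q'y; rewrite E rootC (negPf c0).
have [D _ ->] := Qdvd A A' AA A'y.
by rewrite hornerM (rootP Qx) mulr0.
Qed.

End Related.
End PartialIso.

(** * Extending partial isomorphisms *)

Section Extension.
Local Open Scope classical_set_scope.
Variable F : closedFieldType.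
Implicit Types (R S : set (F * F)) (x y u v : F) (K X Y : set F).

Definition alg_closed_in K := subfield K /\ forall u, algebraic_over K u -> K u.

Lemma cl_alg_closed_in X : alg_closed_in (cl X).
Proof. by split; [exact: cl_subfield | move=> u; exact: cl_algebraic]. Qed.

Lemma alg_closed_in_cl K x : alg_closed_in K -> cl K x -> K x.
Proof.
move=> [Ksub Kalg] [s [sK [p [p0 sp px]]]]; apply: Kalg; exists p; split=> // i.
exact: gen_subfield_min Ksub sK (sp i).
Qed.

Lemma algebraic_over_sub X Y x : X `<=` Y -> algebraic_over X x -> algebraic_over Y x.
Proof. by move=> XY [p [p0 Xp px]]; exists p; split=> // i; exact: XY. Qed.

Lemma bigcup_partial_iso (C : set (set (F * F))) : C !=set0 -> total_on C subset ->
  (forall R, C R -> partial_iso R) -> partial_iso (\bigcup_(R in C) R).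
Proof.
move=> [R0 CR0] tot iC; split.
- by exists R0 => //; case: (iC R0 CR0).
- move=> x x' y y' [R CR Ry] [S CS Sy]; have [D CD [RD SD]] := chain_pair tot CR CS.
  by exists D => //; case: (iC D CD) => _ h _ _ _; apply: h; [exact: RD | exact: SD].
- by move=> x y [R CR Ry]; exists R => //; case: (iC R CR) => _ _ h _ _; exact: h.
- move=> x x' y y' [R CR Ry] [S CS Sy]; have [D CD [RD SD]] := chain_pair tot CR CS.
  by exists D => //; case: (iC D CD) => _ _ _ h _; apply: h; [exact: RD | exact: SD].
- split.
  + by move=> x y [R CR Ry]; exists R => //; case: (iC R CR) => _ _ _ _ [h _ _]; exact: h.
  + by move=> y [R CR Ry]; case: (iC R CR) => _ _ _ _ [_ h _]; exact: h.
  + by move=> y [R CR Ry]; case: (iC R CR) => _ _ _ _ [_ _ h]; exact: h.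
Qed.

Lemma algebraic_step S x : partial_iso S -> algebraic_over (pdom S) x ->
  exists S', [/\ partial_iso S', S `<=` S', pdom S' x,
    forall K, alg_closed_in K -> pdom S `<=` K -> pdom S' `<=` K &
    forall K, alg_closed_in K -> pran S `<=` K -> pran S' `<=` K].
Proof.
move=> iS xalg; have [y yalg xy] := algebraic_related iS xalg.
exists (simple_ext S x y); split.
- exact: simple_ext_partial_iso.
- exact: simple_ext_sub.
- by exists y; exact: simple_ext_gen.
- move=> K [Ksub Kalg] SK; apply: simple_ext_dom => //; apply: Kalg.
  exact: algebraic_over_sub xalg.
- move=> K [Ksub Kalg] SK; apply: simple_ext_ran => //; apply: Kalg.
  exact: algebraic_over_sub yalg.
Qed.

(** A maximal extension inside the two closures has full domain, since a missing algebraic element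
    could be adjoined; the same argument on the flipped graph gives the full range. *)
Lemma algebraic_extension R : partial_iso R -> exists R', [/\ partial_iso R', R `<=` R',
  pdom R' = cl (pdom R) & pran R' = cl (pran R)].
Proof.
move=> iR; pose good S := [/\ partial_iso S, pdom S `<=` cl (pdom R) & pran S `<=` cl (pran R)].
have [||S [[iS Sd Sr] RS] Smax] := @zorn_above _ good R.
- by split=> // x; exact: cl_self.
- move=> C C0 Cgood _ tot; split.
  + by apply: bigcup_partial_iso => // S /Cgood [].
  + by move=> x [y [S CS Sxy]]; have [_ h _] := Cgood S CS; apply: h; exists y.
  + by move=> y [x [S CS Sxy]]; have [_ _ h] := Cgood S CS; apply: h; exists x.
have alg X Y x : subfield Y -> X `<=` Y -> cl X x -> algebraic_over Y x.
  move=> Ysub XY [s [sX [p [p0 sp px]]]]; exists p; split=> // i.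
  by apply: gen_subfield_min Ysub _ (sp i) => y /sX /XY.
exists S; split=> //; rewrite eqEsubset; split=> // x clx.
  have [|S' [iS' SS' [y S'xy] S'd S'r]] := @algebraic_step S x iS.
    apply: alg clx; first exact: pdom_subfield.
    by move=> z [t Rzt]; exists t; exact: RS.
  exists y; apply: Smax S'xy => //; split=> //.
    by apply: S'd => //; exact: cl_alg_closed_in.
  by apply: S'r => //; exact: cl_alg_closed_in.
have iSf := partial_iso_flip iS.
have [|S' [iS' SS' [y S'xy] S'd S'r]] := @algebraic_step (pflip S) x iSf.
  apply: alg clx; first exact: pdom_subfield.
  by move=> z [t Rzt]; exists t; exact: RS.
exists y; apply: (Smax (pflip S')) => //; first by move=> [a b] Sab; exact: (SS' (b, a)).
split; first exact: partial_iso_flip.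
  by apply: S'r => //; exact: cl_alg_closed_in.
by apply: S'd => //; exact: cl_alg_closed_in.
Qed.

(** Sending x to y extends to the rational functions; an algebraic extension then makes domain and
    range closed again. *)
Lemma transcendental_extension R x y : partial_iso R -> ~ cl (pdom R) x -> ~ cl (pran R) y ->
  exists R', [/\ partial_iso R', R `<=` R', R' (x, y),
    pdom R' = cl (pdom R `|` [set x]) & pran R' = cl (pran R `|` [set y])].
Proof.
move=> iR nx ny.
have xy : forall P P', related R P P' -> (P.[x] == 0) = (P'.[y] == 0).
  apply: transcendental_related => // [xalg|yalg]; [apply: nx | apply: ny];
    apply: cl_algebraic; [move: xalg | move: yalg];
    by apply: algebraic_over_sub => z; exact: cl_self.
have i1 := simple_ext_partial_iso iR xy.
have [R' [iR' SR' R'd R'r]] := algebraic_extension i1.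
have Sxy := simple_ext_gen iR x y.
have Rsub : R `<=` simple_ext R x y by exact: simple_ext_sub.
exists R'; split=> //.
- by move=> p /Rsub /SR'.
- exact: SR'.
- rewrite R'd eqEsubset; split=> u; apply: cl_trans => {}u.
    have [Ksub _] := cl_alg_closed_in (pdom R `|` [set x]).
    apply: simple_ext_dom => // [v Rv|]; apply: cl_self; [by left | by right].
  by case=> [[v Ruv]|->]; apply: cl_self; [exists v; exact: Rsub | exists y].
- rewrite R'r eqEsubset; split=> u; apply: cl_trans => {}u.
    have [Ksub _] := cl_alg_closed_in (pran R `|` [set y]).
    apply: simple_ext_ran => // [v Rv|]; apply: cl_self; [by left | by right].
  by case=> [[v Rvu]|->]; apply: cl_self; [exists v; exact: Rsub | exists x].
Qed.

(* The last image x_d is transcendental over the range built so far because it can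
   replace x_0 in a generating set. *)
Lemma block_extension R K d (x : nat -> F) : partial_iso R -> pdom R = K -> pran R = K ->
    alg_closed_in K ->
    (forall i, (i < d)%N -> ~ cl (K `|` [set x j | j in [set j | (j < d)%N /\ j <> i]]) (x i)) ->
    (0 < d)%N ->
    cl (K `|` [set x j | j in [set j | (j < d)%N]]) (x d) ->
    cl (K `|` [set x j.+1 | j in [set j | (j < d)%N]]) (x 0%N) ->
  exists R', [/\ partial_iso R', R `<=` R', forall i, (i < d)%N -> R' (x i, x i.+1),
    pdom R' = cl (K `|` [set x j | j in [set j | (j < d)%N]]) &
    pran R' = cl (K `|` [set x j | j in [set j | (j < d)%N]])].
Proof.
move=> iR Rd Rr Kcl xind d0 xd x0.
(* [Xk k] and [Yk k] are the domain and the range after k steps; as x_i is sent to x_(i+1), the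
   range is shifted by one index. *)
pose Xk k := cl (K `|` [set x j | j in [set j | (j < k)%N]]).
pose Yk k := cl (K `|` [set x j.+1 | j in [set j | (j < k)%N]]).
have xk k : (k < d)%N -> ~ Xk k (x k).
  move=> ltkd h; apply: (xind k ltkd); apply: cl_subset h => z [Kz|[j /= ltjk <-]]; first by left.
  right; exists j => //=; split; first exact: ltn_trans ltjk ltkd.
  by move=> jk; rewrite jk ltnn in ltjk.
have yk k : (k < d)%N -> ~ Yk k (x k.+1).
  rewrite leq_eqVlt => /predU1P [kd|ltkd] h.
    apply: (xind 0%N d0); apply: cl_trans x0 => z [Kz|[j /= ltjd <-]]; first by apply: cl_self; left.
    have h' : cl (K `|` [set x j | j in [set j | (j < d)%N /\ j <> 0%N]]) (x d).
      rewrite -kd; apply: cl_subset h => w [Kw|[i /= ltik <-]]; first by left.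
      by right; exists i.+1 => //=; split=> //; rewrite -kd ltnS.
    move: ltjd; rewrite leq_eqVlt => /predU1P [->//|ltjd].
    by apply: cl_self; right; exists j.+1.
  apply: (xind k.+1 ltkd); apply: cl_subset h => z [Kz|[j /= ltjk <-]]; first by left.
  right; exists j.+1 => //=; split; first by apply: ltn_trans ltkd; rewrite ltnS.
  by case=> jk; rewrite jk ltnn in ltjk.
have stepX k : cl (Xk k `|` [set x k]) = Xk k.+1.
  rewrite eqEsubset; split=> z; apply: cl_trans => {}z.
    case=> [|->]; last by apply: cl_self; right; exists k => /=.
    by apply: cl_subset => w [Kw|[j /= ltj <-]]; [left | right; exists j => //=; exact: ltnW].
  case=> [Kz|[j /= ltj <-]]; first by apply/cl_self; left; apply/cl_self; left.
  apply/cl_self; move: ltj; rewrite ltnS leq_eqVlt => /predU1P [->|ltj]; [by right | left].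
  by apply: cl_self; right; exists j.
have stepY k : cl (Yk k `|` [set x k.+1]) = Yk k.+1.
  rewrite eqEsubset; split=> z; apply: cl_trans => {}z.
    case=> [|->]; last by apply: cl_self; right; exists k => /=.
    by apply: cl_subset => w [Kw|[j /= ltj <-]]; [left | right; exists j => //=; exact: ltnW].
  case=> [Kz|[j /= ltj <-]]; first by apply/cl_self; left; apply/cl_self; left.
  apply/cl_self; move: ltj; rewrite ltnS leq_eqVlt => /predU1P [->|ltj]; [by right | left].
  by apply: cl_self; right; exists j.
have [R' [iR' RR' R'x R'd R'r]] : exists R', [/\ partial_iso R', R `<=` R',
    forall i, (i < d)%N -> R' (x i, x i.+1), pdom R' = Xk d & pran R' = Yk d].
  have : (d <= d)%N by []. 
  elim: {1 3 4 5}d => [_|k IH ltkd].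
    exists R; split=> //; rewrite ?Rd ?Rr eqEsubset; split=> z.
    - by move=> Kz; apply: cl_self; left.
    - by move=> h; apply: (alg_closed_in_cl Kcl); apply: cl_subset h => w [//|[]].
    - by move=> Kz; apply: cl_self; left.
    - by move=> h; apply: (alg_closed_in_cl Kcl); apply: cl_subset h => w [//|[]].
  have [S [iS RS Sx Sd Sr]] := IH (ltnW ltkd).
  have [||S' [iS' SS' S'x S'd S'r]] := @transcendental_extension S (x k) (x k.+1) iS.
  - by rewrite Sd => /(alg_closed_in_cl (cl_alg_closed_in _)); exact: xk.
  - by rewrite Sr => /(alg_closed_in_cl (cl_alg_closed_in _)); exact: yk.
  exists S'; rewrite S'd S'r Sd Sr stepX stepY; split=> //; first by move=> p /RS /SS'.
  by move=> i; rewrite ltnS leq_eqVlt => /predU1P [->//|ltik]; apply: SS'; exact: Sx.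
exists R'; split=> //; rewrite R'r eqEsubset; split=> z; apply: cl_trans => {}z.
  case=> [Kz|[j /= ltj <-]]; first by apply: cl_self; left.
  move: ltj; rewrite leq_eqVlt => /predU1P [->//|ltj].
  by apply: cl_self; right; exists j.+1.
case=> [Kz|[j /= ltj <-]]; first by apply: cl_self; left.
by case: j ltj => // j ltj; apply: cl_self; right; exists j => //=; exact: ltnW.
Qed.

End Extension.

(** * A generic automorphism *)

Section GenericAutomorphism.
Local Open Scope classical_set_scope.
Variables (F : closedFieldType) (B : set F).
Hypotheses (Bind : indep_set B) (Bcl : forall x, cl B x).
Variable e : seq F -> nat -> nat -> F.
Hypotheses (eB : forall l i k, B (e l i k))
  (eI : forall l i k l' i' k', e l i k = e l' i' k' -> [/\ l = l', i = i' & k = k']).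
Variables (rk : F -> nat) (supp : F -> seq F).
Hypotheses (rkE : forall l i k, rk (e l i k) = k)
  (suppB : forall x y, y \in supp x -> B y) (suppP : forall x, acl (supp x) x).
Implicit Types (R S : set (F * F)) (l : seq F) (x y : F).

(* The list c0 :: c encodes the equation t = c0 + \sum_i c_i sigma^(i+1)(t), to be
   solved by a block of basis elements whose rank exceeds that of its coefficients. *)
Definition level l := (\max_(c <- l) \max_(b <- supp c) rk b).+1.
Definition block_elt l i := e l i (level l).
Definition block_size l := (size l).-1.
Definition valid_code l := (0 < block_size l)%N && (last 0 l != 0).
(** The successive images of the first block element t: the block itself, and at index
    [block_size l] the value obtained by solving the equation for its last term. *)
Definition orbit l i := if (i < block_size l)%N then block_elt l i else
  (block_elt l 0 - l`_0 - \sum_(j < (block_size l).-1) l`_j.+1 * block_elt l j.+1) / last 0 l.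

Lemma orbit_lt l i : (i < block_size l)%N -> orbit l i = block_elt l i.
Proof. by rewrite /orbit => ->. Qed.

Lemma rk_supp_lt l c b : c \in l -> b \in supp c -> (rk b < level l)%N.
Proof.
move=> cl bc; rewrite ltnS; apply: leq_trans (_ : \max_(b <- supp c) rk b <= _)%N.
  exact: leq_bigmax_seq.
exact: (@leq_bigmax_seq _ l xpredT (fun c => \max_(b <- supp c) rk b)).
Qed.

Lemma orbit_endE l : valid_code l ->
  block_elt l 0 = last 0 l * orbit l (block_size l) + l`_0 +
    \sum_(j < (block_size l).-1) l`_j.+1 * block_elt l j.+1.
Proof.
by move=> /andP[_ l0]; rewrite /orbit ltnn mulrC divfK //; ring.
Qed.

(** A block enters the domain as a whole, together with the coefficients of its equation. Domain and
    range agree, which yields surjectivity, and generation by basis elements keeps track of which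
    blocks a new element can touch. *)
Definition good R := [/\ partial_iso R, pran R = pdom R, cl (pdom R) `<=` pdom R,
  pdom R `<=` cl (B `&` pdom R) &
  forall l i, valid_code l -> (i < block_size l)%N -> pdom R (block_elt l i) ->
    (forall c, c \in l -> pdom R c) /\
    forall j, (j < block_size l)%N -> R (orbit l j, orbit l j.+1)].

Lemma good_alg_closed R : good R -> alg_closed_in (pdom R).
Proof.
case=> iR _ Rcl _ _; split=> [|u uR]; first exact: pdom_subfield.
by apply/Rcl/cl_algebraic; apply: algebraic_over_sub uR => z; exact: cl_self.
Qed.

Lemma basis_mem_cl K b : K `<=` B -> B b -> cl K b -> K b.
Proof.
move=> KB Bb Kb; apply: contrapT => nKb; apply: (Bind Bb); apply: cl_subset Kb => y Ky.
by split; [exact: KB | move=> yb; apply: nKb; rewrite -yb].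
Qed.

(** Both enlargements have this shape: a whole block adjoined along its orbit, or a single basis
    element outside all blocks, sent to itself. *)
Lemma good_step R d (x : nat -> F) : good R -> (0 < d)%N ->
    (forall j, (j < d)%N -> B (x j) /\ ~ pdom R (x j)) ->
    (forall i j, (i < d)%N -> (j < d)%N -> x i = x j -> i = j) ->
    cl (pdom R `|` [set x j | j in [set j | (j < d)%N]]) (x d) ->
    cl (pdom R `|` [set x j.+1 | j in [set j | (j < d)%N]]) (x 0%N) ->
    (forall l i j, valid_code l -> (i < block_size l)%N -> (j < d)%N -> block_elt l i = x j ->
      [/\ block_size l = d, (forall c, c \in l -> pdom R c) &
        forall j, (j <= d)%N -> orbit l j = x j]) ->
  exists R', [/\ good R', R `<=` R' & pdom R' (x 0%N)].
Proof.
move=> gR d0 xB xI xd x0 xblock; have [iR Rr Rcl Rgen Rblock] := gR.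
set K := pdom R in xB xd x0 xblock; set N := [set x j | j in _] in xd.
have BN : N `<=` B by move=> _ [j /= ltjd <-]; have [] := xB j ltjd.
have [|R' [iR' RR' R'x R'd R'r]] :=
    @block_extension F R K d x iR erefl Rr (good_alg_closed gR) _ d0 xd x0.
  move=> i ltid h; have [Bi nKi] := xB i ltid; apply: (Bind Bi).
  apply: cl_trans h => z [Kz|[j /= [ltjd ji] <-]].
    apply: cl_subset (Rgen z Kz) => b [Bb Kb]; split=> // bi; by apply: nKi; rewrite -bi.
  apply: cl_self; split; first by have [] := xB j ltjd.
  by move=> /(xI _ _ ltjd ltid).
rewrite -/N in R'd R'r.
have KK' : K `<=` pdom R' by move=> z [y Ry]; exists y; exact: RR'.
have NK' : N `<=` pdom R' by move=> z Nz; rewrite R'd; apply: cl_self; right.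
exists R'; split=> //; last by apply: NK'; exists 0%N.
split=> //; first by rewrite R'd R'r.
- by rewrite R'd => z; apply: cl_trans.
- rewrite {1}R'd => z; apply: cl_trans => {}z [Kz|Nz].
    by apply: cl_subset (Rgen z Kz) => b [Bb Kb]; split=> //; exact: KK'.
  by apply: cl_self; split; [exact: BN | exact: NK'].
(* By independence of the basis, a block element in the new domain is either in the old domain or
   one of the x_j. *)
- move=> l i lv lti; rewrite {1}R'd => /(cl_trans (S := (B `&` K) `|` N)) Xi.
  have {Xi} : (B `&` K `|` N) (block_elt l i).
    apply: basis_mem_cl; [by move=> z [[]|/BN] | exact: eB |].
    apply: Xi => z [Kz|Nz]; last by apply: cl_self; right.
    by apply: cl_subset (Rgen z Kz) => b; left.
  case=> [[_ Kli]|[j /= ltjd E]].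
    have [lK lR] := Rblock l i lv lti Kli.
    by split=> [c /lK|j ltj]; [exact: KK' | apply: RR'; exact: lR].
  have [sz lK lx] := xblock l i j lv lti ltjd (esym E).
  split=> [c /lK|k]; first exact: KK'.
  by rewrite sz => ltk; rewrite !lx // 1?ltnW //; exact: R'x.
Qed.

Lemma good0 : good [set p | p.1 = p.2 /\ cl set0 p.1].
Proof.
have [K1 KD KN KM KV] := cl_subfield (set0 : set F).
set R := [set p | _]; have Rd : pdom R = cl set0.
  by rewrite eqEsubset; split=> z; [case=> y [] | exists z].
have Rr : pran R = cl set0.
  by rewrite eqEsubset; split=> z; [case=> y [/= -> ] | exists z].
split.
- split; first by [].
  + by move=> x x' y y' [/= -> Ky] [/= -> Ky']; split=> //=; exact: KD.
  + by move=> x y [/= -> Ky]; split=> //=; exact: KN.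
  + by move=> x x' y y' [/= -> Ky] [/= -> Ky']; split=> //=; exact: KM.
  + split; [|by move=> y [/= <-]|by move=> y [/= ->]].
    by move=> x y [/= -> Ky]; split=> //=; exact: KV.
- by rewrite Rd Rr.
- by rewrite Rd => z; apply: cl_trans.
- by rewrite Rd => z; apply: cl_subset.
- move=> l i lv lti; rewrite Rd => Xi; case: (Bind (eB l i (level l))).
  exact: cl_subset Xi.
Qed.

(** By induction on the rank, every basis element lies in a maximal domain. For an element of a
    block, the coefficients are algebraic over basis elements of smaller rank, hence already
    present, and the whole block could be adjoined; any other element could be adjoined as a fixed
    point. *)
Lemma exists_good_total : exists2 R, good R & forall x, pdom R x.
Proof.
have [|R [gR _] Rmax] := @zorn_above _ good _ good0.
  move=> C C0 Cgood _ tot; set U := \bigcup_(R in C) R.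
  have Cd R : C R -> pdom R `<=` pdom U by move=> CR z [y Ry]; exists y, R.
  have Ud z : pdom U z -> exists2 R, C R & pdom R z by move=> [y [R CR Ry]]; exists R => //; exists y.
  have Ucl : cl (pdom U) `<=` pdom U.
    move=> z [s [sU sz]].
    have /choice [f fP] y : exists u, y \in s -> U (y, u).
      by case: (boolP (y \in s)) => [/sU [u Uu]|]; [exists u | exists 0].
    have [|R CR Rs] := @chain_seq _ C [seq (y, f y) | y <- s] C0 tot.
      by move=> _ /mapP [y ys ->]; have [R CR Ry] := fP y ys; exists R.
    apply: (Cd R CR); have [_ _ Rcl _ _] := Cgood R CR; apply: Rcl; exists s; split=> // y ys.
    by exists (f y); apply: Rs; exact: map_f.
  split.
  - by apply: bigcup_partial_iso => // R /Cgood [].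
  - rewrite eqEsubset; split=> z.
      move=> [y [R CR Ryz]]; apply: (Cd R CR); have [_ <- _ _ _] := Cgood R CR; by exists y.
    move=> /Ud [R CR]; have [_ Rr _ _ _] := Cgood R CR; rewrite -Rr => -[y Ryz].
    by exists y, R.
  - exact: Ucl.
  - move=> z /Ud [R CR Rz]; have [_ _ _ Rgen _] := Cgood R CR.
    by apply: cl_subset (Rgen z Rz) => b [Bb Rb]; split=> //; exact: Cd Rb.
  - move=> l i lv lti /Ud [R CR Rli]; have [_ _ _ _ Rblock] := Cgood R CR.
    have [lR lx] := Rblock l i lv lti Rli.
    by split=> [c /lR|j ltj]; [exact: Cd | exists R => //; exact: lx].
exists R => //; have [iR Rr Rcl Rgen Rblock] := gR.
suff BR : B `<=` pdom R by move=> x; apply: Rcl; exact: cl_subset (Bcl x).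
move=> b; have [k] := ubnP (rk b); elim: k b => // k IH b rkb Bb; apply: contrapT => nRb.
have no_step R' : good R' -> R `<=` R' -> pdom R' b -> False.
  by move=> gR' RR' [y R'by]; apply: nRb; exists y; exact: Rmax R'by.
have [[l [i [lv lti bE]]]|nblock] :=
    pselect (exists l i, [/\ valid_code l, (i < block_size l)%N & b = block_elt l i]).
  have lR c : c \in l -> pdom R c.
    move=> cl; apply: Rcl; exists (supp c); split; last exact: suppP.
    move=> y yc; apply: IH; last exact: suppB yc.
    apply: leq_trans (rk_supp_lt cl yc) _; move: rkb; rewrite bE rkE ltnS; exact.
  have nX j : (j < block_size l)%N -> ~ pdom R (block_elt l j).
    move=> ltj Rj; apply: nRb; have [_ lx] := Rblock l j lv ltj Rj.
    by exists (orbit l i.+1); rewrite bE -(orbit_lt lti); exact: lx.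
  have [d0 l0] := andP lv.
  have sub_cl X : [/\ subfield (cl (pdom R `|` X)), (forall c, c \in l -> cl (pdom R `|` X) c) &
      cl (pdom R `|` X) 0].
    have Xsub := cl_subfield (pdom R `|` X); split=> //; last exact: subring0 (subfield_subring Xsub).
    by move=> c /lR Rc; apply: cl_self; left.
  have lmem j : (j < size l)%N -> l`_j \in l by exact: mem_nth.
  have szl : (block_size l < size l)%N by rewrite /block_size prednK //; move: d0; rewrite /block_size; case: (size l).
  have lastl : last 0 l \in l.
    by rewrite -nth_last; apply: lmem.
  have [|||||R' [gR' RR' [y R'y]]] := @good_step R (block_size l) (orbit l) gR d0.
  - by move=> j ltj; rewrite orbit_lt //; split; [exact: eB | exact: nX].
  - by move=> a b' lta ltb; rewrite !orbit_lt // => /eI [].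
  - rewrite /orbit ltnn; set X := [set _ | _ in _].
    have [[K1 KD KN KM KV] lK K0] := sub_cl X.
    have Xring := subfield_subring (cl_subfield (pdom R `|` X)).
    have KX j : (j < block_size l)%N -> cl (pdom R `|` X) (block_elt l j).
      by move=> ltj; apply: cl_self; right; exists j => //=; rewrite ltj.
    apply: (KM); last by apply: KV; exact: lK.
    apply: (KD); last first.
      apply: (KN); apply: subring_sum => // j _; apply: (KM); [apply/lK/lmem | apply: KX];
        by move: (ltn_ord j) szl; rewrite /block_size; lia.
    apply: (KD); first exact: KX.
    by apply: (KN); apply/lK/lmem; apply: leq_ltn_trans szl.
  - rewrite orbit_lt // orbit_endE //; set X := [set _ | _ in _].
    have [[K1 KD KN KM KV] lK K0] := sub_cl X.
    have Xring := subfield_subring (cl_subfield (pdom R `|` X)).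
    have KX j : (j < block_size l)%N -> cl (pdom R `|` X) (orbit l j.+1).
      by move=> ltj; apply: cl_self; right; exists j.
    apply: (KD).
      apply: (KD); last by apply/lK/lmem; apply: leq_ltn_trans szl.
      apply: (KM); first exact: lK.
      by rewrite -(prednK d0); apply: KX; rewrite prednK.
    apply: subring_sum => // j _; apply: (KM).
      by apply/lK/lmem; move: (ltn_ord j) szl; rewrite /block_size; lia.
    have ltj : (j.+1 < block_size l)%N by move: (ltn_ord j); rewrite /block_size; lia.
    by rewrite -(orbit_lt ltj); apply: KX; exact: ltnW.
  - move=> l' a j lv' lta ltj; rewrite orbit_lt // => /eI [-> _ _].
    by split.
  - apply: (no_step R' gR' RR').
    have [_ _ _ _ R'block] := gR'.
    have [|_ R'x] := R'block l 0%N lv d0; first by exists y; rewrite -(orbit_lt d0).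
    by exists (orbit l i.+1); rewrite bE -(orbit_lt lti); exact: R'x.
have [|||||R' [gR' RR' R'b]] := @good_step R 1 (fun=> b) gR isT.
- by move=> j _; split.
- by move=> [|i] [|j].
- by apply: cl_self; right; exists 0%N.
- by apply: cl_self; right; exists 0%N.
- by move=> l i j lv lti _ E; case: nblock; exists l, i.
- exact: no_step R'b.
Qed.

Lemma exists_generic_aut : exists2 sigma : {rmorphism F -> F},
  twisted_solvable sigma & forall y, exists x, sigma x = y.
Proof.
have [R [iR Rr _ _ Rblock] Rtot] := exists_good_total.
have /choice [s sP] := Rtot; have [R1 RD RN RM _] := iR.
have sE x y : R (x, y) -> s x = y by move=> Rxy; exact: related_fun (sP x) Rxy.
have [||| sigma sigmaE] := @rmorphism_of_morph F s.
- by move=> x y; apply: sE; apply: RD.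
- by move=> x y; apply: sE; apply: RM.
- exact: sE.
exists sigma; last first.
  by move=> y; have := Rtot y; rewrite -Rr => -[x /sE <-]; exists x.
move=> d c c0 [i ltid ci].
(* Trailing zero coefficients are dropped, because the equation is solved for its last term. *)
have [d' ltd' [cd' clast]] : exists2 d', (d' < d)%N & c d' != 0 /\
    forall j, (d' < j < d)%N -> c j = 0.
  have ex : exists k, (k < d)%N && (c k != 0) by exists i; rewrite ltid.
  have ub k : (k < d)%N && (c k != 0) -> (k <= d)%N by move=> /andP[/ltnW].
  case: (ex_maxnP ex ub) => k /andP[ltkd ck] kmax; exists k => //; split=> // j /andP[ltkj ltjd].
  by apply/eqP/negPn/negP => cj; have := kmax j; rewrite ltjd cj leqNgt ltkj => /(_ isT).
pose l := c0 :: map c (iota 0 d'.+1).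
have szl : block_size l = d'.+1 by rewrite /block_size /= size_map size_iota.
have lS j : (j <= d')%N -> l`_j.+1 = c j.
  move=> lej; rewrite -[l`_j.+1]/((map c (iota 0 d'.+1))`_j).
  by rewrite (nth_map 0%N) ?size_iota // nth_iota.
have lastE : last 0 l = c d'.
  by rewrite -nth_last -/(block_size l) szl lS.
have lv : valid_code l by rewrite /valid_code szl lastE cd'.
have d0 : (0 < block_size l)%N by rewrite szl.
have [_ lx] := Rblock l 0%N lv d0 (Rtot _).
have iterE j : (j <= d'.+1)%N -> iter j sigma (block_elt l 0) = orbit l j.
  elim: j => [|j IH] lej; first by rewrite orbit_lt.
  by rewrite iterS IH 1?ltnW // sigmaE; apply: sE; apply: lx; rewrite szl.
exists (block_elt l 0).
  apply/eqP => X0; apply: (Bind (eB l 0 (level l))); rewrite -/(block_elt l 0) X0.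
  exact: subring0 (subfield_subring (cl_subfield _)).
have -> : \sum_(i < d) c i * iter i.+1 sigma (block_elt l 0) =
    \sum_(i < d'.+1) c i * iter i.+1 sigma (block_elt l 0).
  rewrite (big_ord_widen d (fun i => c i * iter i.+1 sigma (block_elt l 0)) ltd') [RHS]big_mkcond.
  by apply: eq_bigr => j _; case: ltnP => // ltj; rewrite clast ?mul0r // ltj ltn_ord.
rewrite big_ord_recr [LHS]orbit_endE // szl iterE // lastE -addrA [RHS]addrA [RHS]addrC; congr (_ + (_ + _)).
apply: eq_bigr => j _; have ltj := ltn_ord j.
by rewrite lS 1?ltnW // iterE 1?ltnW // orbit_lt // szl.
Qed.

End GenericAutomorphism.

Lemma infinite_trdeg_generic_aut (F : closedFieldType) : ~ finite_trdeg F ->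
  exists2 sigma : {rmorphism F -> F}, twisted_solvable sigma & forall y, exists x, sigma x = y.
Proof.
move=> nfin; have [B Bind Bcl] := exists_basis F.
have [iota iotaI iotaB] := basis_infinite nfin Bind Bcl.
have [e eB eI] := basis_coding iotaI iotaB Bcl.
(* The rank is the last component of the code, and 0 off the image of [e]. *)
have /choice [rk rkP] x : exists k, forall l i k', x = e l i k' -> k' = k.
  have [[l [i [k ->]]]|nx] := pselect (exists l i k, x = e l i k).
    by exists k => l' i' k' /eI [_ _ ->].
  by exists 0%N => l i k xE; case: nx; exists l, i, k.
have /choice [supp suppP] x : exists s, (forall y, y \in s -> B y) /\ acl s x := Bcl x.
apply: (@exists_generic_aut F B Bind Bcl e eB eI rk supp).
- by move=> l i k; rewrite -(rkP _ l i k erefl).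
- by move=> x y; exact: (suppP x).1.
- by move=> x; exact: (suppP x).2.
Qed.

Theorem mainTheorem1 (F : closedFieldType) (n : nat) (hn : (2 <= n)%N) :
  (R_infty_property (@SLpred F n) <-> ([pchar F] =i pred0 /\ finite_trdeg F)) /\
  (R_infty_property (@GLpred F n) <-> ([pchar F] =i pred0 /\ finite_trdeg F)).
Proof.
have char0 (P : Prop) : (forall sigma : {rmorphism F -> F}, twisted_solvable sigma ->
    (forall y, exists x, sigma x = y) -> ~ P) -> P -> [pchar F] =i pred0 /\ finite_trdeg F.
  move=> nP HP; split.
    move=> p; apply/negP => charFp.
    exact: nP (frob_twisted_solvable charFp) (frob_surj charFp) HP.
  apply: contrapT => /infinite_trdeg_generic_aut [sigma solv surj].
  exact: nP solv surj HP.
case: n hn => [|[|m]] // _; split; split.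
- by apply: char0 => sigma solv surj; apply: sl_not_R_infty solv surj _.
- by move=> [F0 Ffin]; have [] := finite_trdeg_R_infty F0 m Ffin.
- by apply: char0 => sigma solv surj; apply: gl_not_R_infty solv surj _.
- by move=> [F0 Ffin]; have [] := finite_trdeg_R_infty F0 m Ffin.
Qed.
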